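(* Let $v$ be an admissible weight function on $\mathbb{R}^{2d}$ and let $\varphi\in\mathcal{S}(\mathbb{R}^d)\setminus\{0\}$. For any $\tau\in(0,1)$, the following properties are equivalent: (i) $\sigma\in W(\mathcal{F}L^\infty,L^1_{v\circ\mathcal{B}_\tau})(\mathbb{R}^{2d})$. (ii) $\sigma\in\mathcal{S}'(\mathbb{R}^{2d})$ and there exists a function $H_\tau\in L^1_v(\mathbb{R}^{2d})$ such that $$|\langle\mathrm{Op}_\tau(\sigma)\pi(z)\varphi,\pi(w)\varphi\rangle|\le H_\tau(w-\mathcal{U}_\tau z)\qquad\forall w,z\in\mathbb{R}^{2d}.$$ Here $$\mathcal{B}_\tau=\begin{pmatrix}\frac{1}{1-\tau}I_{d\times d}&0\\0&\frac1\tau I_{d\times d}\end{pmatrix},\qquad \mathcal{U}_\tau=-\begin{pmatrix}\frac{\tau}{1-\tau}I_{d\times d}&0\\0&\frac{1-\tau}{\tau}I_{d\times d}\end{pmatrix}.$$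
   Context: Admissible weight: a non-negative continuous function $v$ on $\mathbb{R}^{2d}$ with $v(0)=1$, even in each coordinate, submultiplicative ($v(w+z)\le v(w)v(z)$ for all $w,z$), and satisfying the GRS condition $\lim_{n\to\infty}v(nz)^{1/n}=1$ for all $z$. Time-frequency shifts: for $z=(x,\omega)\in\mathbb{R}^{2d}$, $\pi(z)f(t)=e^{2\pi i\omega\cdot t}f(t-x)$; analogously $\pi(z,\zeta)$, $z,\zeta\in\mathbb{R}^{2d}$, on $\mathbb{R}^{2d}$. The bracket $\langle f,g\rangle$ extends $\int f\overline{g}$ to $\mathcal{S}'\times\mathcal{S}$. Short-time Fourier transform on $\mathbb{R}^{2d}$: $V_G\sigma(z,\zeta)=\langle\sigma,\pi(z,\zeta)G\rangle$. $\tau$-Wigner distribution: $W_\tau(f,g)(x,\omega)=\int_{\mathbb{R}^d}e^{-2\pi i y\cdot\omega}f(x+\tau y)\overline{g(x-(1-\tau)y)}\,dy$. The $\tau$-pseudodifferential operator with symbol $\sigma\in\mathcal{S}'(\mathbb{R}^{2d})$ is $\mathrm{Op}_\tau(\sigma):\mathcal{S}(\mathbb{R}^d)\to\mathcal{S}'(\mathbb{R}^d)$, $\langle\mathrm{Op}_\tau(\sigma)f,g\rangle=\langle\sigma,W_\tau(g,f)\rangle$, $f,g\in\mathcal{S}(\mathbb{R}^d)$. Wiener amalgam space: for a weight $u$ on $\mathbb{R}^{2d}$, $W(\mathcal{F}L^\infty,L^1_u)(\mathbb{R}^{2d})$ consists of $\sigma\in\mathcal{S}'(\mathbb{R}^{2d})$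 with $\int_{\mathbb{R}^{2d}}\sup_{\zeta\in\mathbb{R}^{2d}}|V_G\sigma(z,\zeta)|\,u(z)\,dz<\infty$, where $G\in\mathcal{S}(\mathbb{R}^{2d})\setminus\{0\}$ is a fixed window; it is a standing convention that the space does not depend on the choice of $G$ (different choices give equivalent norms). $L^1_v(\mathbb{R}^{2d})$ has norm $\int|H|v$. *)

(* Defs.v *)
From HB Require Import structures.
From mathcomp Require Import all_boot all_order all_algebra.
From mathcomp Require Import all_classical all_reals all_analysis.
From mathcomp Require Import complex.

Set Implicit Arguments.
Unset Strict Implicit.
Unset Printing Implicit Defensive.

Import Order.TTheory GRing.Theory Num.Theory.
Import numFieldNormedType.Exports.

Local Open Scope classical_set_scope.
Local Open Scope ring_scope.

(** * Lebesgue measure on R^n = 'rV[R]_n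

The sigma-algebra on ['rV[R]_n] is generated by the coordinate maps, i.e. it
is the product of the Borel sigma-algebras.  The measure is the n-fold product
of [lebesgue_measure], built by recursion along [R * R^n ~ R^(n+1)]. *)

Definition measure_rV_display : measure_display -> measure_display.
Proof. exact. Qed.

Section measurable_rV.
Context {d : measure_display} {T : measurableType d}.
Variable n : nat.

Let coors : 'I_n -> 'rV[T]_n -> T := fun i x => x ord0 i.

Let rV_set0 : g_sigma_preimage coors set0.
Proof. exact: sigma_algebra0. Qed.

Let rV_setC A : g_sigma_preimage coors A -> g_sigma_preimage coors (~` A).
Proof. exact: sigma_algebraC. Qed.

Let rV_bigcup (F : (set 'rV[T]_n)^nat) :
  (forall i, g_sigma_preimage coors (F i)) ->
  g_sigma_preimage coors (\bigcup_i (F i)).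
Proof. exact: sigma_algebra_bigcup. Qed.

HB.instance Definition _ := @isMeasurable.Build (measure_rV_display d)
  'rV[T]_n (g_sigma_preimage coors) rV_set0 rV_setC rV_bigcup.

Lemma measurable_rV_coord (i : 'I_n) :
  measurable_fun [set: 'rV[T]_n] (fun x : 'rV[T]_n => x ord0 i).
Proof.
move=> _ Y mY; rewrite setTI; apply: sub_sigma_algebra => /=.
rewrite -bigcup_seq/=; exists i => /=; first by rewrite mem_index_enum.
by exists Y => //; rewrite setTI.
Qed.

Lemma measurable_fun_rVP d1 (T1 : measurableType d1) (f : T1 -> 'rV[T]_n) :
  (forall i, measurable_fun [set: T1] (fun x => f x ord0 i)) ->
  measurable_fun [set: T1] f.
Proof.
move=> mf _ A mA; rewrite setTI.
suff : g_sigma_preimage coors `<=` [set B | measurable (f @^-1` B)] by apply.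
apply: smallest_sub.
  split => [|B|F] /=.
  - by rewrite preimage_set0; exact: measurable0.
  - by move=> mB; rewrite setTD preimage_setC; exact: measurableC.
  - by move=> mF; rewrite preimage_bigcup; exact: bigcup_measurable.
rewrite -bigcup_seq => B [i _ [C mC <-]] /=.
rewrite setTI -comp_preimage -[X in measurable X]setTI.
exact: mf.
Qed.

End measurable_rV.

Section lebesgue_rV.
Variable R : realType.

Definition rV_cons n (p : measurableTypeR R * 'rV[R]_n) : 'rV[R]_n.+1 :=
  \row_(i < n.+1) if unlift ord0 i is Some j then p.2 ord0 j else p.1.

Definition rV_uncons n (x : 'rV[R]_n.+1) : measurableTypeR R * 'rV[R]_n :=
  (x ord0 ord0, \row_(j < n) x ord0 (lift ord0 j)).

Lemma rV_consK n : cancel (@rV_cons n) (@rV_uncons n).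
Proof.
move=> [a x]; rewrite /rV_uncons /rV_cons mxE unlift_none; congr pair.
by apply/rowP => j; rewrite !mxE liftK.
Qed.

Lemma measurable_rV_cons n : measurable_fun setT (@rV_cons n).
Proof.
apply: measurable_fun_rVP => i.
under eq_fun do rewrite mxE.
case: (unlift ord0 i) => [j|]; last exact: measurable_fst.
by apply: (measurableT_comp (measurable_rV_coord j)); exact: measurable_snd.
Qed.

Lemma measurable_rV_uncons n : measurable_fun setT (@rV_uncons n).
Proof.
apply/measurable_fun_pairP; split; first exact: (measurable_rV_coord ord0).
apply: measurable_fun_rVP => i /=.
under eq_fun do rewrite mxE.
exact: measurable_rV_coord.
Qed.

Section lebesgue_rVS.
Variables (n : nat) (mu : {sigma_finite_measure set 'rV[R]_n -> \bar R}).

Let leb : {sigma_finite_measure set (measurableTypeR R) -> \bar R} :=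
  @lebesgue_measure R.

Definition lebesgue_rVS : set 'rV[R]_n.+1 -> \bar R :=
  pushforward (leb \x mu)%E (@rV_cons n).

Let mf := @measurable_rV_cons n.

Let lebesgue_rVS0 : lebesgue_rVS set0 = 0%E.
Proof. by rewrite /lebesgue_rVS /pushforward preimage_set0 measure0. Qed.

Let lebesgue_rVS_ge0 A : (0 <= lebesgue_rVS A)%E.
Proof. exact: measure_ge0. Qed.

Let lebesgue_rVS_semi_sigma_additive : semi_sigma_additive lebesgue_rVS.
Proof.
exact: (@measure_semi_sigma_additive _ _ _
  (measure_function_pushforward__canonical__measure_function_Measure
     (leb \x mu)%E mf)).
Qed.

HB.instance Definition _ := isMeasure.Build _ _ _ lebesgue_rVS
  lebesgue_rVS0 lebesgue_rVS_ge0 lebesgue_rVS_semi_sigma_additive.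

Let lebesgue_rVS_sigma_finite : sigma_finite setT lebesgue_rVS.
Proof.
have /sigma_finiteP[F [TF ndF Foo]] := sigma_finiteT leb.
have /sigma_finiteP[G [TG ndG Goo]] := sigma_finiteT mu.
exists (fun k => @rV_uncons n @^-1` (F k `*` G k)).
  rewrite -preimage_bigcup -(preimage_setT (@rV_uncons n)); congr (_ @^-1` _).
  rewrite -setXTT TF TG predeqE => -[x y]; split.
    move=> [/= [i _ Fix] [k _ Gky]]; exists (maxn i k) => //; split.
    - by move: x Fix; exact/subsetPset/ndF/leq_maxl.
    - by move: y Gky; exact/subsetPset/ndG/leq_maxr.
  by move=> [i _ []/= ? ?]; split; exists i.
move=> k; have [? ?] := Foo k; have [? ?] := Goo k; split.
  rewrite -[X in measurable X]setTI; apply: measurable_rV_uncons => //.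
  exact: measurableX.
rewrite /lebesgue_rVS /pushforward -comp_preimage.
rewrite (_ : @rV_uncons n \o _ = id); last first.
  by apply/funext => x /=; rewrite rV_consK.
by rewrite preimage_id product_measure1E// lte_mul_pinfty// ge0_fin_numE.
Qed.

HB.instance Definition _ := Measure_isSigmaFinite.Build _ _ _ lebesgue_rVS
  lebesgue_rVS_sigma_finite.

End lebesgue_rVS.

Fixpoint lebesgue_rV (n : nat) : {sigma_finite_measure set 'rV[R]_n -> \bar R} :=
  if n is m.+1 then lebesgue_rVS (lebesgue_rV m) else \d_(0 : 'rV[R]_0).

End lebesgue_rV.

Section functions_on_Rn.
Variables (R : realType) (n : nat).
Implicit Types (f g : 'rV[R]_n -> R[i]) (x y w : 'rV[R]_n).

(* [`|z|] on [R[i]] is again an element of [R[i]]; this is its real version *)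
Definition cabs (z : R[i]) : R := ComplexField.Normc.normc z.

Definition expi (t : R) : R[i] := Complex (cos t) (sin t).

Definition dotp x y : R := \sum_(i < n) x ord0 i * y ord0 i.

Definition cintegral f : R[i] :=
  Complex (\int[lebesgue_rV R n]_x complex.Re (f x))
          (\int[lebesgue_rV R n]_x complex.Im (f x)).

Definition basis_vec (i : 'I_n) : 'rV[R]_n := delta_mx ord0 i.

Definition pderiv (i : 'I_n) f : 'rV[R]_n -> R[i] := fun x =>
  Complex ('D_(basis_vec i) (fun y => complex.Re (f y)) x)
          ('D_(basis_vec i) (fun y => complex.Im (f y)) x).

Definition pderivable (i : 'I_n) f x : Prop :=
  derivable (fun y => complex.Re (f y)) x (basis_vec i) /\
  derivable (fun y => complex.Im (f y)) x (basis_vec i).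

(* A derivative of order [k] is given by the sequence of the [k] directions in
   which one differentiates; the multi-index derivatives are among these, and
   for smooth functions there are no others. *)
Definition pderivs (s : seq 'I_n) f : 'rV[R]_n -> R[i] := foldr pderiv f s.

Definition smooth f : Prop := forall s : seq 'I_n,
  [/\ continuous (fun x => complex.Re (pderivs s f x)),
      continuous (fun x => complex.Im (pderivs s f x)) &
      forall i x, pderivable i (pderivs s f) x].

Definition monomial (a : 'I_n -> nat) x : R := \prod_(i < n) x ord0 i ^+ a i.

Definition schwartz_seminorm (a : 'I_n -> nat) (s : seq 'I_n) f : \bar R :=
  ereal_sup (range (fun x => (`|monomial a x| * cabs (pderivs s f x))%:E)).

Definition schwartz f : Prop :=
  smooth f /\ forall a s, (schwartz_seminorm a s f < +oo)%E.

(** ** Tempered distributions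

A tempered distribution [sigma] is represented by its bracket
[g |-> <sigma, g>], which extends [\int sigma (conj g)] and is therefore
antilinear in the test function.  Only the values of the functional on Schwartz
functions are meaningful. *)

Definition functional := ('rV[R]_n -> R[i]) -> R[i].

Definition antilinear_on_schwartz (sigma : functional) : Prop :=
  forall (c : R[i]) f g, schwartz f -> schwartz g ->
    sigma (fun x => c * f x + g x) = conjc c * sigma f + sigma g.

(* continuity for the locally convex topology defined by the seminorms *)
Definition continuous_on_schwartz (sigma : functional) : Prop :=
  forall f, schwartz f -> forall e : R, 0 < e ->
  exists (N : nat) (delta : R), 0 < delta /\
    forall g, schwartz g ->
      (forall a s, (\sum_(i < n) a i <= N)%N -> (size s <= N)%N ->
         (schwartz_seminorm a s (fun x => g x - f x)%R < delta%:E)%E) ->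
      cabs (sigma g - sigma f) < e.

Definition tempered (sigma : functional) : Prop :=
  antilinear_on_schwartz sigma /\ continuous_on_schwartz sigma.

Definition tf_shift x w f : 'rV[R]_n -> R[i] :=
  fun t => expi (2 * pi * dotp w t) * f (t - x).

Definition stft (G : 'rV[R]_n -> R[i]) (sigma : functional) x w : R[i] :=
  sigma (tf_shift x w G).

Definition weighted_L1 (u : 'rV[R]_n -> R) (H : 'rV[R]_n -> R) : Prop :=
  measurable_fun setT H /\
  (\int[lebesgue_rV R n]_x (`|H x| * u x)%:E < +oo)%E.

(* [sigma] belongs to W(F L^oo, L^1_u), the norm being computed with [G] *)
Definition amalgam (G : 'rV[R]_n -> R[i]) (u : 'rV[R]_n -> R)
    (sigma : functional) : Prop :=
  tempered sigma /\
  (\int[lebesgue_rV R n]_z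
     (ereal_sup (range (fun zeta => (cabs (stft G sigma z zeta))%:E))
      * (u z)%:E) < +oo)%E.

(* the convention under which W(F L^oo, L^1_u) is used without reference to a
   window; it is a condition on [u] *)
Definition window_independent (u : 'rV[R]_n -> R) : Prop :=
  forall G1 G2 : 'rV[R]_n -> R[i],
    schwartz G1 -> G1 <> (fun=> 0) -> schwartz G2 -> G2 <> (fun=> 0) ->
    forall sigma, amalgam G1 u sigma -> amalgam G2 u sigma.

Definition flip_coord (i : 'I_n) x : 'rV[R]_n :=
  \row_j if j == i then - x ord0 j else x ord0 j.

End functions_on_Rn.

Section phase_space.
Variables (R : realType) (d : nat).
Implicit Types (f g : 'rV[R]_d -> R[i]) (z w : 'rV[R]_(d + d)).

Record admissible (v : 'rV[R]_(d + d) -> R) : Prop := Admissible {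
  admissible_ge0 : forall z, 0 <= v z ;
  admissible_continuous : continuous v ;
  admissible0 : v 0 = 1 ;
  admissible_even : forall i z, v (flip_coord i z) = v z ;
  admissible_submultiplicative : forall w z, v (w + z) <= v w * v z ;
  admissible_GRS : forall z,
    (fun k : nat => v (k%:R *: z) `^ (k%:R^-1)) @ \oo --> (1 : R) }.

(* a point of R^(2d) is [row_mx x omega] *)
Definition phase_shift z f : 'rV[R]_d -> R[i] :=
  tf_shift (lsubmx z) (rsubmx z) f.

Definition tau_wigner (tau : R) f g : 'rV[R]_(d + d) -> R[i] := fun z =>
  let x := lsubmx z in let omega := rsubmx z in
  cintegral (fun y : 'rV[R]_d =>
    expi (- (2 * pi * dotp y omega))
    * f (x + tau *: y) * conjc (g (x - (1 - tau) *: y))).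

Definition Op_tau (tau : R) (sigma : functional R (d + d)) f : functional R d :=
  fun g => sigma (tau_wigner tau g f).

Definition B_tau (tau : R) : 'M[R]_(d + d) :=
  block_mx (1 / (1 - tau))%:M 0 0 (1 / tau)%:M.

Definition U_tau (tau : R) : 'M[R]_(d + d) :=
  - block_mx (tau / (1 - tau))%:M 0 0 ((1 - tau) / tau)%:M.

(* [A] acting on column vectors, points being stored as rows *)
Definition mxapp (A : 'M[R]_(d + d)) z : 'rV[R]_(d + d) := (A *m z^T)^T.

End phase_space.

(* Main.v *)
Require Import Defs.
From mathcomp Require Import all_boot all_order all_algebra.
From mathcomp Require Import all_classical all_reals all_analysis.
From mathcomp Require Import measurable_realfun complex ring lra.

Set Implicit Arguments.
Unset Strict Implicit.
Unset Printing Implicit Defensive.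

Import Order.TTheory GRing.Theory Num.Theory.
Import numFieldNormedType.Exports.
Import ComplexField.Normc.

Local Open Scope classical_set_scope.
Local Open Scope ring_scope.

(** Let [Phi] be the [tau]-Wigner distribution of [phi] with itself.  A phase
    space shift of each argument of the [tau]-Wigner distribution amounts to one
    time-frequency shift of the result ([wigner_covariance]), so that the matrix
    entry [<Op_tau(sigma) pi(z) phi, pi(w) phi>] has the modulus of the
    short-time Fourier transform of [sigma], with window [Phi], at a point with
    position [T] and modulation [J].  Here [(w, z) |-> (T, J)] is onto, and
    [B_tau T = w - U_tau z]: a bound by [H (w - U_tau z)] is the same thing as a
    bound of [V_Phi sigma (p, q)] by [H (B_tau p)], uniform in [q].  The linear
    change of variables [B_tau] turns integrability of [H] against [v] into
    integrability against [v o B_tau], which is the amalgam condition with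
    window [Phi]; independence of the window then links [Phi] with [G].

    Three facts make this argument complete.

    First, [Phi] is a Schwartz function.  The span of all [W_tau(f, g)], with
    [f] and [g] Schwartz, consists of bounded functions and is stable under
    partial derivatives and under multiplication by coordinates
    ([wigner_span_deriv], [wigner_span_coord]); this alone forces its elements to
    be Schwartz ([schwartz_bounded_coind]).  Multiplication by a frequency is an
    integration by parts, which comes from differentiating the translation
    invariance of the integral.

    Second, [Phi] is not zero.  If it were, all Fourier integrals of
    [y |-> phi (a + tau y) conj (phi (a - (1 - tau) y))] would vanish, hence so
    would this function at [0] ([fourier_vanish]), that is [|phi a| ^ 2] for every
    [a].  The reason is that the multipliers that preserve the vanishing of all
    Fourier integrals are stable under products with cosines and under bounded
    pointwise limits, so that they contain the powers of a product of squared
    cardinal sines (Viete's infinite product of cosines), and these powers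
    concentrate at the origin.

    Third, the real valued function [H] has to dominate the transform at every
    point, while the amalgam condition makes the supremum over the modulations
    finite only almost everywhere.  The derivatives of the window are windows
    too, so the suprema attached to all of them are integrable; locally they
    dominate a Sobolev norm of [z |-> V_Phi sigma (z, q)] of type [W^(n,1)],
    uniformly in [q], and such a norm controls the value at a point
    ([sobolev_point_bound], [stft_sup_finite]).  This rests on the formula
    [d_i V_g sigma = - V_(d_i g) sigma] ([stft_is_cderive]), whose proof uses
    that [sigma] is bounded on bounded families of Schwartz functions. *)

(** * Measurability and iterated integration on R^n *)
Section measure_rV.
Variable R : realType.

Lemma measurable_rV_ball n (x : 'rV[R]_n) (e : R) : measurable (ball x e).
Proof.
have [e0|e0] := ltP 0 e; last first.
  rewrite (_ : ball x e = set0)//; apply/seteqP; split => // y [].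
  by rewrite ltNge e0.
have -> : ball x e =
    \bigcap_(i in [set: 'I_n]) ((fun y : 'rV[R]_n => y ord0 i) @^-1` ball (x ord0 i) e).
  apply/seteqP; split => [y [_ xy] i _|y xy]; first exact: xy.
  by split=> // i j; rewrite (ord1 i); exact: xy.
apply: fin_bigcap_measurable => // i _.
rewrite -[X in measurable X]setTI; apply: measurable_rV_coord => //.
by apply: open_measurable; exact: ball_open.
Qed.

(** The sigma-algebra generated by the coordinates contains the open sets because
    an open set is a countable union of cubes with rational data. *)
Lemma open_measurable_rV n (O : set 'rV[R]_n) : open O -> measurable O.
Proof.
move=> oO.
pose q2r (q : 'rV[rat]_n) : 'rV[R]_n := map_mx ratr q.
(* the balls of rational centre and radius that lie in [O] *)
pose F k := if unpickle k is Some (q, m) then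
  (if `[< ball (q2r q) m.+1%:R^-1 `<=` O >] then ball (q2r q) m.+1%:R^-1 else set0)
  else set0.
have -> : O = \bigcup_k F k.
  apply/seteqP; split => [x Ox|x [k _]]; last first.
    rewrite /F; case: unpickle => [[q m]|//].
    by case: asboolP => // h; exact: h.
  have [e /= e0 eO] : nbhs_ball x O by rewrite nbhs_ballE; exact: oO.
  (* a ball of rational centre and radius below [e / 2] around [x] stays in [O] *)
  have [m me] : exists m : nat, m.+1%:R^-1 < e / 2.
    exists (Num.truncn (e / 2)^-1).
    by rewrite -ltf_pV2 ?(posrE,divr_gt0)// invrK truncnS_gt.
  have m0 : 0 < m.+1%:R^-1 :> R by rewrite invr_gt0.
  have hq i : exists q : rat, `|ratr q - x ord0 i| < m.+1%:R^-1.
    have [|q] := @rat_in_itvoo R (x ord0 i - m.+1%:R^-1) (x ord0 i + m.+1%:R^-1).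
      by rewrite ltrD2l (lt_trans _ m0)// oppr_lt0.
    by rewrite in_itv/= => /andP[h1 h2]; exists q; rewrite ltr_distl h1.
  move/choice : hq => [q hq].
  have qx : ball (q2r (\row_i q i)) m.+1%:R^-1 x.
    by split=> // i j; rewrite (ord1 i) !mxE; exact: hq.
  exists (pickle (\row_i q i : 'rV[rat]_n, m)) => //.
  rewrite /F pickleK; case: asboolP => // -[].
  move=> y qy; apply: eO; rewrite (splitr e).
  apply: (@le_ball _ _ _ (m.+1%:R^-1 + m.+1%:R^-1)); first by rewrite lerD// ltW.
  by apply: ball_triangle qy; exact: ball_sym.
apply: bigcupT_measurable => k; rewrite /F.
case: unpickle => [[q m]|//].
by case: asboolP => // _; exact: measurable_rV_ball.
Qed.

(** Stated for extended real functions so that it applies to suprema of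
    uncountably many continuous functions. *)
Lemma lsc_measurable_rV n (f : 'rV[R]_n -> \bar R) :
  (forall a : R, open [set x | (a%:E < f x)%E]) -> measurable_fun setT f.
Proof.
move=> f_open; apply: (measurability _ (ErealGenOInfty.measurableE R)) => //.
move=> _ [_ [a ->] <-]; rewrite setTI preimage_itvoy.
by apply: open_measurable_rV; exact: f_open.
Qed.

Lemma continuous_measurable_rV n (f : 'rV[R]_n -> R) :
  continuous f -> measurable_fun setT f.
Proof.
move=> cf; apply/measurable_EFinP; apply: lsc_measurable_rV => a.
rewrite (_ : [set x | _] = f @^-1` [set y | a < y]); last first.
  by apply/seteqP; split => x /=; rewrite lte_fin.
by apply: open_comp; [move=> x _; exact: cf|exact: open_gt].
Qed.

(** The integral of a nonnegative function is the supremum over the simple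
    functions below it, and there are more of these below [g] than below [f]. *)
Lemma le_nnintegral d (T : measurableType d) (mu : {measure set T -> \bar R})
    (f g : T -> \bar R) : (forall x, 0 <= f x)%E -> (forall x, f x <= g x)%E ->
  (\int[mu]_x f x <= \int[mu]_x g x)%E.
Proof.
move=> f0 fg; have g0 x : (0 <= g x)%E by exact: le_trans (fg x).
rewrite !ge0_integralTE//; apply/ge_ereal_sup => _ [h hf <-].
apply: ereal_sup_ubound; exists h => // x; exact: le_trans (fg x).
Qed.

Notation leb := (@lebesgue_rV R).

Lemma ge0_integral_rVS n (f : 'rV[R]_n.+1 -> \bar R) :
  measurable_fun setT f -> (forall x, 0 <= f x)%E ->
  (\int[leb n.+1]_x f x =
   \int[leb n]_y \int[@lebesgue_measure R]_t f (rV_cons (t, y)))%E.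
Proof.
move=> mf f0.
rewrite [LHS](_ : _ = \int[pushforward ((@lebesgue_measure R) \x leb n)%E
  (@rV_cons R n)]_x f x)%E//.
rewrite (ge0_integral_pushforward (@measurable_rV_cons R n))//.
rewrite preimage_setT fubini_tonelli2//=; last first.
  by apply: measurableT_comp => //; exact: measurable_rV_cons.
Qed.

Lemma ge0_integral_rV0 (f : 'rV[R]_0 -> \bar R) : (forall x, 0 <= f x)%E ->
  (\int[leb 0]_x f x = f 0%R)%E.
Proof.
move=> f0 /=.
have f_cst x : f x = f 0 by congr f; apply/matrixP => ? [].
rewrite (_ : f = cst (f 0)); last exact/funext.
rewrite integral_dirac//= ?diracT ?mul1e//.
Qed.

End measure_rV.

(** * Diagonal affine changes of variables and an integrable majorant *)
Section affine.
Variable R : realType.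
Notation leb := (@lebesgue_rV R).

Section affine1.
Variables (c b : R).
Hypothesis c0 : 0 < c.

Let aff1 : measurableTypeR R -> measurableTypeR R := fun t => c * t + b.

Let maff1 : measurable_fun setT aff1.
Proof.
apply: continuous_measurable_fun => x.
by apply: cvgD; [apply: cvgM; [exact: cvg_cst|exact: cvg_id]|exact: cvg_cst].
Qed.

Let push : {measure set (measurableTypeR R) -> \bar R} :=
  measure_function_pushforward__canonical__measure_function_Measure
    (@lebesgue_measure R) maff1.

Let lebesgue_aff1 (A : set R) : measurable A ->
  @lebesgue_measure R A =
  mscale (NngNum (ltW c0)) push A.
Proof.
move=> mA; apply: (@lebesgue_measure_unique R (mscale (NngNum (ltW c0)) push)) => //.
move=> _ [[x y] _ <-]; transitivity (c%:E * @lebesgue_measure R (aff1 @^-1` `]x, y]%classic))%E; last by [].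
have -> : aff1 @^-1` `]x, y]%classic = `](x - b) / c, (y - b) / c]%classic.
  apply/seteqP; split => t /=; rewrite !in_itv/= /aff1 ltr_pdivrMr// ler_pdivlMr//;
    by rewrite ltrBlDr lerBrDr (mulrC t).
rewrite !lebesgue_measure_itv/= !lte_fin ltr_pM2r ?invr_gt0// ltrD2r.
case: ifPn => // _; last by rewrite mule0.
rewrite -!EFinD -EFinM; congr EFin; field; exact: lt0r_neq0.
Qed.

(** Both sides integrate [f] against measures that agree on intervals. *)
Lemma ge0_integral_affine1 (f : measurableTypeR R -> \bar R) : measurable_fun setT f ->
  (forall x, 0 <= f x)%E ->
  (\int[@lebesgue_measure R]_t f (c * t + b)%R =
   (c^-1)%:E * \int[@lebesgue_measure R]_t f t)%E.
Proof.
move=> mf f0.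
rewrite [in RHS](_ : \int[@lebesgue_measure R]_t f t =
  \int[mscale (NngNum (ltW c0)) push]_t f t)%E; last first.
  by apply: eq_measure_integral => A mA _; exact: lebesgue_aff1.
rewrite ge0_integral_mscale//.
have := @ge0_integral_pushforward _ _ _ _ _ _ maff1 (@lebesgue_measure R) setT f
  measurableT mf (fun x _ => f0 x).
rewrite preimage_setT /= => H; rewrite [X in (_ * (_ * X))%E]H.
by rewrite muleA -EFinM mulVf ?mul1e// lt0r_neq0.
Qed.

End affine1.

Definition rV_aff n (c b : 'I_n -> R) (x : 'rV[R]_n) : 'rV[R]_n :=
  \row_i (c i * x ord0 i + b i).

Lemma measurable_rV_aff n (c b : 'I_n -> R) : measurable_fun setT (rV_aff c b).
Proof.
apply: measurable_fun_rVP => i; under eq_fun do rewrite mxE.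
apply: measurable_funD; last exact: measurable_cst.
by apply: measurable_funM; [exact: measurable_cst|exact: measurable_rV_coord].
Qed.

Lemma rV_aff_cons n (c b : 'I_n.+1 -> R) t (y : 'rV[R]_n) :
  rV_aff c b (rV_cons (t, y)) =
  rV_cons (c ord0 * t + b ord0, rV_aff (c \o lift ord0) (b \o lift ord0) y).
Proof.
apply/rowP => i; rewrite !mxE; case: unliftP => [j ->|->] //=.
by rewrite !mxE.
Qed.

Lemma ge0_integral_affine n (c b : 'I_n -> R) (f : 'rV[R]_n -> \bar R) :
  (forall i, 0 < c i) -> measurable_fun setT f -> (forall x, 0 <= f x)%E ->
  (\int[leb n]_x f (rV_aff c b x) =
   (\prod_(i < n) (c i)^-1)%:E * \int[leb n]_x f x)%E.
Proof.
elim: n c b f => [|n ih] c b f c0 mf f0.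
  rewrite !ge0_integral_rV0// big_ord0 mul1e; congr f.
  by apply/matrixP => ? [].
rewrite ge0_integral_rVS//; last first.
  by apply: measurableT_comp => //; exact: measurable_rV_aff.
under eq_integral => y _.
  under eq_integral => t _ do rewrite rV_aff_cons.
  rewrite (ge0_integral_affine1 (b ord0) (c0 ord0)
    (f := fun t => f (rV_cons (t, rV_aff (c \o lift ord0) (b \o lift ord0) y))))//; last first.
    apply: (measurableT_comp mf); apply: (measurableT_comp (@measurable_rV_cons R n)).
    exact: measurable_fun_pair.
  over.
have mF : measurable_fun setT (fun y => \int[@lebesgue_measure R]_t f (rV_cons (t, y)))%E.
  apply: (@measurable_fun_fubini_tonelli_G _ _ _ _ _ (@lebesgue_measure R)
    (f \o @rV_cons R n)) => [|x]; last exact: f0.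
  by apply: measurableT_comp => //; exact: measurable_rV_cons.
have F0 y : (0 <= \int[@lebesgue_measure R]_t f (rV_cons (t, y)))%E.
  exact: integral_ge0.
rewrite ge0_integralZl_EFin//; first last.
- by rewrite invr_ge0 ltW.
- by apply: (measurableT_comp mF); exact: measurable_rV_aff.
rewrite (ih _ _ (fun y => \int[@lebesgue_measure R]_t f (rV_cons (t, y)))%E)//.
  by rewrite [in RHS]ge0_integral_rVS// big_ord_recl EFinM muleA.
by move=> i /=.
Qed.

(** The sign of [f] is arbitrary: the case of nonnegative functions is applied to
    the positive and negative parts. *)
Lemma integral_translation n (b : 'rV[R]_n) (f : 'rV[R]_n -> \bar R) :
  measurable_fun setT f ->
  (\int[leb n]_x f (x + b)%R = \int[leb n]_x f x)%E.
Proof.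
move=> mf.
have bE x : x + b = rV_aff (fun=> 1) (fun i => b ord0 i) x.
  by apply/rowP => i; rewrite !mxE mul1r.
have ge0 (g : 'rV[R]_n -> \bar R) : measurable_fun setT g ->
    (forall x, 0 <= g x)%E -> (\int[leb n]_x g (x + b)%R = \int[leb n]_x g x)%E.
  move=> mg g0; under eq_integral do rewrite bE.
  rewrite ge0_integral_affine// big1 ?mul1e// => i _.
  by rewrite invr1.
rewrite integralE [RHS]integralE; congr (_ - _)%E.
  rewrite -[RHS]ge0//; first by apply: eq_integral => x _; rewrite ?funeposE ?funenegE.
  exact: measurable_funepos.
rewrite -[RHS]ge0//; first by apply: eq_integral => x _; rewrite ?funeposE ?funenegE.
exact: measurable_funeneg.
Qed.

(** A product of one-variable functions, so that its integral can be computed by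
    iterated integration; every Schwartz function is bounded by a multiple of
    it. *)
Definition majorant n (x : 'rV[R]_n) : R := \prod_(i < n) (1 + x ord0 i ^+ 2)^-1.

Lemma oneDsqr_gt0 (t : R) : 0 < 1 + t ^+ 2.
Proof. by rewrite ltr_pwDl// sqr_ge0. Qed.

Lemma majorant_gt0 n (x : 'rV[R]_n) : 0 < majorant x.
Proof. by apply: prodr_gt0 => i _; rewrite invr_gt0 oneDsqr_gt0. Qed.

Lemma measurable_majorant n : measurable_fun setT (@majorant n).
Proof.
apply: measurable_prod => i _.
apply: (@measurableT_comp _ _ _ _ _ _ (fun t : R => (1 + t ^+ 2)^-1)).
  by apply: continuous_measurable_fun; exact: continuous_oneDsqrV.
exact: measurable_rV_coord.
Qed.

Lemma integral_oneDsqrV :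
  (\int[@lebesgue_measure R]_t ((1 + t ^+ 2)^-1)%:E < +oo)%E.
Proof.
rewrite (ge0_symfun_integralT (f := fun t : R => (1 + t ^+ 2)^-1))//=.
- rewrite (_ : [set x | _] = `[0, +oo[%classic); last first.
    by apply/seteqP; split => x/=; rewrite in_itv/= andbT.
  by rewrite (integral0y_oneDsqr R) -EFinM ltry.
- by move=> x; rewrite invr_ge0 ltW// oneDsqr_gt0.
- exact: continuous_oneDsqrV.
- by move=> x /=; rewrite sqrrN.
Qed.

Lemma ge0_integral_prod n (u : R -> R) : measurable_fun setT u ->
  (forall t, 0 <= u t) -> (\int[@lebesgue_measure R]_t (u t)%:E < +oo)%E ->
  (\int[leb n]_x (\prod_(i < n) u (x ord0 i))%:E =
   (fine (\int[@lebesgue_measure R]_t (u t)%:E) ^+ n)%:E)%E.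
Proof.
move=> mu u0 uoo.
have p0 k (x : 'rV[R]_k) : (0 <= (\prod_(i < k) u (x ord0 i))%:E)%E.
  by rewrite lee_fin; apply: prodr_ge0 => i _; exact: u0.
have mp k : measurable_fun setT (fun x : 'rV[R]_k => (\prod_(i < k) u (x ord0 i))%:E).
  apply/measurable_EFinP; apply: measurable_prod => i _.
  by apply: (measurableT_comp mu); exact: measurable_rV_coord.
elim: n => [|n ih]; first by rewrite ge0_integral_rV0 ?big_ord0.
rewrite ge0_integral_rVS//.
have E t (y : 'rV[R]_n) : (\prod_(i < n.+1) u (rV_cons (t, y) ord0 i))%:E =
    ((\prod_(i < n) u (y ord0 i))%:E * (u t)%:E)%E.
  rewrite -EFinM; congr EFin; rewrite big_ord_recl !mxE unlift_none mulrC.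
  by congr (_ * _); apply: eq_bigr => i _; rewrite !mxE liftK.
under eq_integral => y _.
  under eq_integral do rewrite E.
  rewrite ge0_integralZl_EFin//; last 3 first.
  - by move=> t _; rewrite lee_fin.
  - exact/measurable_EFinP.
  - by apply: prodr_ge0 => i _; exact: u0.
  over.
have I0 : (0 <= \int[@lebesgue_measure R]_t (u t)%:E)%E.
  by apply: integral_ge0 => t _; rewrite lee_fin.
have fI : (\int[@lebesgue_measure R]_t (u t)%:E)%E \is a fin_num by rewrite ge0_fin_numE.
rewrite -(fineK fI); under eq_integral do rewrite muleC.
rewrite ge0_integralZl_EFin//.
- by rewrite ih -EFinM -exprS.
- exact: mp.
- exact: fine_ge0.
Qed.

Lemma integral_majorant n : (\int[leb n]_x (majorant x)%:E < +oo)%E.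
Proof.
rewrite (ge0_integral_prod n (u := fun t => (1 + t ^+ 2)^-1)) ?ltry//.
- by apply: continuous_measurable_fun; exact: continuous_oneDsqrV.
- by move=> t; rewrite invr_ge0 ltW// oneDsqr_gt0.
- exact: integral_oneDsqrV.
Qed.

End affine.

(** * Derivatives along lines *)
Section line_derivative.
Variables (R : realType) (V : normedModType R).
Implicit Types (u : V -> R) (x v w : V).

Lemma is_derive_line u (du : V -> R) v :
  (forall x, is_derive x v u (du x)) ->
  forall x (t : R), is_derive t 1 (fun s : R => u (x + s *: v)) (du (x + t *: v)).
Proof.
move=> hu x t; have [hd hv] := hu (x + t *: v).
have E : (fun h : R => h^-1 *: (((fun s : R => u (x + s *: v)) \o shift t) (h *: 1) -
      u (x + t *: v))) = (fun h : R => h^-1 *: ((u \o shift (x + t *: v)) (h *: v) - u (x + t *: v))).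
  apply/funext => h /=; congr (_ *: (u _ - _)).
  by rewrite /shift/= scaler1 scalerDl addrCA.
split.
  by rewrite /derivable E.
by rewrite /derive E.
Qed.

Lemma is_derive_line0 u x v (d : R) :
  is_derive x v u d -> is_derive (0 : R) 1 (fun s : R => u (x + s *: v)) d.
Proof.
move=> [hd hv].
have E : (fun h : R => h^-1 *: (((fun s : R => u (x + s *: v)) \o shift 0) (h *: 1) -
      u (x + 0 *: v))) = (fun h : R => h^-1 *: ((u \o shift x) (h *: v) - u x)).
  apply/funext => h /=; rewrite scale0r !addr0; congr (_ *: (u _ - _)).
  by rewrite /shift/= scaler1 ?addr0 addrC.
split.
  by rewrite /derivable E.
by rewrite /derive E.
Qed.

Lemma line_is_derive u x v (d : R) :
  is_derive (0 : R) 1 (fun s : R => u (x + s *: v)) d -> is_derive x v u d.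
Proof.
move=> [hd hv].
have E : (fun h : R => h^-1 *: (((fun s : R => u (x + s *: v)) \o shift 0) (h *: 1) -
      u (x + 0 *: v))) = (fun h : R => h^-1 *: ((u \o shift x) (h *: v) - u x)).
  apply/funext => h /=; rewrite scale0r !addr0; congr (_ *: (u _ - _)).
  by rewrite /shift/= scaler1 ?addr0 addrC.
split.
  by rewrite /derivable -E.
by rewrite /derive -E.
Qed.

Lemma MVT_line u (du : V -> R) v :
  (forall x, is_derive x v u (du x)) ->
  forall x (h : R), 0 <= h -> exists t : R, [/\ 0 <= t, t <= h &
    u (x + h *: v) - u x = h * du (x + t *: v)].
Proof.
move=> hu x h h0.
have hd (t : R) : is_derive t 1 (fun s : R => u (x + s *: v)) (du (x + t *: v)).
  exact: is_derive_line.
have [|t th E] := @MVT_segment R (fun s : R => u (x + s *: v))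
  (fun t => du (x + t *: v)) 0 h h0.
- apply: continuous_subspaceT => t.
  by apply: differentiable_continuous; apply/derivable1_diffP; case: (hd t).
exists t; move: th; rewrite in_itv/= => /andP[-> ->]; split => //.
by move: E; rewrite scale0r addr0 subr0 mulrC.
Qed.

(** The increment [h] may have any sign, hence the location of [t] is given by
    absolute values. *)
Lemma MVT_line_norm u (du : V -> R) v :
  (forall x, is_derive x v u (du x)) ->
  forall x (h : R), exists2 t : R, `|t| <= `|h| &
    u (x + h *: v) - u x = h * du (x + t *: v).
Proof.
move=> hu x h; have [h0|h0] := leP 0 h.
  have [t [t0 th E]] := MVT_line hu x h0.
  by exists t => //; rewrite !ger0_norm.
have h0' : 0 <= - h by rewrite oppr_ge0 ltW.
have [t [t0 th]] := MVT_line hu (x + h *: v) h0'.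
rewrite -!addrA -!scalerDl subrr scale0r addr0 => E.
exists (h + t); last by rewrite -opprB E mulNr opprK.
by rewrite !ler0_norm ?(ltW h0)//; lra.
Qed.

(** Two applications of the mean value theorem express the second difference of
    [u] on a small parallelogram through either mixed derivative at a nearby
    point. *)
Lemma mixed_derivatives u (a b a' b' : V -> R) v w x :
  (forall x, is_derive x v u (a x)) -> (forall x, is_derive x w u (b x)) ->
  (forall x, is_derive x w a (a' x)) -> (forall x, is_derive x v b (b' x)) ->
  {for x, continuous a'} -> {for x, continuous b'} -> a' x = b' x.
Proof.
move=> ua ub aa' bb' ca' cb'.
have key (u0 a0 a0' : V -> R) v0 w0 : (forall x, is_derive x v0 u0 (a0 x)) ->
    (forall x, is_derive x w0 a0 (a0' x)) -> forall h : R, 0 <= h ->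
    exists s t, [/\ 0 <= s <= h, 0 <= t <= h &
     u0 (x + h *: v0 + h *: w0) - u0 (x + h *: v0) - (u0 (x + h *: w0) - u0 x) =
     h * (h * a0' (x + s *: v0 + t *: w0))].
  move=> h1 h2 h h0.
  (* the second difference is the increment of [U] along [v0] *)
  pose U y := u0 (y + h *: w0) - u0 y.
  have hU y : is_derive y v0 U (a0 (y + h *: w0) - a0 y).
    rewrite /U; apply: is_deriveB.
    apply: line_is_derive; have := is_derive_line h1 (y + h *: w0) 0.
    rewrite scale0r addr0; congr is_derive.
    by apply/funext => s; rewrite addrAC.
  have [s [s0 sh E]] := MVT_line hU x h0.
  have [t [t0 th E']] := MVT_line h2 (x + s *: v0) h0.
  exists s, t; rewrite s0 sh t0 th; split => //.
  by rewrite -E' -E.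
apply/eqP; rewrite -subr_eq0 -normr_eq0; apply/eqP/le_anti; rewrite normr_ge0 andbT.
apply/ler_addgt0Pl => e e0; rewrite addr0.
have e2 : 0 < e / 2 by rewrite divr_gt0.
have /cvgrPdist_lt/(_ _ e2)/nbhs_ballP[d1 /= d10 H1] := ca'.
have /cvgrPdist_lt/(_ _ e2)/nbhs_ballP[d2 /= d20 H2] := cb'.
pose M := 1 + `|v| + `|w|.
have M0 : 0 < M by rewrite ltr_wpDr// ltr_wpDr.
pose h := Num.min d1 d2 / (2 * M).
have h0 : 0 < h by rewrite divr_gt0 ?mulr_gt0// lt_min d10.
have near (s t : R) v0 w0 d : 0 <= s <= h -> 0 <= t <= h -> `|v0| + `|w0| <= M -> 
    Num.min d1 d2 <= d -> ball x d (x + s *: v0 + t *: w0).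
  move=> /andP[s0 sh] /andP[t0 th] vw dd.
  rewrite -ball_normE/= -addrA opprD addNKr normrN.
  apply: (le_lt_trans (ler_normD _ _)); rewrite !normrZ !ger0_norm//.
  apply: (@le_lt_trans _ _ (h * M)).
    apply: le_trans (ler_wpM2l (ltW h0) vw).
    by rewrite mulrDr lerD// ler_wpM2r.
  apply: lt_le_trans dd; rewrite /h invfM mulrA divfK ?lt0r_neq0//.
  by rewrite ltr_pdivrMr// ltr_pMr ?ltr1n// lt_min d10.
have [s1 [t1 [hs1 ht1 E1]]] := key u a a' v w ua aa' h (ltW h0).
have [s2 [t2 [hs2 ht2 E2]]] := key u b b' w v ub bb' h (ltW h0).
have E : a' (x + s1 *: v + t1 *: w) = b' (x + s2 *: w + t2 *: v).
  apply: (mulfI (lt0r_neq0 h0)); apply: (mulfI (lt0r_neq0 h0)).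
  rewrite -E1 -E2 (addrAC x) !opprB; ring.
have N1 : `|a' x - a' (x + s1 *: v + t1 *: w)| < e / 2.
  apply: H1; apply: near => //; rewrite ?ge_min ?lexx// /M; lra.
have N2 : `|b' x - b' (x + s2 *: w + t2 *: v)| < e / 2.
  apply: H2; apply: near => //; rewrite ?ge_min ?lexx ?orbT// /M; lra.
rewrite -E in N2.
rewrite (_ : a' x - b' x = (a' x - a' (x + s1 *: v + t1 *: w)) -
  (b' x - a' (x + s1 *: v + t1 *: w))); last by ring.
by rewrite (le_trans (ler_normB _ _))// (splitr e) lerD// ltW.
Qed.

End line_derivative.

(** * Increments of functions with bounded partial derivatives *)
Section rV_increments.
Variable R : realType.

Lemma rV_coord_le n (x : 'rV[R]_n) i : `|x ord0 i| <= `|x|.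
Proof.
rewrite /Num.norm/= mx_normrE.
exact: (le_bigmax _ (fun ij : 'I_1 * 'I_n => `|x ij.1 ij.2|) (ord0, i)).
Qed.

Lemma rV_norm_le n (x : 'rV[R]_n) (r : R) : 0 <= r ->
  (forall i, `|x ord0 i| <= r) -> `|x| <= r.
Proof.
move=> r0 h; rewrite /Num.norm/= mx_normrE; apply: bigmax_le => // -[i j] _.
by rewrite (ord1 i).
Qed.

Lemma rV_increment n (u : 'rV[R]_n -> R) (D : 'I_n -> 'rV[R]_n -> R)
    (x h : 'rV[R]_n) (C : R) :
  (forall i y, is_derive y (basis_vec R i) u (D i y)) ->
  (forall i y, `|y - x| <= `|h| -> `|D i y| <= C) ->
  `|u (x + h) - u x| <= C * n%:R * `|h|.
Proof.
move=> hu hD.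
(* the polygonal path from [x] to [x + h] that follows the coordinate axes *)
pose p (k : nat) : 'rV[R]_n := \row_i (if (i < k)%N then h ord0 i else 0).
have p0 : p 0%N = 0 by apply/rowP => i; rewrite !mxE ltn0.
have pn : p n = h by apply/rowP => i; rewrite !mxE ltn_ord.
have step (k : 'I_n) : `|u (x + p k.+1) - u (x + p k)| <= C * `|h|.
  have -> : x + p k.+1 = x + p k + h ord0 k *: basis_vec R k.
    rewrite -addrA; congr (_ + _); apply/rowP => i; rewrite !mxE eqxx/= ltnS leq_eqVlt.
    have [->|ik] := eqVneq i k; first by rewrite eqxx ltnn add0r mulr1.
    by rewrite (negbTE (_ : (i : nat) != k))//= mulr0 addr0.
  have [t tk ->] := MVT_line_norm (hu k) (x + p k) (h ord0 k).
  have th : `|t| <= `|h| by apply: le_trans tk _; exact: rV_coord_le.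
  have C0 : 0 <= C by apply: le_trans (hD k x _); rewrite ?subrr ?normr0.
  rewrite normrM mulrC ler_pM//; last exact: rV_coord_le.
  apply: hD; rewrite -(addrA x) [x + _]addrC addrK.
  apply: rV_norm_le => // i; rewrite !mxE eqxx/=.
  have [->|ik] := eqVneq i k; first by rewrite ltnn add0r mulr1.
  rewrite mulr0 addr0; case: ifP => _; first exact: rV_coord_le.
  by rewrite normr0.
have -> : u (x + h) - u x = \sum_(0 <= k < n) (u (x + p k.+1) - u (x + p k)).
  by rewrite telescope_sumr// pn p0 addr0.
rewrite big_mkord; apply: (le_trans (ler_norm_sum _ _ _)).
apply: le_trans (ler_sum _ (fun k _ => step k)) _.
by rewrite sumr_const card_ord -mulrA (mulrC n%:R) mulrA mulr_natr.
Qed.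

(** Bounded partial derivatives give a local Lipschitz bound.  For
    Wigner distributions and short-time Fourier transforms the partial derivatives
    are computed first, and continuity in all variables follows. *)
Lemma bounded_partials_continuous n (u : 'rV[R]_n -> R) (D : 'I_n -> 'rV[R]_n -> R)
    (x : 'rV[R]_n) (C : R) :
  (forall i y, is_derive y (basis_vec R i) u (D i y)) ->
  (forall i y, `|y - x| <= 1 -> `|D i y| <= C) ->
  {for x, continuous u}.
Proof.
move=> hu hD; apply/(@cvgrPdist_lt R R^o _ (nbhs x) (nbhs_filter x)) => e e0.
pose M := `|C| * n%:R + 1.
have M0 : 0 < M by rewrite ltr_wpDl// mulr_ge0.
have M1 : 0 < Num.min 1 (e / M) by rewrite lt_min ltr01 divr_gt0.
apply/nbhs_ballP; exists (Num.min 1 (e / M)) => //= y.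
rewrite -ball_normE/= distrC lt_min => /andP[/ltW y1 yx].
rewrite distrC -[in u y](subrKC x y).
apply: (le_lt_trans (@rV_increment _ u D x (y - x) C hu _)).
  by move=> i z zx; apply: hD; exact: le_trans zx y1.
apply: (@le_lt_trans _ _ (M * `|y - x|)); last by rewrite mulrC -ltr_pdivlMr.
by rewrite ler_wpM2r// /M ler_wpDr// ler_wpM2r// ler_norm.
Qed.

End rV_increments.

(** * Moduli and derivatives of complex valued functions *)
Section complex_calculus.
Variable R : realType.
Local Notation rc := (real_complex R).
Local Notation Re := complex.Re.
Local Notation Im := complex.Im.
Implicit Types (z w : R[i]) (s t : R).

Lemma complexD z w : z + w = Complex (Re z + Re w) (Im z + Im w).
Proof. by case: z w => [a b] [c e]. Qed.
Lemma complexN z : - z = Complex (- Re z) (- Im z).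
Proof. by case: z. Qed.
Lemma complexM z w :
  z * w = Complex (Re z * Re w - Im z * Im w) (Re z * Im w + Im z * Re w).
Proof. by case: z w => [a b] [c e]. Qed.
Lemma complexJ z : conjc z = Complex (Re z) (- Im z).
Proof. by case: z. Qed.
Definition complexE := (complexD, complexN, complexM, complexJ).

Lemma complex_ext z w : Re z = Re w -> Im z = Im w -> z = w.
Proof. by case: z w => [a b] [c e] /= -> ->. Qed.

Lemma cabsM z w : cabs (z * w) = cabs z * cabs w.
Proof. exact: normcM. Qed.

Lemma cabsD z w : cabs (z + w) <= cabs z + cabs w.
Proof. exact: le_normcD. Qed.

Lemma cabsN z : cabs (- z) = cabs z. Proof. exact: normcN. Qed.

Lemma cabs0 : cabs (0 : R[i]) = 0. Proof. exact: normc0. Qed.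

Lemma cabs_ge0 z : 0 <= cabs z.
Proof. by case: z => a b; exact: sqrtr_ge0. Qed.

Lemma cabs_eq0 z : cabs z = 0 -> z = 0. Proof. exact: eq0_normc. Qed.

Lemma cabsJ z : cabs (conjc z) = cabs z.
Proof. by case: z => a b; rewrite /cabs/= sqrrN. Qed.

Lemma cabs_real s : cabs (rc s) = `|s|.
Proof. by rewrite /cabs/= expr0n addr0 sqrtr_sqr. Qed.

Lemma Re_le_cabs z : `|Re z| <= cabs z.
Proof.
case: z => a b; rewrite /cabs/= -sqrtr_sqr ler_sqrt ?addr_ge0 ?sqr_ge0//.
by rewrite lerDl sqr_ge0.
Qed.

Lemma Im_le_cabs z : `|Im z| <= cabs z.
Proof.
case: z => a b; rewrite /cabs/= -sqrtr_sqr ler_sqrt ?addr_ge0 ?sqr_ge0//.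
by rewrite lerDr sqr_ge0.
Qed.

Lemma cabs_le z : cabs z <= `|Re z| + `|Im z|.
Proof.
case: z => a b.
have -> : cabs (Complex a b) = cabs (rc a + Complex 0 1 * rc b).
  by congr cabs; rewrite !complexE/=; congr Complex; ring.
apply: (le_trans (cabsD _ _)); rewrite cabsM !cabs_real.
have -> : cabs (Complex 0 1) = 1 :> R by rewrite /cabs/= expr0n/= add0r expr1n sqrtr1.
by rewrite mul1r.
Qed.

Lemma expiD s t : expi (s + t) = expi s * expi t.
Proof. by rewrite !complexE/= /expi cosD sinD; congr Complex; ring. Qed.

Lemma expi0 : expi (0 : R) = 1. Proof. by rewrite /expi cos0 sin0. Qed.

Lemma cabs_expi t : cabs (expi t) = 1.
Proof. by rewrite /cabs/= cos2Dsin2 sqrtr1. Qed.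

Lemma conjc_expi t : conjc (expi t) = expi (- t).
Proof. by rewrite /expi/= cosN sinN. Qed.

Section directional.
Variables (V : normedModType R).
Implicit Types (f g : V -> R[i]) (x v : V).

(** The derivative is recorded through the real and imaginary parts, which is
    how partial derivatives of complex functions are defined. *)
Definition is_cderive x v f (l : R[i]) : Prop :=
  is_derive x v (fun y => Re (f y)) (Re l) /\
  is_derive x v (fun y => Im (f y)) (Im l).

Lemma is_cderive_eq x v f l l' : is_cderive x v f l -> l = l' -> is_cderive x v f l'.
Proof. by move=> ? <-. Qed.

Lemma is_cderive_cst x v (c : R[i]) : is_cderive x v (fun=> c) 0.
Proof. by split; exact: is_derive_cst. Qed.

Lemma is_cderiveD x v f g l m : is_cderive x v f l -> is_cderive x v g m ->
  is_cderive x v (fun y => f y + g y) (l + m).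
Proof.
move=> [f1 f2] [g1 g2]; split.
  rewrite (_ : (fun y => _) = (fun y => Re (f y)) \+ (fun y => Re (g y))); last first.
    by apply/funext => y; rewrite complexD.
  by rewrite complexD; exact: is_deriveD.
rewrite (_ : (fun y => _) = (fun y => Im (f y)) \+ (fun y => Im (g y))); last first.
  by apply/funext => y; rewrite complexD.
by rewrite complexD; exact: is_deriveD.
Qed.

Lemma is_cderiveM x v f g l m : is_cderive x v f l -> is_cderive x v g m ->
  is_cderive x v (fun y => f y * g y) (f x * m + l * g x).
Proof.
move=> [f1 f2] [g1 g2]; split.
  rewrite (_ : (fun y => _) = (fun y => Re (f y)) * (fun y => Re (g y)) -
     (fun y => Im (f y)) * (fun y => Im (g y))); last first.
    by apply/funext => y; rewrite complexM.
  apply: is_derive_eq; rewrite !complexE/=.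
  rewrite -![_ *: _]/(_ * _); ring.
rewrite (_ : (fun y => _) = (fun y => Re (f y)) * (fun y => Im (g y)) +
   (fun y => Im (f y)) * (fun y => Re (g y))); last first.
  by apply/funext => y; rewrite complexM.
apply: is_derive_eq; rewrite !complexE/=.
rewrite -![_ *: _]/(_ * _); ring.
Qed.

Lemma is_cderiveZ x v f l c : is_cderive x v f l ->
  is_cderive x v (fun y => c * f y) (c * l).
Proof.
move=> hf; apply: is_cderive_eq (is_cderiveM (is_cderive_cst x v c) hf) _.
by rewrite mul0r addr0.
Qed.

Lemma is_cderiveJ x v f l : is_cderive x v f l ->
  is_cderive x v (fun y => conjc (f y)) (conjc l).
Proof.
move=> [f1 f2]; split.
  rewrite (_ : (fun y => _) = (fun y => Re (f y))) ?complexJ//.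
  by apply/funext => y; rewrite complexJ.
rewrite (_ : (fun y => _) = - (fun y => Im (f y))); last first.
  by apply/funext => y; rewrite complexJ.
by rewrite complexJ; exact: is_deriveN.
Qed.

Lemma is_cderive_real x v (f : V -> R) (l : R) : is_derive x v f l ->
  is_cderive x v (fun y => rc (f y)) (rc l).
Proof. by move=> hf; split => //=; exact: is_derive_cst. Qed.

End directional.

(** A chain rule for affine substitutions [p] that send lines of direction [v] to
    lines of direction [w]: it involves the values of [f] on one line. *)
Lemma is_cderive_line (V W : normedModType R) (f : W -> R[i]) (p : V -> W) (x v : V) (w : W) (c : R) (l : R[i]) :
  (forall s, p (x + s *: v) = p x + (s * c) *: w) ->
  is_cderive (p x) w f l -> is_cderive x v (f \o p) (rc c * l).
Proof.
have key (g : W -> R) (m : R) : (forall s, p (x + s *: v) = p x + (s * c) *: w) ->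
    is_derive (p x) w g m -> is_derive x v (fun y => g (p y)) (c * m).
  move=> hp hg; apply: line_is_derive.
  rewrite (_ : (fun s => _) = (fun s : R => g (p x + s *: w)) \o (fun s => c * s)); last first.
    by apply/funext => s /=; rewrite hp mulrC.
  have hg0 : is_derive (c * 0 : R) 1 (fun s : R => g (p x + s *: w)) m.
    rewrite mulr0; exact: is_derive_line0.
  have hc : is_derive (0 : R) 1 (fun s : R => c * s) c.
    rewrite (_ : (fun s : R => c * s) = c *: (@id R))//.
    by apply: is_derive_eq (is_deriveZ _ _) _; rewrite -[_ *: _]/(_ * _) mulr1.
  by apply: is_derive_eq (is_derive1_comp hg0 hc) _; rewrite mulrC.
move=> hp [f1 f2]; split; rewrite complexM/= mul0r ?subr0 ?addr0; exact: key.
Qed.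

End complex_calculus.

(** * Bounded families of Schwartz functions *)
Section schwartz_families.
Variables (R : realType) (n : nat).
Local Notation rc := (real_complex R).
Local Notation Re := complex.Re.
Local Notation Im := complex.Im.
Local Notation V := 'rV[R]_n.
Implicit Types (f g : V -> R[i]) (x y : V).

Lemma pderivable_is_cderive i f x :
  pderivable i f x -> is_cderive x (basis_vec R i) f (pderiv i f x).
Proof. by move=> [h1 h2]; split; exact/derivableP. Qed.

Lemma is_cderive_pderivable i f x l :
  is_cderive x (basis_vec R i) f l -> pderivable i f x.
Proof. by move=> [[h1 _] [h2 _]]; split. Qed.

Lemma is_cderive_pderiv i f x l :
  is_cderive x (basis_vec R i) f l -> pderiv i f x = l.
Proof. by case: l => a b [[_ h1] [_ h2]]; rewrite /pderiv h1 h2. Qed.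

Lemma pderivs_rcons s i f : pderivs (rcons s i) f = pderivs s (pderiv i f).
Proof. by rewrite /pderivs foldr_rcons. Qed.

Definition poly_weight (N : nat) x : R := (1 + `|x|) ^+ N.

Lemma poly_weight_ge1 N x : 1 <= poly_weight N x.
Proof. by apply: exprn_ege1; rewrite lerDl. Qed.

Lemma poly_weight_gt0 N x : 0 < poly_weight N x.
Proof. exact: lt_le_trans (poly_weight_ge1 N x). Qed.

Lemma poly_weight_ge0 N x : 0 <= poly_weight N x.
Proof. exact/ltW/poly_weight_gt0. Qed.

Lemma poly_weightD N x y : poly_weight N (x + y) <= poly_weight N x * poly_weight N y.
Proof.
rewrite /poly_weight -exprMn lerXn2r// ?nnegrE ?mulr_ge0// ?addr_ge0//.
have := ler_normD x y; have := mulr_ge0 (normr_ge0 x) (normr_ge0 y).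
by move: `|x + y| `|x| `|y| => a b c; nra.
Qed.

Lemma monomial_le_poly_weight (a : 'I_n -> nat) x : `|monomial a x| <= poly_weight (\sum_(i < n) a i) x.
Proof.
rewrite /monomial normr_prod /poly_weight -prodrXr; apply: ler_prod => i _.
rewrite normr_ge0 normrX lerXn2r ?nnegrE ?addr_ge0//.
by rewrite (le_trans (rV_coord_le x i))// lerDr.
Qed.

(** Boundedness of a family in the Schwartz topology.  The weights
    [(1 + |x|) ^ N] replace monomials because they are submultiplicative, which
    makes translations harmless. *)
Definition schwartz_bounded (T : Type) (F : T -> V -> R[i]) : Prop :=
  (forall t, smooth (F t)) /\
  forall N s, exists C, forall t x, poly_weight N x * cabs (pderivs s (F t) x) <= C.

Lemma schwartz_boundedP (T : Type) (F : T -> V -> R[i]) t :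
  schwartz_bounded F -> schwartz (F t).
Proof.
move=> [sF bF]; split => // a s.
have [C hC] := bF (\sum_(i < n) a i)%N s.
apply: (@le_lt_trans _ _ C%:E); last exact: ltry.
apply: ge_ereal_sup => _ [x _ <-]; rewrite lee_fin.
apply: le_trans (hC t x); rewrite ler_wpM2r ?cabs_ge0//.
exact: monomial_le_poly_weight.
Qed.

Lemma schwartz_seminorm_le a s f : (schwartz_seminorm a s f < +oo)%E ->
  exists C : R, forall x, `|monomial a x| * cabs (pderivs s f x) <= C.
Proof.
move=> h; exists (fine (schwartz_seminorm a s f)) => x.
have ub : ((`|monomial a x| * cabs (pderivs s f x))%:E <= schwartz_seminorm a s f)%E.
  by apply: ereal_sup_ubound; exists x.
rewrite -lee_fin fineK// fin_numElt h andbT.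
by apply: lt_le_trans ub; exact: ltNyr.
Qed.

(** The weight [(1 + |x|) ^ N] is dominated by [2 ^ N] and the powers
    [2 ^ N |x_i| ^ N] of the coordinates, which are monomials. *)
Lemma schwartz_bounded_cst f (T : Type) : schwartz f -> schwartz_bounded (fun _ : T => f).
Proof.
move=> [sf bf]; split => // N s.
pose a (i j : 'I_n) := if i == j then N else 0%N.
have [C0 h0] := schwartz_seminorm_le (bf (fun=> 0%N) s).
have /choice[C hC] i := schwartz_seminorm_le (bf (a i) s).
exists (2 ^+ N * (`|C0| + \sum_i `|C i|)) => _ x.
set c := cabs _; have c0 : 0 <= c by exact: cabs_ge0.
have S0 : 0 <= \sum_i `|C i| by exact: sumr_ge0.
have [x1|x1] := leP `|x| 1.
  apply: (@le_trans _ _ (2 ^+ N * c)).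
    rewrite ler_wpM2r// /poly_weight lerXn2r ?nnegrE ?addr_ge0//.
    by move: x1; move: `|x| => r; lra.
  rewrite ler_wpM2l// ?exprn_ge0//; apply: ler_wpDr => //.
  have := h0 x; rewrite /monomial big1 ?normr1 ?mul1r//.
  by move=> /le_trans; apply; exact: ler_norm.
have [i xi] : exists i, `|x| = `|x ord0 i|.
  have : mx_norm x != 0 by apply: lt0r_neq0; exact: lt_trans ltr01 x1.
  by move=> /mx_norm_neq0[[i j] /= E]; exists j; rewrite (ord1 i) in E.
apply: (@le_trans _ _ (2 ^+ N * (`|x ord0 i| ^+ N * c))).
  rewrite mulrA -exprMn ler_wpM2r// lerXn2r ?nnegrE ?addr_ge0 ?mulr_ge0// -xi.
  by move: x1; move: `|x| => r; lra.
rewrite ler_wpM2l// ?exprn_ge0//; apply: ler_wpDl => //.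
rewrite (bigD1 i)//= ler_wpDr ?sumr_ge0//.
apply: le_trans (ler_norm _); apply: le_trans (hC i x).
rewrite /monomial (bigD1 i)//= big1 ?mulr1 /a ?eqxx ?normrX//.
by move=> j /negbTE; rewrite eq_sym => ->.
Qed.

(** Coinduction: iterated derivatives never leave a class that is stable under
    differentiation, so decay of the members of the class is decay of all their
    derivatives; continuity comes for free from
    [bounded_partials_continuous]. *)
Lemma schwartz_bounded_coind (T : Type) (Q : (T -> V -> R[i]) -> Prop) :
  (forall F, Q F -> forall i, exists2 G, Q G &
     forall t x, is_cderive x (basis_vec R i) (F t) (G t x)) ->
  (forall F, Q F -> forall N, exists C, forall t x, poly_weight N x * cabs (F t x) <= C) ->
  forall F, Q F -> schwartz_bounded F.
Proof.
move=> Qd Qb.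
have Qs F (s : seq 'I_n) : Q F -> exists2 G, Q G & forall t, pderivs s (F t) = G t.
  move=> QF; elim: s => [|i s [G QG E]]; first by exists F.
  have [H QH hH] := Qd G QG i; exists H => // t; apply/funext => x.
  rewrite /pderivs/= -[foldr _ _ _]/(pderivs s (F t)) E.
  exact/is_cderive_pderiv.
move=> F QF; split=> [t s|N s]; last first.
  have [G QG E] := Qs F s QF; have [C hC] := Qb G QG N.
  by exists C => t x; rewrite E.
have [G QG ->] := Qs F s QF.
have /choice[H hH] i := (let: ex_intro2 H h1 h2 := Qd G QG i in
  ex_intro (fun H => Q H /\ forall t x, is_cderive x (basis_vec R i) (G t) (H t x))
    H (conj h1 h2)).
have /choice[C hC] i := Qb (H i) (hH i).1 0%N.
have hb i y : cabs (H i t y) <= \sum_i `|C i|.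
  rewrite (bigD1 i)//= ler_wpDr ?sumr_ge0//; apply: le_trans (ler_norm _).
  by have := hC i t y; rewrite /poly_weight expr0 mul1r.
split.
- move=> x; apply: (bounded_partials_continuous (D := fun i y => Re (H i t y))
    (C := \sum_i `|C i|)) => i y.
    by have [] := (hH i).2 t y.
  by move=> _; apply: le_trans (Re_le_cabs _) _.
- move=> x; apply: (bounded_partials_continuous (D := fun i y => Im (H i t y))
    (C := \sum_i `|C i|)) => i y.
    by have [] := (hH i).2 t y.
  by move=> _; apply: le_trans (Im_le_cabs _) _.
- by move=> i x; apply: is_cderive_pderivable; exact: (hH i).2.
Qed.

End schwartz_families.

(** * Stability properties of Schwartz functions *)
Section schwartz_closure.
Variables (R : realType).
Local Notation rc := (real_complex R).
Local Notation Re := complex.Re.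
Local Notation Im := complex.Im.

Definition imag_unit : R[i] := Complex 0 1.

Lemma is_derive_affine (V : normedModType R) (u : V -> R) (x v : V) (c : R) :
  (forall s, u (x + s *: v) = u x + s * c) -> is_derive x v u c.
Proof.
move=> hu; apply: line_is_derive; rewrite (funext hu).
have h1 : is_derive (0 : R) 1 (fun s : R => s * c) c.
  rewrite (_ : (fun s : R => s * c) = c *: (@id R)); last first.
    by apply/funext => s /=; rewrite mulrC.
  by apply: is_derive_eq (is_deriveZ _ _) _; rewrite -[_ *: _]/(_ * _) mulr1.
rewrite (_ : (fun s => _) = cst (u x) \+ (fun s => s * c))//.
by apply: is_derive_eq (is_deriveD (is_derive_cst _ _ _) h1) _; rewrite add0r.
Qed.

Lemma is_cderive_expi (t : R) : is_cderive t 1 (@expi R) (imag_unit * expi t).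
Proof.
split; rewrite complexM/=.
  by rewrite mul0r mul1r sub0r; exact: is_derive_cos.
by rewrite mul0r add0r mul1r; exact: is_derive_sin.
Qed.

Lemma is_cderive_expi_affine (V : normedModType R) (a : V -> R) (x v : V) (c : R) :
  (forall s, a (x + s *: v) = a x + s * c) ->
  is_cderive x v (fun y => expi (a y)) (rc c * imag_unit * expi (a x)).
Proof.
move=> ha; rewrite -mulrA.
apply: (@is_cderive_line R V R (@expi R) a x v (1 : R) c).
  by move=> s; rewrite ha; congr (_ + _); rewrite -[_ *: _]/(_ * _) mulr1.
exact: is_cderive_expi.
Qed.

Section fixed_dimension.
Variables (n : nat) (T : Type).
Local Notation V := 'rV[R]_n.
Implicit Types (f g : V -> R[i]) (x y z : V) (F G : T -> V -> R[i]).

Lemma dotp_line (w x : V) i s :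
  dotp w (x + s *: basis_vec R i) = dotp w x + s * w ord0 i.
Proof.
rewrite /dotp [in LHS](bigD1 i)//= [in RHS](bigD1 i)//= !mxE !eqxx/= mulr1.
rewrite mulrDr (mulrC s) addrAC; congr (_ + _ + _).
by apply: eq_bigr => j /negbTE ji; rewrite !mxE ji andbF mulr0 addr0.
Qed.

Lemma coord_line x i j s :
  (x + s *: basis_vec R i) ord0 j = x ord0 j + s * (i == j)%:R.
Proof. by rewrite !mxE eqxx/= (eq_sym j). Qed.

Lemma is_cderive_coord x i j :
  is_cderive x (basis_vec R i) (fun y => rc (y ord0 j)) (rc (i == j)%:R).
Proof.
apply: is_cderive_real; apply: is_derive_affine => s.
exact: coord_line.
Qed.

Lemma schwartz_bounded_pderiv i F : schwartz_bounded F ->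
  schwartz_bounded (fun t => pderiv i (F t)).
Proof.
move=> [sF bF]; split=> [t s|N s].
  by have := sF t (rcons s i); rewrite pderivs_rcons.
have [C hC] := bF N (rcons s i); exists C => t x.
by have := hC t x; rewrite pderivs_rcons.
Qed.

Lemma schwartz_bounded_is_cderive i F t x : schwartz_bounded F ->
  is_cderive x (basis_vec R i) (F t) (pderiv i (F t) x).
Proof.
move=> [sF _]; apply: pderivable_is_cderive.
by have [_ _] := sF t [::]; exact.
Qed.

Lemma schwartz_bounded_decay F N : schwartz_bounded F ->
  exists C, forall t x, poly_weight N x * cabs (F t x) <= C.
Proof. by move=> [_ /(_ N [::])]. Qed.

(** Stability of Schwartz boundedness under all these operations is proved at
    once, by showing that this closure is stable under derivatives and has
    weighted bounds. *)
Inductive schwartz_span : (T -> V -> R[i]) -> Prop :=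
| span_base F : schwartz_bounded F -> schwartz_span F
| span_coord i F : schwartz_span F ->
    schwartz_span (fun t x => rc (x ord0 i) * F t x)
| span_add F G : schwartz_span F -> schwartz_span G ->
    schwartz_span (fun t x => F t x + G t x)
| span_scale (c : T -> R[i]) (K : R) F : (forall t, cabs (c t) <= K) ->
    schwartz_span F -> schwartz_span (fun t x => c t * F t x)
| span_modulation w F : schwartz_span F ->
    schwartz_span (fun t x => expi (2 * pi * dotp w x) * F t x)
| span_translation (z : T -> V) (K : R) F : (forall t, `|z t| <= K) ->
    schwartz_span F -> schwartz_span (fun t x => F t (x - z t)).

Lemma schwartz_span_deriv F : schwartz_span F -> forall i, exists2 G,
  schwartz_span G & forall t x, is_cderive x (basis_vec R i) (F t) (G t x).
Proof.
elim=> {F} [F bF i|j F sF ih i|F G sF ihF sG ihG i|c K F cK sF ih i|w F sF ih i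
  |z K F zK sF ih i].
- exists (fun t => pderiv i (F t)); first exact/span_base/schwartz_bounded_pderiv.
  by move=> t x; exact: schwartz_bounded_is_cderive.
- have [G sG hG] := ih i.
  exists (fun t x => rc (x ord0 j) * G t x + rc (i == j)%:R * F t x).
    apply: span_add; first exact: span_coord.
    by apply: (span_scale (K := cabs (rc (i == j)%:R))).
  by move=> t x; apply: is_cderiveM => //; exact: is_cderive_coord.
- have [F' sF' hF] := ihF i; have [G' sG' hG] := ihG i.
  exists (fun t x => F' t x + G' t x); first exact: span_add.
  by move=> t x; exact: is_cderiveD.
- have [G sG hG] := ih i; exists (fun t x => c t * G t x).
    exact: span_scale cK sG.
  by move=> t x; exact: is_cderiveZ.
- have [G sG hG] := ih i.
  exists (fun t x => expi (2 * pi * dotp w x) * G t x +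
     expi (2 * pi * dotp w x) * ((rc (2 * pi * w ord0 i) * imag_unit) * F t x)).
    apply: span_add; first exact: span_modulation.
    apply: (@span_modulation w (fun t x => rc (2 * pi * w ord0 i) * imag_unit * F t x)).
    by apply: (span_scale (c := fun=> rc (2 * pi * w ord0 i) * imag_unit)) sF.
  move=> t x; apply: is_cderive_eq.
    apply: is_cderiveM (hG t x).
    apply: is_cderive_expi_affine => s.
    by rewrite dotp_line mulrDr; congr (_ + _); rewrite mulrCA.
  by congr (_ + _); rewrite mulrCA -!mulrA.
- have [G sG hG] := ih i; exists (fun t x => G t (x - z t)).
    exact: span_translation zK sG.
  move=> t x; rewrite -[G t _]mul1r.
  apply: (@is_cderive_line R _ _ (F t) (fun x => x - z t)) => // s.
  by rewrite mulr1 addrAC.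
Qed.

Lemma schwartz_span_decay F : schwartz_span F -> forall N,
  exists C, forall t x, poly_weight N x * cabs (F t x) <= C.
Proof.
elim=> {F} [F bF N|j F sF ih N|F G sF ihF sG ihG N|c K F cK sF ih N|w F sF ih N
  |z K F zK sF ih N].
- exact: schwartz_bounded_decay.
- have [C hC] := ih N.+1; exists C => t x; apply: le_trans (hC t x).
  rewrite cabsM cabs_real mulrA ler_wpM2r ?cabs_ge0// /poly_weight exprSr ler_wpM2l ?poly_weight_ge0//.
  by rewrite (le_trans (rV_coord_le x j))// lerDr.
- have [C hC] := ihF N; have [D hD] := ihG N; exists (C + D) => t x.
  apply: le_trans (lerD (hC t x) (hD t x)).
  by rewrite -mulrDr ler_wpM2l ?poly_weight_ge0// cabsD.
- have [C hC] := ih N; exists (K * C) => t x.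
  rewrite cabsM mulrCA ler_pM ?cabs_ge0 ?mulr_ge0 ?poly_weight_ge0 ?cabs_ge0//.
- have [C hC] := ih N; exists C => t x.
  by rewrite cabsM cabs_expi mul1r.
- have [C hC] := ih N; exists (C * (1 + K) ^+ N) => t x.
  have C0 : 0 <= C by apply: le_trans (hC t x); rewrite mulr_ge0 ?poly_weight_ge0 ?cabs_ge0.
  apply: (@le_trans _ _ (poly_weight N (x - z t) * poly_weight N (z t) * cabs (F t (x - z t)))).
    rewrite ler_wpM2r ?cabs_ge0//; rewrite -{1}(subrK (z t) x).
    exact: poly_weightD.
  rewrite mulrAC ler_pM ?mulr_ge0 ?poly_weight_ge0 ?cabs_ge0//.
  by rewrite /poly_weight lerXn2r ?nnegrE ?addr_ge0 ?lerD2l// (le_trans _ (zK t)).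
Qed.

Lemma schwartz_spanP F : schwartz_span F -> schwartz_bounded F.
Proof.
exact: (schwartz_bounded_coind schwartz_span_deriv schwartz_span_decay).
Qed.

End fixed_dimension.

Section schwartz_space.
Variable n : nat.
Local Notation V := 'rV[R]_n.
Implicit Types (f g : V -> R[i]) (x y z : V).

Let base f : schwartz f -> schwartz_span (fun _ : unit => f).
Proof. by move=> sf; apply: span_base; exact: schwartz_bounded_cst. Qed.

Let close (F : unit -> V -> R[i]) : schwartz_span F -> schwartz (F tt).
Proof. by move=> /schwartz_spanP /(schwartz_boundedP tt). Qed.

Lemma schwartz_coord i f : schwartz f -> schwartz (fun x => rc (x ord0 i) * f x).
Proof. by move=> /base /(span_coord i) /close. Qed.

Lemma schwartzD f g : schwartz f -> schwartz g -> schwartz (fun x => f x + g x).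
Proof. by move=> /base sf /base sg; exact: close (span_add sf sg). Qed.

Lemma schwartzZ c f : schwartz f -> schwartz (fun x => c * f x).
Proof.
move=> /base sf; apply: (close (F := fun _ x => c * f x)).
by apply: (span_scale (c := fun=> c)) sf.
Qed.

Lemma schwartz_tf_shift z w f : schwartz f -> schwartz (tf_shift z w f).
Proof.
move=> /base sf; apply: (close (F := fun _ => tf_shift z w f)).
apply: (@span_modulation n unit w (fun _ x => f (x - z))).
by apply: (span_translation (z := fun=> z)) sf.
Qed.

Lemma schwartz_pderiv i f : schwartz f -> schwartz (pderiv i f).
Proof.
move=> /(schwartz_bounded_cst unit)/(schwartz_bounded_pderiv i).
exact: (schwartz_boundedP tt).
Qed.

Lemma schwartz_is_cderive i f x : schwartz f ->
  is_cderive x (basis_vec R i) f (pderiv i f x).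
Proof. by move=> /(schwartz_bounded_cst unit)/(schwartz_bounded_is_cderive i tt). Qed.

Lemma schwartz_decay N f : schwartz f -> exists C, forall x, poly_weight N x * cabs (f x) <= C.
Proof.
move=> /(schwartz_bounded_cst unit)/(schwartz_bounded_decay N)[C hC].
by exists C => x; exact: hC tt x.
Qed.

End schwartz_space.
End schwartz_closure.

(** * Complex integrals dominated by the majorant *)
Section complex_integration.
Variables (R : realType) (n : nat).
Local Notation rc := (real_complex R).
Local Notation Re := complex.Re.
Local Notation Im := complex.Im.
Local Notation V := 'rV[R]_n.
Local Notation leb := (lebesgue_rV R n).
Implicit Types (f g : V -> R[i]) (x y : V).

Definition cmeasurable f : Prop :=
  measurable_fun setT (fun y => Re (f y)) /\ measurable_fun setT (fun y => Im (f y)).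

Lemma cmeasurable_cst c : cmeasurable (fun=> c).
Proof. by split; exact: measurable_cst. Qed.

Lemma cmeasurableD f g : cmeasurable f -> cmeasurable g ->
  cmeasurable (fun y => f y + g y).
Proof.
move=> [f1 f2] [g1 g2]; split; under eq_fun do rewrite complexD/=;
  exact: measurable_funD.
Qed.

Lemma cmeasurableM f g : cmeasurable f -> cmeasurable g ->
  cmeasurable (fun y => f y * g y).
Proof.
move=> [f1 f2] [g1 g2]; split; under eq_fun do rewrite complexM/=.
  by apply: measurable_funB; exact: measurable_funM.
by apply: measurable_funD; exact: measurable_funM.
Qed.

Lemma cmeasurableJ f : cmeasurable f -> cmeasurable (fun y => conjc (f y)).
Proof.
move=> [f1 f2]; split; under eq_fun do rewrite complexJ/=; first by [].
exact: measurable_funN.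
Qed.

Lemma cmeasurable_comp f (p : V -> V) : cmeasurable f -> measurable_fun setT p ->
  cmeasurable (fun y => f (p y)).
Proof.
by move=> [f1 f2] mp; split; [exact: measurableT_comp f1 mp|exact: measurableT_comp f2 mp].
Qed.

Lemma cmeasurable_expi (a : V -> R) : measurable_fun setT a ->
  cmeasurable (fun y => expi (a y)).
Proof.
move=> ma; split => /=.
  by apply: measurableT_comp ma; apply: continuous_measurable_fun; exact: continuous_cos.
by apply: measurableT_comp ma; apply: continuous_measurable_fun; exact: continuous_sin.
Qed.

Lemma measurable_dotp (w : V) : measurable_fun setT (dotp w).
Proof.
rewrite /dotp; apply: measurable_sum => i; apply: measurable_funM; first exact: measurable_cst.
exact: measurable_rV_coord.
Qed.

Lemma schwartz_cmeasurable f : schwartz f -> cmeasurable f.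
Proof.
by move=> [/(_ [::])[c1 c2 _] _]; split; exact: continuous_measurable_rV.
Qed.

(** One fixed integrable majorant serves all integrands, so that linearity of the
    integral and differentiation under the integral sign have uniform
    hypotheses. *)
Definition dominated (C : R) f : Prop := cmeasurable f /\ forall y, cabs (f y) <= C * majorant y.

Definition majorant_mass : R := fine (\int[leb]_x (majorant x)%:E)%E.

Lemma integrable_majorant (C : R) : leb.-integrable setT (fun y => (C * majorant y)%:E).
Proof.
under eq_fun do rewrite EFinM.
apply: integrableZl => //; apply/integrableP; split.
  by apply/measurable_EFinP; exact: measurable_majorant.
under eq_integral do rewrite /= ger0_norm ?(ltW (majorant_gt0 _))//.
exact: integral_majorant.
Qed.

Lemma Rintegral_majorant (C : R) : \int[leb]_y (C * majorant y) = C * majorant_mass.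
Proof.
have := integrable_majorant 1; under eq_fun do rewrite mul1r; move=> h.
by rewrite RintegralZl.
Qed.

Lemma dominated_integrable C f : dominated C f ->
  leb.-integrable setT (fun y => (Re (f y))%:E) /\
  leb.-integrable setT (fun y => (Im (f y))%:E).
Proof.
move=> [[mr mi] fC]; split.
  apply: le_integrable (integrable_majorant C) => //; first exact/measurable_EFinP.
  move=> y _; rewrite lee_fin (le_trans (Re_le_cabs _))//.
  by rewrite (le_trans (fC y))// ler_norm.
apply: le_integrable (integrable_majorant C) => //; first exact/measurable_EFinP.
move=> y _; rewrite lee_fin (le_trans (Im_le_cabs _))//.
by rewrite (le_trans (fC y))// ler_norm.
Qed.

Lemma cabs_cintegral_le C f : dominated C f -> cabs (cintegral f) <= 2 * (C * majorant_mass).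
Proof.
move=> fC; have [ir ii] := dominated_integrable fC.
have bound (u : V -> R) : (leb.-integrable setT (EFin \o u)) ->
    (forall y, `|u y| <= C * majorant y) -> `|\int[leb]_y u y| <= C * majorant_mass.
  move=> iu uC; apply: le_trans (le_normr_Rintegral _ _) _ => //.
  rewrite -Rintegral_majorant; apply: le_Rintegral => //.
  - exact: integrable_norm.
  - exact: integrable_majorant.
apply: (le_trans (cabs_le _)); rewrite mulr_natl mulr2n lerD//; apply: bound => // y.
  exact: le_trans (Re_le_cabs _) (fC.2 y).
exact: le_trans (Im_le_cabs _) (fC.2 y).
Qed.

Lemma dominatedD C D f g : dominated C f -> dominated D g ->
  dominated (C + D) (fun y => f y + g y).
Proof.
move=> [mf fC] [mg gD]; split; first exact: cmeasurableD.
by move=> y; rewrite mulrDl (le_trans (cabsD _ _))// lerD.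
Qed.

Lemma dominatedZ C c f : dominated C f -> dominated (cabs c * C) (fun y => c * f y).
Proof.
move=> [mf fC]; split; first exact: cmeasurableM (cmeasurable_cst _) mf.
by move=> y; rewrite cabsM -mulrA ler_wpM2l ?cabs_ge0.
Qed.

Lemma cintegralD C D f g : dominated C f -> dominated D g ->
  cintegral (fun y => f y + g y) = cintegral f + cintegral g.
Proof.
move=> /dominated_integrable[fr fi] /dominated_integrable[gr gi].
rewrite complexD /cintegral/=; congr Complex; under eq_Rintegral do rewrite complexD/=;
  by rewrite RintegralD.
Qed.

Lemma cintegralZ C c f : dominated C f ->
  cintegral (fun y => c * f y) = c * cintegral f.
Proof.
move=> fC; have [fr fi] := dominated_integrable fC.
have iZ (k : R) (u : V -> R) : leb.-integrable setT (fun y => (u y)%:E) ->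
    leb.-integrable setT (EFin \o (fun y => k * u y)).
  move=> iu; rewrite (_ : _ \o _ = (fun y => k%:E * (u y)%:E)%E); last exact/funext.
  exact: integrableZl.
rewrite complexM /cintegral/=; congr Complex; under eq_Rintegral do rewrite complexM/=.
  rewrite RintegralB ?RintegralZl//; exact: iZ.
rewrite RintegralD ?RintegralZl//; exact: iZ.
Qed.

Lemma cintegral_translation f (b : V) : cmeasurable f ->
  cintegral (fun y => f (y + b)) = cintegral f.
Proof.
move=> [mr mi]; rewrite /cintegral /Rintegral; congr Complex; congr fine.
  by rewrite (integral_translation b (f := fun y => (Re (f y))%:E))//; exact/measurable_EFinP.
by rewrite (integral_translation b (f := fun y => (Im (f y))%:E))//; exact/measurable_EFinP.
Qed.

Lemma is_cderive_cintegral (F F' : R -> V -> R[i]) (C : R) :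
  (forall s, `|s| < 1 -> dominated C (F s)) ->
  (forall s y, `|s| < 1 -> cabs (F' s y) <= C * majorant y) ->
  (forall (s : R) y, `|s| < 1 -> is_cderive s 1 (fun s => F s y) (F' s y)) ->
  is_cderive (0 : R) 1 (fun s => cintegral (F s)) (cintegral (F' 0)).
Proof.
move=> FC F'C hF.
have in01 (s : R) : s \in `]-1, 1[%R -> `|s| < 1 by rewrite in_itv/= ltr_norml.
have z01 : (`]-1, 1[%classic : set R) 0 by rewrite /= in_itv/= oppr_lt0 ltr01.
have key (u u' : R -> V -> R) :
    (forall s, `|s| < 1 -> leb.-integrable setT (fun y => (u s y)%:E)) ->
    (forall s y, `|s| < 1 -> `|u' s y| <= C * majorant y) ->
    (forall (s : R) y, `|s| < 1 -> is_derive s 1 (fun s => u s y) (u' s y)) ->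
    is_derive (0 : R) 1 (fun s => \int[leb]_y u s y) (\int[leb]_y u' 0 y).
  move=> iu u'C hu.
  have du s y : `|s| < 1 -> partial1of2 u s y = u' s y.
    by move=> s1; rewrite partial1of2E; have [_ ->] := hu s y s1.
  have d1 (x : R) (y : V) : (`]-1, 1[%classic : set R) x -> setT y ->
      derivable (u ^~ y) x 1.
    by move=> /in01 x1 _; case: (hu x y x1).
  have d2 (x : R) (y : V) : (`]-1, 1[%classic : set R) x -> setT y ->
      `|partial1of2 u x y| <= `|C| * majorant y.
    move=> /in01 x1 _; rewrite du// (le_trans (u'C _ _ x1))//.
    by rewrite ler_wpM2r ?ler_norm// ltW// majorant_gt0.
  have iu' (x : R) : (`]-1, 1[%classic : set R) x -> leb.-integrable setT (EFin \o u x).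
    by move=> /in01; exact: iu.
  have G0 y : 0 <= `|C| * majorant y by rewrite mulr_ge0// ltW// majorant_gt0.
  split.
    exact: (derivable_under_integral measurableT z01 iu' d1 G0 (integrable_majorant _) d2).
  rewrite -derive1E.
  rewrite (differentiation_under_integral measurableT z01 iu' d1 G0 (integrable_majorant _) d2).
  by apply: eq_Rintegral => y _; rewrite du// normr0.
split; [apply: (key (fun s y => Re (F s y)) (fun s y => Re (F' s y))) => s|
  apply: (key (fun s y => Im (F s y)) (fun s y => Im (F' s y))) => s].
- by move=> s1; have [] := dominated_integrable (FC s s1).
- by move=> y s1; exact: le_trans (Re_le_cabs _) (F'C s y s1).
- by move=> y s1; have [] := hF s y s1.
- by move=> s1; have [] := dominated_integrable (FC s s1).
- by move=> y s1; exact: le_trans (Im_le_cabs _) (F'C s y s1).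
- by move=> y s1; have [] := hF s y s1.
Qed.

(** In one variable this is [1 + (a - b) ^ 2 <= 2 (1 + a ^ 2) (1 + b ^ 2)].  A
    product of two decaying functions thus decays in the difference of their
    arguments, whatever their common translation. *)
Lemma majorant_mul_le x y : majorant x * majorant y <= 2 ^+ n * majorant (x - y).
Proof.
rewrite /majorant -big_split/=.
have -> : 2 ^+ n = \prod_(i < n) (2 : R) by rewrite prodr_const card_ord.
rewrite -big_split/=.
apply: ler_prod => i _; rewrite !mxE.
have := oneDsqr_gt0 (x ord0 i); have := oneDsqr_gt0 (y ord0 i).
move: (x ord0 i) (y ord0 i) => a b b0 a0.
rewrite mulr_ge0 ?invr_ge0 ?(ltW a0) ?(ltW b0)//=.
have H : 1 + (a - b) ^+ 2 <= 2 * ((1 + a ^+ 2) * (1 + b ^+ 2)).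
  by have := sqr_ge0 (a + b); have := sqr_ge0 (a * b); nra.
by rewrite ler_pdivlMr ?oneDsqr_gt0// mulrC -invfM ler_pdivrMr ?mulr_gt0.
Qed.

(** The exponent [n + n] is enough: each of the [n] factors [1 + y_i ^ 2] is at
    most [(1 + |y|) ^ 2]. *)
Lemma schwartz_dominated f : schwartz f -> exists C, dominated C f.
Proof.
move=> sf; have [C hC] := schwartz_decay (n + n) sf; exists C; split.
  exact: schwartz_cmeasurable.
move=> y; rewrite -ler_pdivrMr ?majorant_gt0//; apply: le_trans (hC y).
rewrite mulrC ler_wpM2r ?cabs_ge0// /majorant -prodfV.
rewrite /poly_weight exprD -exprMn -[leRHS](_ : \prod_(i < n) ((1 + `|y|) * (1 + `|y|)) = _); last first.
  by rewrite prodr_const card_ord.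
apply: ler_prod => i _; rewrite invrK ltW ?oneDsqr_gt0//=.
have := rV_coord_le y i; rewrite -[in X in _ -> X]real_normK ?num_real//.
have := normr_ge0 (y ord0 i); move: `|y ord0 i| `|y| => a b; nra.
Qed.

End complex_integration.

(** * The [tau]-Wigner distribution of Schwartz functions is Schwartz *)
Section wigner_schwartz.
Variables (R : realType) (d : nat) (tau : R).
Local Notation rc := (real_complex R).
Local Notation Re := complex.Re.
Local Notation Im := complex.Im.
Local Notation V := 'rV[R]_d.
Local Notation ci := (imag_unit R).
Local Notation e := (basis_vec R).
Implicit Types (f g : V -> R[i]) (x y w : V) (z : 'rV[R]_(d + d)).

Lemma line_is_cderive (W : normedModType R) (F : W -> R[i]) (z v : W) l :
  is_cderive (0 : R) 1 (fun s : R => F (z + s *: v)) l -> is_cderive z v F l.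
Proof.
move=> [h1 h2]; split.
  exact: (@line_is_derive R W (fun p : W => Re (F p)) z v _ h1).
exact: (@line_is_derive R W (fun p : W => Im (F p)) z v _ h2).
Qed.

Lemma schwartz_line f j (p : R -> V) (c : R) (s : R) : schwartz f ->
  (forall s t, p (s + t) = p s + (t * c) *: e j) ->
  is_cderive s 1 (fun s => f (p s)) (rc c * pderiv j f (p s)).
Proof.
move=> sf hp; apply: (@is_cderive_line R _ _ f p _ _ (e j) c).
  by move=> t; rewrite -hp -[_ *: _]/(_ * _) mulr1.
exact: schwartz_is_cderive.
Qed.

Definition wigner_integrand f g x w y : R[i] :=
  expi (- (2 * pi * dotp y w)) * f (x + tau *: y) * conjc (g (x - (1 - tau) *: y)).

Local Notation K := wigner_integrand.
Local Notation W := (tau_wigner tau).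

Lemma wignerE f g z : W f g z = cintegral (K f g (lsubmx z) (rsubmx z)).
Proof. by []. Qed.

Lemma conjcM (a b : R[i]) : conjc (a * b) = conjc a * conjc b.
Proof. exact: rmorphM. Qed.

Lemma dotpC x y : dotp x y = dotp y x.
Proof. by apply: eq_bigr => i _; rewrite mulrC. Qed.

(** The difference of the two arguments [x + tau y] and [x - (1 - tau) y] is [y],
    so [majorant_mul_le] gives a bound that does not depend on [x] and [w]. *)
Lemma wigner_integrand_dominated f g : schwartz f -> schwartz g ->
  exists C, 0 <= C /\ forall x w, dominated C (K f g x w).
Proof.
move=> sf sg; have [A [mf fA]] := schwartz_dominated sf.
have [B [mg gB]] := schwartz_dominated sg.
have A0 : 0 <= A.
  by rewrite -(@pmulr_lge0 _ (majorant (0 : V))) ?majorant_gt0//; exact: le_trans (cabs_ge0 _) (fA 0).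
have B0 : 0 <= B.
  by rewrite -(@pmulr_lge0 _ (majorant (0 : V))) ?majorant_gt0//; exact: le_trans (cabs_ge0 _) (gB 0).
exists (A * B * 2 ^+ d); split; first by rewrite !mulr_ge0// exprn_ge0.
move=> x w; split.
  apply: cmeasurableM; first apply: cmeasurableM.
  - apply: cmeasurable_expi; apply: measurable_funN; apply: measurable_funM.
      exact: measurable_cst.
    by under eq_fun do rewrite dotpC; exact: measurable_dotp.
  - apply: cmeasurable_comp => //.
    rewrite (_ : (fun y => _) = rV_aff (fun=> tau) (fun i => x ord0 i)); last first.
      by apply/funext => y; apply/rowP => i; rewrite !mxE addrC.
    exact: measurable_rV_aff.
  apply: cmeasurableJ; apply: cmeasurable_comp => //.
  rewrite (_ : (fun y => _) = rV_aff (fun=> - (1 - tau)) (fun i => x ord0 i)); last first.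
    by apply/funext => y; apply/rowP => i; rewrite !mxE addrC mulNr.
  exact: measurable_rV_aff.
move=> y; rewrite !cabsM cabs_expi mul1r cabsJ.
apply: (@le_trans _ _ ((A * majorant (x + tau *: y)) * (B * majorant (x - (1 - tau) *: y)))).
  by rewrite ler_pM ?cabs_ge0.
rewrite mulrACA -[leRHS]mulrA ler_wpM2l ?mulr_ge0//.
apply: le_trans (majorant_mul_le _ _) _.
rewrite (_ : x + tau *: y - (x - (1 - tau) *: y) = y)//.
by apply/rowP => i; rewrite !mxE; ring.
Qed.

(** The integrand is dominated uniformly in the point [(x, w)] of phase space, so
    a bound on its derivative along the line is the only additional hypothesis. *)
Lemma is_cderive_wigner f g z v (G : R -> V -> R[i]) :
  schwartz f -> schwartz g ->
  (exists C, forall s y, `|s| < 1 -> cabs (G s y) <= C * majorant y) ->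
  (forall (s : R) y, `|s| < 1 -> is_cderive s 1
     (fun s : R => K f g (lsubmx (z + s *: v)) (rsubmx (z + s *: v)) y) (G s y)) ->
  is_cderive z v (W f g) (cintegral (G 0)).
Proof.
move=> sf sg [C' GC] hG; apply: line_is_cderive.
have [C [C0 hC]] := wigner_integrand_dominated sf sg.
apply: (@is_cderive_cintegral R d
  (fun s y => K f g (lsubmx (z + s *: v)) (rsubmx (z + s *: v)) y) G (C + `|C'|)) => //.
- move=> s s1; have [mK hK] := hC (lsubmx (z + s *: v)) (rsubmx (z + s *: v)).
  split=> // y; apply: le_trans (hK y) _.
  by rewrite ler_wpM2r ?lerDl// ltW// majorant_gt0.
- move=> s y s1; apply: le_trans (GC s y s1) _.
  by rewrite ler_wpM2r ?(ltW (majorant_gt0 _))// ler_wpDl// ler_norm.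
Qed.

Local Notation X j f := (fun x : V => rc (x ord0 j) * f x).

Lemma lsubmx_line_l z s j :
  lsubmx (z + s *: basis_vec R (lshift d j)) = lsubmx z + s *: e j.
Proof. by apply/rowP => i; rewrite !mxE eqxx/= (inj_eq (@lshift_inj _ _)). Qed.

Lemma rsubmx_line_l z s j :
  rsubmx (z + s *: basis_vec R (lshift d j)) = rsubmx z.
Proof. by apply/rowP => i; rewrite !mxE eqxx/= eq_rlshift mulr0 addr0. Qed.

Lemma lsubmx_line_r z s j :
  lsubmx (z + s *: basis_vec R (rshift d j)) = lsubmx z.
Proof. by apply/rowP => i; rewrite !mxE eqxx/= eq_lrshift mulr0 addr0. Qed.

Lemma rsubmx_line_r z s j :
  rsubmx (z + s *: basis_vec R (rshift d j)) = rsubmx z + s *: e j.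
Proof. by apply/rowP => i; rewrite !mxE eqxx/= (inj_eq (@rshift_inj _ _)). Qed.

Lemma wigner_deriv_position j f g z : schwartz f -> schwartz g ->
  is_cderive z (basis_vec R (lshift d j)) (W f g)
    (W (pderiv j f) g z + W f (pderiv j g) z).
Proof.
move=> sf sg; have sf' := schwartz_pderiv j sf; have sg' := schwartz_pderiv j sg.
have [C [C0 hC]] := wigner_integrand_dominated sf' sg.
have [D [D0 hD]] := wigner_integrand_dominated sf sg'.
pose x (s : R) := lsubmx z + s *: e j.
pose w := rsubmx z.
have x0 : x 0 = lsubmx z by rewrite /x scale0r addr0.
have := @is_cderive_wigner f g z (basis_vec R (lshift d j))
  (fun s y => K (pderiv j f) g (x s) w y + K f (pderiv j g) (x s) w y) sf sg.
rewrite x0 (cintegralD (hC _ _) (hD _ _)); apply.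
  exists (C + D) => s y _; rewrite mulrDl (le_trans (cabsD _ _))// lerD//.
    exact: (hC _ _).2.
  exact: (hD _ _).2.
move=> s y _; rewrite /K; under eq_fun do rewrite lsubmx_line_l rsubmx_line_l.
apply: is_cderive_eq.
  apply: is_cderiveM; first apply: is_cderiveM.
  - exact: is_cderive_cst.
  - apply: (schwartz_line (j := j) (p := fun s => x s + tau *: y) (c := 1) _ sf) => a b.
    by apply/rowP => i; rewrite !mxE; ring.
  - apply: is_cderiveJ.
    apply: (schwartz_line (j := j) (p := fun s => x s - (1 - tau) *: y) (c := 1) _ sg) => a b.
    by apply/rowP => i; rewrite !mxE; ring.
rewrite -/(x s) !mul1r mul0r addr0 addrC; congr (_ + _).
Qed.

Lemma expi_linear_deriv (a : R -> R) (c s : R) :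
  (forall s t, a (s + t) = a s + t * c) ->
  is_cderive s 1 (fun s => expi (a s)) (rc c * ci * expi (a s)).
Proof.
move=> ha; apply: is_cderive_expi_affine => t.
by rewrite -ha -[_ *: _]/(_ * _) mulr1.
Qed.

(** [y] is the difference of the arguments of [f] and of [g]. *)
Lemma wigner_integrand_coord j f g x w y :
  rc (y ord0 j) * K f g x w y = K (X j f) g x w y - K f (X j g) x w y.
Proof.
rewrite /K conjcM conjc_real.
have -> : rc (y ord0 j) = rc ((x + tau *: y) ord0 j) - rc ((x - (1 - tau) *: y) ord0 j).
  by rewrite -rmorphB/=; congr (real_complex _ _); rewrite !mxE; ring.
by ring.
Qed.

Lemma wigner_deriv_frequency j f g z : schwartz f -> schwartz g ->
  is_cderive z (basis_vec R (rshift d j)) (W f g)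
    (- (rc (2 * pi) * ci) * (W (X j f) g z + - 1 * W f (X j g) z)).
Proof.
move=> sf sg; have sf' := schwartz_coord j sf; have sg' := schwartz_coord j sg.
have [C [C0 hC]] := wigner_integrand_dominated sf' sg.
have [D [D0 hD]] := wigner_integrand_dominated sf sg'.
pose w (s : R) := rsubmx z + s *: e j.
pose x := lsubmx z.
have w0 : w 0 = rsubmx z by rewrite /w scale0r addr0.
have hGd s := dominatedZ (- (rc (2 * pi) * ci))
   (dominatedD (hC x (w s)) (dominatedZ (- 1) (hD x (w s)))).
have := @is_cderive_wigner f g z (basis_vec R (rshift d j))
  (fun s y => - (rc (2 * pi) * ci) *
    (K (X j f) g x (w s) y + - 1 * K f (X j g) x (w s) y)) sf sg.
rewrite w0 (cintegralZ _ (dominatedD (hC _ _) (dominatedZ (- 1) (hD _ _)))).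
rewrite (cintegralD (hC _ _) (dominatedZ (- 1) (hD _ _))) (cintegralZ _ (hD _ _)); apply.
  by eexists => s y _; exact: (hGd s).2.
move=> s y _; under eq_fun do rewrite /K lsubmx_line_r rsubmx_line_r.
apply: is_cderive_eq.
  apply: is_cderiveM; first apply: is_cderiveM.
  - apply: (expi_linear_deriv (a := fun s => - (2 * pi * dotp y (w s)))
      (c := - (2 * pi * y ord0 j))) => a b.
    by rewrite /w scalerDl addrA !dotp_line; ring.
  - exact: is_cderive_cst.
  - exact: is_cderive_cst.
rewrite mulN1r -wigner_integrand_coord /K !mulr0 !add0r.
rewrite rmorphN rmorphM/= -/(w s); ring.
Qed.

(** The constant comes from [majorant_mul_le], together with the lower bound
    [2 ^ - d] of the majorant at [s e_j]. *)
Lemma majorant_shift_le (s : R) j y : `|s| < 1 -> majorant (y + s *: e j) <= 2 ^+ d * 2 ^+ d * majorant y.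
Proof.
move=> s1; have Dse : (2 ^+ d)^-1 <= majorant (s *: e j).
  rewrite -exprVn; have -> : 2^-1 ^+ d = \prod_(i < d) (2^-1 : R) by rewrite prodr_const card_ord.
  apply: ler_prod => i _; rewrite invr_ge0 ler0n/= lef_pV2 ?posrE ?oneDsqr_gt0//.
  rewrite !mxE eqxx/=; have := sqr_ge0 s; have : s ^+ 2 <= 1.
    by rewrite -real_normK ?num_real// expr_le1// ltW.
  case: (i == j); rewrite ?mulr1 ?mulr0 ?expr0n/=; lra.
have := majorant_mul_le (y + s *: e j) (s *: e j); rewrite addrK => h.
have p0 : 0 < 2 ^+ d :> R by rewrite exprn_gt0.
apply: (@le_trans _ _ (2 ^+ d * (majorant (y + s *: e j) * majorant (s *: e j)))); last first.
  by rewrite -mulrA ler_wpM2l// ltW.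
rewrite mulrCA -[leLHS]mulr1 ler_wpM2l ?(ltW (majorant_gt0 _))//.
by rewrite mulrC -ler_pdivrMr// mul1r.
Qed.

(** Integration by parts in [y_j]: the integral of the integrand translated by
    [s e_j] does not depend on [s], and its derivative at [s = 0] is the integral
    of the [y_j]-derivative of the integrand. *)
Lemma wigner_integration_by_parts j f g z : schwartz f -> schwartz g ->
  rc (2 * pi) * ci * (rc (z ord0 (rshift d j)) * W f g z) =
  rc tau * W (pderiv j f) g z + - rc (1 - tau) * W f (pderiv j g) z.
Proof.
move=> sf sg; have sf' := schwartz_pderiv j sf; have sg' := schwartz_pderiv j sg.
have [A [A0 hA]] := wigner_integrand_dominated sf sg.
have [C [C0 hC]] := wigner_integrand_dominated sf' sg.
have [D [D0 hD]] := wigner_integrand_dominated sf sg'.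
pose x := lsubmx z; pose w := rsubmx z.
pose F (s : R) y := K f g x w (y + s *: e j).
pose c : R[i] := - (rc (2 * pi) * ci * rc (w ord0 j)).
pose G y := c * K f g x w y + (rc tau * K (pderiv j f) g x w y
  + - rc (1 - tau) * K f (pderiv j g) x w y).
have hG : dominated (cabs c * A + (cabs (rc tau) * C + cabs (- rc (1 - tau)) * D)) G.
  by do 2?apply: dominatedD; exact: dominatedZ.
set B := (cabs c * _ + _) in hG.
have B0 : 0 <= B by rewrite !addr_ge0// mulr_ge0// cabs_ge0.
pose M := 2 ^+ d * 2 ^+ d * (A + B).
have shift_le (E : R) y s : 0 <= E -> E <= A + B -> `|s| < 1 ->
    E * majorant (y + s *: e j) <= M * majorant y.
  move=> E0 EAB s1; rewrite /M mulrAC mulrC; apply: ler_pM => //.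
    by rewrite ltW// majorant_gt0.
  exact: majorant_shift_le.
have dF : is_cderive (0 : R) 1 (fun s => cintegral (F s)) (cintegral (fun y => G (y + 0 *: e j))).
  apply: (@is_cderive_cintegral R d F (fun s y => G (y + s *: e j)) M).
  - move=> s s1; split.
      apply: cmeasurable_comp; first exact: (hA x w).1.
      rewrite (_ : (fun y => _) = rV_aff (fun=> 1) (fun i => (s *: e j) ord0 i)); last first.
        by apply/funext => y; apply/rowP => i; rewrite !mxE mul1r.
      exact: measurable_rV_aff.
    by move=> y; apply: le_trans ((hA x w).2 _) _; apply: shift_le; rewrite ?lerDl.
  - move=> s y s1; apply: le_trans (hG.2 _) _; apply: shift_le => //; by rewrite lerDr.
  - move=> s y s1; rewrite /F /K.
    apply: is_cderive_eq.
      apply: is_cderiveM; first apply: is_cderiveM.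
      + apply: (expi_linear_deriv (a := fun s => - (2 * pi * dotp (y + s *: e j) w))
          (c := - (2 * pi * w ord0 j))) => a b.
        by rewrite !(dotpC _ w) scalerDl addrA !dotp_line; ring.
      + apply: (schwartz_line (j := j) (p := fun s => x + tau *: (y + s *: e j)) (c := tau) _ sf) => a b.
        by apply/rowP => i; rewrite !mxE; ring.
      + apply: is_cderiveJ.
        apply: (schwartz_line (j := j) (p := fun s => x - (1 - tau) *: (y + s *: e j))
          (c := - (1 - tau)) _ sg) => a b.
        by apply/rowP => i; rewrite !mxE; ring.
    rewrite /G /c /K conjcM conjc_real !rmorphN rmorphM; ring.
have F0 : (fun s => cintegral (F s)) = (fun=> cintegral (K f g x w)).
  apply/funext => s; rewrite /F.
  exact: (cintegral_translation (s *: e j) (hA x w).1).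
have : cintegral (fun y => G (y + 0 *: e j)) = 0.
  move: dF; rewrite F0 => -[[_ h1] [_ h2]].
  have [[_ k1] [_ k2]] := is_cderive_cst (0 : R) 1 (cintegral (K f g x w)).
  by apply: complex_ext; rewrite -?h1 -?h2 ?k1 ?k2.
rewrite (cintegral_translation _ hG.1).
rewrite /G (cintegralD (dominatedZ c (hA x w))
  (dominatedD (dominatedZ (rc tau) (hC x w)) (dominatedZ (- rc (1 - tau)) (hD x w)))).
rewrite (cintegralD (dominatedZ (rc tau) (hC x w)) (dominatedZ (- rc (1 - tau)) (hD x w))).
rewrite (cintegralZ _ (hA x w)) (cintegralZ _ (hC x w)) (cintegralZ _ (hD x w)).
rewrite -!wignerE => /eqP; rewrite addrC addr_eq0 => /eqP ->.
by rewrite /c /w mxE; ring.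
Qed.

(** [x = (1 - tau) a + tau b], where [a] and [b] are the arguments of [f] and [g]. *)
Lemma wigner_coord_position j f g z : schwartz f -> schwartz g ->
  rc (z ord0 (lshift d j)) * W f g z =
  rc (1 - tau) * W (X j f) g z + rc tau * W f (X j g) z.
Proof.
move=> sf sg; have sf' := schwartz_coord j sf; have sg' := schwartz_coord j sg.
have [A [A0 hA]] := wigner_integrand_dominated sf sg.
have [C [C0 hC]] := wigner_integrand_dominated sf' sg.
have [D [D0 hD]] := wigner_integrand_dominated sf sg'.
rewrite !wignerE -(cintegralZ _ (hA _ _)) -(cintegralZ _ (hC _ _)) -(cintegralZ _ (hD _ _)).
rewrite -(cintegralD (dominatedZ _ (hC _ _)) (dominatedZ _ (hD _ _))).
congr cintegral; apply/funext => y; rewrite /K conjcM conjc_real.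
set x := lsubmx z.
have -> : rc (z ord0 (lshift d j)) = rc (1 - tau) * rc ((x + tau *: y) ord0 j) +
    rc tau * rc ((x - (1 - tau) *: y) ord0 j).
  by rewrite -!rmorphM -rmorphD/=; congr (real_complex _ _); rewrite !mxE; ring.
by ring.
Qed.

(** Passing to the linear span makes the family stable under partial derivatives
    and under multiplication by coordinates, each of which turns one
    [tau]-Wigner distribution into a combination of two. *)
Inductive wigner_span : ('rV[R]_(d + d) -> R[i]) -> Prop :=
| wspan_base f g : schwartz f -> schwartz g -> wigner_span (W f g)
| wspan_add F G : wigner_span F -> wigner_span G -> wigner_span (fun z => F z + G z)
| wspan_scale c F : wigner_span F -> wigner_span (fun z => c * F z).

Lemma wigner_span_deriv F : wigner_span F -> forall i, exists2 G,
  wigner_span G & forall z, is_cderive z (basis_vec R i) F (G z).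
Proof.
elim=> {F} [f g sf sg i|F G sF ihF sG ihG i|c F sF ih i].
- case: (splitP i) => j ij.
    have -> : i = lshift d j by exact: val_inj.
    exists (fun z => W (pderiv j f) g z + W f (pderiv j g) z).
      by apply: wspan_add; apply: wspan_base => //; exact: schwartz_pderiv.
    by move=> z; exact: wigner_deriv_position.
  have -> : i = rshift d j by exact: val_inj.
  exists (fun z => - (rc (2 * pi) * ci) * (W (X j f) g z + - 1 * W f (X j g) z)).
    apply: wspan_scale; apply: wspan_add; last apply: wspan_scale;
      apply: wspan_base => //; exact: schwartz_coord.
  by move=> z; exact: wigner_deriv_frequency.
- have [F' sF' hF] := ihF i; have [G' sG' hG] := ihG i.
  exists (fun z => F' z + G' z); first exact: wspan_add.
  by move=> z; exact: is_cderiveD.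
- have [G sG hG] := ih i; exists (fun z => c * G z); first exact: wspan_scale.
  by move=> z; exact: is_cderiveZ.
Qed.

Lemma twopi_ci_neq0 : rc (2 * pi) * ci != 0.
Proof.
rewrite mulf_neq0//; apply/eqP => -[]; last by move/eqP; rewrite oner_eq0.
by apply/eqP; rewrite lt0r_neq0// mulr_gt0// pi_gt0.
Qed.

Lemma wigner_span_coord i F : wigner_span F ->
  wigner_span (fun z => rc (z ord0 i) * F z).
Proof.
elim=> {F} [f g sf sg|F G sF ihF sG ihG|c F sF ih].
- case: (splitP i) => j ij.
    have -> : i = lshift d j by exact: val_inj.
    under eq_fun do rewrite wigner_coord_position//.
    by apply: wspan_add; apply: wspan_scale; apply: wspan_base => //; exact: schwartz_coord.
  have -> : i = rshift d j by exact: val_inj.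
  rewrite (_ : (fun z => _) = (fun z => (rc (2 * pi) * ci)^-1 *
    (rc tau * W (pderiv j f) g z + - rc (1 - tau) * W f (pderiv j g) z))); last first.
    apply/funext => z; rewrite -wigner_integration_by_parts// mulKf//.
    exact: twopi_ci_neq0.
  apply: wspan_scale; apply: wspan_add; apply: wspan_scale; apply: wspan_base => //;
    exact: schwartz_pderiv.
- by under eq_fun do rewrite mulrDr; exact: wspan_add.
- by under eq_fun do rewrite mulrCA; exact: wspan_scale.
Qed.

Lemma wigner_span_bounded F : wigner_span F -> exists C, forall z, cabs (F z) <= C.
Proof.
elim=> {F} [f g sf sg|F G sF [A hA] sG [B hB]|c F sF [A hA]].
- have [C [C0 hC]] := wigner_integrand_dominated sf sg.
  by eexists => z; rewrite wignerE; exact: cabs_cintegral_le (hC _ _).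
- by exists (A + B) => z; rewrite (le_trans (cabsD _ _))// lerD.
- by exists (cabs c * A) => z; rewrite cabsM ler_wpM2l// cabs_ge0.
Qed.

(** [1 + |z|] is at most [1 + sum_i |z_i|], so each additional power of the weight
    is paid by one multiplication by a coordinate. *)
Lemma wigner_span_decay F N : wigner_span F -> exists C, forall z, poly_weight N z * cabs (F z) <= C.
Proof.
elim: N F => [|N ih] F sF.
  have [C hC] := wigner_span_bounded sF; exists C => z.
  by rewrite /poly_weight expr0 mul1r.
have [A hA] := ih _ sF.
have /choice[B hB] i := ih _ (wigner_span_coord i sF).
exists (A + \sum_i B i) => z; rewrite /poly_weight exprSr -/(poly_weight N z) mulrDr mulr1 mulrDl lerD//.
have [z0|/mx_norm_neq0[[i0 i] /= zi]] := eqVneq (mx_norm z) 0.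
  rewrite (_ : `|z| = 0)// mulr0 mul0r sumr_ge0// => i _.
  by apply: le_trans (hB i z); rewrite mulr_ge0 ?poly_weight_ge0 ?cabs_ge0.
have {}zi : `|z| = `|z ord0 i| by rewrite (ord1 i0) in zi.
rewrite (bigD1 i)//= ler_wpDr ?sumr_ge0//.
  move=> j _; apply: le_trans (hB j z).
  by rewrite mulr_ge0 ?poly_weight_ge0 ?cabs_ge0.
by apply: le_trans (hB i z); rewrite cabsM cabs_real zi mulrA.
Qed.

Lemma wigner_schwartz f g : schwartz f -> schwartz g -> schwartz (W f g).
Proof.
move=> sf sg.
suff sW : schwartz_bounded (fun _ : unit => W f g) by exact: (schwartz_boundedP tt sW).
apply: (@schwartz_bounded_coind R _ unit (fun F => wigner_span (F tt))); last exact: wspan_base.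
- move=> F sF i; have [G sG hG] := wigner_span_deriv sF i.
  by exists (fun=> G) => // -[].
- move=> F sF N; have [C hC] := wigner_span_decay N sF.
  by exists C => -[].
Qed.

End wigner_schwartz.

(** * The cardinal sine as a limit of products of cosines *)
Section sinc.
Variable R : realType.
Implicit Types (t u : R).

Lemma MVT_line1 (f df : R -> R) : (forall t, is_derive t 1 f (df t)) ->
  forall u, exists2 t, `|t| <= `|u| & f u - f 0 = u * df t.
Proof.
move=> hf u; have [t tu E] := MVT_line_norm hf 0 u.
by exists t => //; move: E; rewrite !add0r -![_ *: _]/(_ * _) !mulr1.
Qed.

Lemma cos_sub1_le t : `|cos t - 1| <= `|t|.
Proof.
have [s _ E] := MVT_line1 (fun t => is_derive_cos t) t.
rewrite -[X in cos t - X]cos0 E normrM normrN ler_piMr//; exact: sin_max.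
Qed.

Lemma sin_subid_le t : `|sin t - t| <= t ^+ 2.
Proof.
have [s st E] := MVT_line1 (fun t => is_derive_sin t) t.
rewrite sin0 subr0 in E; rewrite E -{2}[t]mulr1 -mulrBr normrM -real_normK ?num_real// expr2.
by rewrite ler_wpM2l// (le_trans (cos_sub1_le s)).
Qed.

Definition cos_product n t : R := \prod_(k < n) cos (t / 2 ^+ k.+1).

Definition sinc t : R := if t == 0 then 1 else sin t / t.

Lemma cos_product_sin n t : 2 ^+ n * sin (t / 2 ^+ n) * cos_product n t = sin t.
Proof.
elim: n => [|n ih]; first by rewrite /cos_product big_ord0 expr0 divr1 mul1r mulr1.
rewrite -[RHS]ih {1}/cos_product big_ord_recr/= -/(cos_product n t).
have -> : t / 2 ^+ n = (t / 2 ^+ n.+1) *+ 2.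
  by rewrite -mulr_natr exprSr; field; rewrite expf_neq0.
rewrite sin_mulr2n -mulr_natr exprSr; ring.
Qed.

(** By the duplication formula the product is [sin t / (2 ^ n sin (t / 2 ^ n))]
    as soon as the denominator, which tends to [t], does not vanish. *)
Lemma cos_product_cvg t : cos_product ^~ t @ \oo --> sinc t.
Proof.
rewrite /sinc; have [->|t0] := eqVneq t 0.
  rewrite (_ : cos_product ^~ 0 = cst 1); first exact: cvg_cst.
  apply/funext => n; rewrite /cos_product big1// => k _.
  by rewrite mul0r cos0.
pose a n := 2 ^+ n * sin (t / 2 ^+ n).
have p2 n : (0 : R) < 2 ^+ n by rewrite exprn_gt0.
have at_le n : `|a n - t| <= t ^+ 2 * (2^-1) ^+ n.
  have -> : a n - t = 2 ^+ n * (sin (t / 2 ^+ n) - t / 2 ^+ n).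
    by rewrite mulrBr [in RHS](mulrCA (2 ^+ n)) divff ?mulr1// lt0r_neq0.
  rewrite normrM ger0_norm ?(ltW (p2 n))//.
  apply: le_trans (ler_wpM2l (ltW (p2 n)) (sin_subid_le _)) _.
  rewrite exprVn (_ : 2 ^+ n * _ = t ^+ 2 / 2 ^+ n)//.
  by field; rewrite expf_neq0.
have a_cvg : a @ \oo --> t.
  apply/cvgrPdist_le => e e0.
  have : (fun n => t ^+ 2 * (2^-1) ^+ n) @ \oo --> (0 : R).
    by apply: cvg_geometric; rewrite ger0_norm ?invf_lt1// ltr1n.
  move=> /cvgrPdist_le/(_ e e0); apply: filterS => n; rewrite sub0r normrN => h.
  by rewrite distrC (le_trans (at_le n))// (le_trans _ h)// ler_norm.
have : (fun n => sin t / a n) @ \oo --> sin t / t.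
  by apply: cvgM; [exact: cvg_cst|exact: cvgV].
apply: cvg_trans; apply: near_eq_cvg.
have : \forall n \near \oo, a n != 0 by exact: (cvgr_neq0 t).
apply: filterS => n an0.
by rewrite -(cos_product_sin n t) -/(a n) mulrC mulKf.
Qed.

Lemma sinc_near t : `|sinc t - 1| <= `|t|.
Proof.
rewrite /sinc; have [->|t0] := eqVneq t 0; first by rewrite subrr.
have -> : sin t / t - 1 = (sin t - t) / t by rewrite mulrBl divff.
rewrite normrM normfV ler_pdivrMr ?normr_gt0// (le_trans (sin_subid_le t))//.
by rewrite -real_normK ?num_real// expr2.
Qed.

Lemma sinc_le1 t : `|sinc t| <= 1.
Proof.
rewrite /sinc; have [_|t0] := eqVneq t 0; first by rewrite normr1.
have [s _ E] := MVT_line1 (fun t => is_derive_sin t) t.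
rewrite sin0 subr0 in E.
by rewrite E mulrC mulKf// cos_max.
Qed.

(** Up to [pi], [sinc t = cos (t / 2) sinc (t / 2)] and the cosine is decreasing;
    beyond [pi], [|sinc t| <= 1 / |t| <= 1 / 2]. *)
Lemma sinc_far (e : R) : 0 < e -> e <= 1 -> exists2 q, 0 <= q < 1 &
  forall t, e <= `|t| -> `|sinc t| <= q.
Proof.
move=> e0 e1; have pi2 := pi_ge2 R.
have c1 : cos (e / 2) < 1.
  rewrite -[X in _ < X]cos0 ltr_cos ?in_itv/= ?lexx ?pi_ge0//; first by rewrite divr_gt0.
  by apply/andP; split; lra.
have c0 : 0 <= cos (e / 2) by apply: cos_ge0_pihalf; apply/andP; split; lra.
exists (Num.max (cos (e / 2)) 2^-1).
  by rewrite le_max c0/= gt_max c1 invf_lt1 ?ltr1n.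
move=> t et.
have t0 : t != 0 by rewrite -normr_gt0 (lt_le_trans e0).
rewrite le_max; apply/orP; have [tpi|tpi] := leP `|t| pi; [left|right]; last first.
  rewrite /sinc (negbTE t0) normrM normfV ler_pdivrMr ?normr_gt0//.
  rewrite (le_trans (sin_max t))// mulrC ler_pdivlMr// mul1r.
  by rewrite (le_trans pi2)// ltW.
have t2 : t / 2 != 0 by rewrite mulf_neq0// invr_neq0// pnatr_eq0.
have -> : sinc t = cos (t / 2) * sinc (t / 2).
  rewrite /sinc (negbTE t0) (negbTE t2) {1}(_ : t = (t / 2) *+ 2); last first.
    by rewrite -mulr_natr divfK// pnatr_eq0.
  by rewrite sin_mulr2n -mulr_natr; field.
rewrite normrM.
apply: (@le_trans _ _ `|cos (t / 2)|); first by rewrite ler_piMr ?sinc_le1.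
have -> : cos (t / 2) = cos (`|t| / 2).
  by have [//|_] := ger0P t; rewrite mulNr cosN.
rewrite ger0_norm; last by apply: cos_ge0_pihalf; apply/andP; split; have := normr_ge0 t; lra.
move: et; rewrite le_eqVlt => /predU1P[<-//|et]; apply: ltW.
have := normr_ge0 t; move: et tpi; move: `|t| => s et tpi s0.
rewrite ltr_cos ?in_itv/=; first by rewrite ltr_pM2r.
  by apply/andP; split; lra.
by apply/andP; split; lra.
Qed.

End sinc.

(** * Multipliers preserving the vanishing of Fourier integrals *)
Section fourier_uniqueness.
Variables (R : realType) (n : nat).
Local Notation rc := (real_complex R).
Local Notation Re := complex.Re.
Local Notation Im := complex.Im.
Local Notation V := 'rV[R]_n.
Local Notation leb := (lebesgue_rV R n).
Variables (h : V -> R[i]) (C : R).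
Hypothesis hC : dominated C h.

Let H (w : V) y := expi (- (2 * pi * dotp y w)) * h y.

Hypothesis fourier0 : forall w, cintegral (H w) = 0.

(** The bounded multipliers that preserve the vanishing of all Fourier
    integrals of [h].  All frequencies are kept in the definition, because
    multiplication by a cosine shifts the frequency. *)
Definition annihilating (k : V -> R) : Prop :=
  [/\ measurable_fun setT k, forall y, `|k y| <= 1 &
      forall w, cintegral (fun y => rc (k y) * H w y) = 0].

Lemma dominated_multiplier (k : V -> R) w : measurable_fun setT k ->
  (forall y, `|k y| <= 1) -> dominated C (fun y => rc (k y) * H w y).
Proof.
move=> mk k1; have [mh hC'] := hC; split.
  apply: cmeasurableM; first by split => //=; exact: measurable_cst.
  apply: cmeasurableM => //; apply: cmeasurable_expi; apply: measurable_funN.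
  apply: measurable_funM; first exact: measurable_cst.
  rewrite (_ : (fun y => dotp y w) = dotp w); first exact: measurable_dotp.
  by apply/funext => y; apply: eq_bigr => i _; rewrite mulrC.
move=> y; rewrite !cabsM cabs_real cabs_expi mul1r; apply: le_trans (hC' y).
by rewrite ler_piMl ?cabs_ge0.
Qed.

Lemma annihilating1 : annihilating (fun=> 1).
Proof.
split=> [|y|w]; [exact: measurable_cst|by rewrite normr1|].
by rewrite -[RHS](fourier0 w); congr cintegral; apply/funext => y; rewrite mul1r.
Qed.

Lemma annihilating_cos i (a : R) k : annihilating k ->
  annihilating (fun y : V => cos (a * y ord0 i) * k y).
Proof.
move=> [mk k1 k0]; split=> [|y|w].
- apply: measurable_funM => //.
  apply: (@measurableT_comp _ _ _ _ _ _ (fun t : R => cos (a * t))).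
    apply: continuous_measurable_fun => t; apply: continuous_comp.
      by apply: cvgM; [exact: cvg_cst|exact: cvg_id].
    exact: continuous_cos.
  exact: measurable_rV_coord.
- by rewrite normrM -[leRHS]mulr1 ler_pM// cos_max.
(* the exponentials that make up the cosine move the frequency *)
have Hshift (s : R) (y : V) : expi (s * (a * y ord0 i)) * H w y =
    H (w + (- (s * a / (2 * pi))) *: basis_vec R i) y.
  rewrite /H mulrA -expiD; congr (expi _ * _).
  rewrite dotp_line; have := lt0r_neq0 (pi_gt0 R); move: (pi : R) => p p0.
  by field.
have E (y : V) : rc (cos (a * y ord0 i) * k y) * H w y =
    rc 2^-1 * (rc (k y) * H (w + (- (1 * a / (2 * pi))) *: basis_vec R i) y +
            rc (k y) * H (w + (- (- 1 * a / (2 * pi))) *: basis_vec R i) y).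
  rewrite -!Hshift mul1r mulN1r rmorphM/= -mulrDr -mulrDl.
  have -> : rc (cos (a * y ord0 i)) =
      rc 2^-1 * (expi (a * y ord0 i) + expi (- (a * y ord0 i))).
    rewrite /expi cosN sinN !complexE/=; congr Complex; last by ring.
    by field.
  by ring.
under [X in cintegral X]funext do rewrite E.
rewrite (cintegralZ _ (dominatedD (dominated_multiplier _ mk k1) (dominated_multiplier _ mk k1))).
rewrite (cintegralD (dominated_multiplier _ mk k1) (dominated_multiplier _ mk k1)).
by rewrite !k0 addr0 mulr0.
Qed.

Lemma annihilating_lim (k_ : nat -> V -> R) k :
  (forall m, annihilating (k_ m)) -> (forall y, k_ ^~ y @ \oo --> k y) ->
  annihilating k.
Proof.
move=> ak kc.
have mk : measurable_fun setT k.
  apply: (measurable_fun_cvg (h := k_)) => [m|y _]; last exact: kc.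
  by have [] := ak m.
have k1 y : `|k y| <= 1.
  apply: (closed_cvg (fun r : R => r <= 1) (@closed_le R 1)) (cvg_norm (kc y)).
  by apply: nearW => m; have [_ + _] := ak m; exact.
split=> // w.
have key (u : V -> R) : (forall y, `|u y| <= C * majorant y) -> measurable_fun setT u ->
    (forall m, \int[leb]_y (k_ m y * u y) = 0) -> \int[leb]_y (k y * u y) = 0.
  move=> uC mu k0.
  have im m : leb.-integrable setT (fun y => (k_ m y * u y)%:E).
    apply: le_integrable (integrable_majorant n C) => //.
      by apply/measurable_EFinP; apply: measurable_funM => //; have [] := ak m.
    move=> y _; rewrite lee_fin; apply: le_trans (ler_norm _).
    apply: le_trans (uC y); rewrite normrM ler_piMl//.
    by have [_ + _] := ak m; exact.
  have : (\int[leb]_y (k_ m y * u y)%:E @[m --> \oo] --> \int[leb]_y (k y * u y)%:E)%E.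
    apply: (@dominated_cvg _ _ _ leb setT measurableT
      (fun m y => (k_ m y * u y)%:E) (fun y => (k y * u y)%:E) (fun y => (C * majorant y)%:E)) => //.
    - by move=> m; have /integrableP[] := im m.
    - move=> y _; apply: cvg_EFin; first exact: nearW.
      by apply: cvgM => //; exact: cvg_cst.
    - exact: integrable_majorant.
    - move=> m y _; rewrite lee_fin; apply: le_trans (uC y).
      rewrite normrM ler_piMl//.
      by have [_ + _] := ak m; exact.
  rewrite (_ : (fun m => _) = cst 0%E); last first.
    apply/funext => m /=; rewrite -[LHS]fineK; last exact: integrable_fin_num.
    by rewrite (_ : fine _ = \int[leb]_y (k_ m y * u y))// k0.
  move=> /(cvg_unique (@ereal_hausdorff R) (cvg_cst _)) h0.
  by rewrite /Rintegral -h0.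
have HC y : cabs (H w y) <= C * majorant y.
  by rewrite cabsM cabs_expi mul1r; exact: hC.2.
have [[mr mi] _] := dominated_multiplier w (@measurable_cst _ _ _ _ setT (1 : R))
  (fun y => eq_ind_r (fun x => x <= 1) (lexx 1) (normr1 R)).
apply: complex_ext => /=.
  rewrite -(key (fun y => Re (H w y))).
  - by apply: eq_Rintegral => y _; rewrite complexM/= mul0r subr0.
  - by move=> y; exact: le_trans (Re_le_cabs _) (HC y).
  - by move: mr; under eq_fun do rewrite complexM/= mul1r mul0r subr0.
  - move=> m; have [_ _ /(_ w)] := ak m; rewrite /cintegral => -[<- _].
    by apply: eq_Rintegral => y _; rewrite complexM/= mul0r subr0.
rewrite -(key (fun y => Im (H w y))).
- by apply: eq_Rintegral => y _; rewrite complexM/= mul0r addr0.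
- by move=> y; exact: le_trans (Im_le_cabs _) (HC y).
- by move: mi; under eq_fun do rewrite complexM/= mul1r mul0r addr0.
- move=> m; have [_ _ /(_ w)] := ak m; rewrite /cintegral => -[_ <-].
  by apply: eq_Rintegral => y _; rewrite complexM/= mul0r addr0.
Qed.

Lemma annihilating_cos_product i m k : annihilating k ->
  annihilating (fun y : V => cos_product m (y ord0 i) * k y).
Proof.
move=> ak; elim: m => [|m ih].
  by under eq_fun do rewrite /cos_product big_ord0 mul1r.
rewrite (_ : (fun y => _) = (fun y : V => cos ((2 ^+ m.+1)^-1 * y ord0 i) *
  (cos_product m (y ord0 i) * k y))); first exact: annihilating_cos.
apply/funext => y; rewrite {1}/cos_product big_ord_recr/= -/(cos_product m _).
by rewrite [in RHS](mulrC _^-1); ring.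
Qed.

Lemma annihilating_sinc i k : annihilating k ->
  annihilating (fun y : V => sinc (y ord0 i) * k y).
Proof.
move=> ak; apply: (annihilating_lim (k_ := fun m y => cos_product m (y ord0 i) * k y)).
  by move=> m; exact: annihilating_cos_product.
by move=> y; apply: cvgM; [exact: cos_product_cvg|exact: cvg_cst].
Qed.

Definition sinc_kernel (y : V) : R := \prod_(i < n) sinc (y ord0 i) ^+ 2.

Lemma annihilating_mul_kernel k : annihilating k ->
  annihilating (fun y => sinc_kernel y * k y).
Proof.
move=> ak; rewrite /sinc_kernel; elim: (index_enum _) => [|i s ihs].
  by under eq_fun do rewrite big_nil mul1r.
under eq_fun do rewrite big_cons expr2 -!mulrA.
by do 2 apply: annihilating_sinc.
Qed.

Lemma annihilating_sinc_kernel m : annihilating (fun y => sinc_kernel y ^+ m).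
Proof.
elim: m => [|m ih]; first exact: annihilating1.
by under eq_fun do rewrite exprS; exact: annihilating_mul_kernel.
Qed.

Lemma sinc_kernel_ge0 y : 0 <= sinc_kernel y.
Proof. by apply: prodr_ge0 => i _; exact: sqr_ge0. Qed.

Lemma sinc_kernel_near (e : R) : 0 < e -> exists2 r, 0 < r &
  forall y : V, `|y| <= r -> 1 - e <= sinc_kernel y.
Proof.
move=> e0; pose r := Num.min 1 (e / (2 * n.+1%:R)).
have r0 : 0 < r by rewrite lt_min ltr01 divr_gt0// mulr_gt0.
exists r => // y yr.
have r1 : r <= 1 by rewrite ge_min lexx.
have sq i : 1 - 2 * r <= sinc (y ord0 i) ^+ 2 <= 1.
  have := sinc_near (y ord0 i); have := rV_coord_le y i.
  have := sinc_le1 (y ord0 i); rewrite -real_normK ?num_real// => s1 yi.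
  move: (s1); rewrite ler_norml => /andP[_ s1'].
  rewrite ler_distl => /andP[h1 _].
  rewrite expr_le1// s1 andbT.
  have [s0|s0] := leP 0 (sinc (y ord0 i)).
    by rewrite ger0_norm//; move: yr yi h1; move: `|y| `|y ord0 i| => a b *; nra.
  have : 1 - r < 0 by move: yr yi h1 s0; move: `|y| `|y ord0 i| => a b *; lra.
  by rewrite subr_lt0 ltNge r1.
suff : 1 - n%:R * (2 * r) <= sinc_kernel y.
  apply: le_trans; rewrite lerD2l lerN2.
  have : r <= e / (2 * n.+1%:R) by rewrite ge_min lexx orbT.
  rewrite ler_pdivlMr ?mulr_gt0// -natr1 => h1.
  have := ler0n R n; nra.
suff H1 (s : seq 'I_n) : 1 - (size s)%:R * (2 * r) <= \prod_(i <- s) sinc (y ord0 i) ^+ 2.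
  have := H1 (index_enum _).
  by rewrite [size _](_ : _ = n)// [index_enum 'I_n]unlock -enumT size_enum_ord.
elim: s => [|i s ih] /=; first by rewrite big_nil mul0r subr0.
rewrite big_cons -natr1 mulrDl mul1r.
have P01 : 0 <= \prod_(j <- s) sinc (y ord0 j) ^+ 2 <= 1.
  elim/big_ind : _ => [|a b /andP[a0 a1] /andP[b0 b1]|j _]; first by rewrite ler01 lexx.
    by rewrite mulr_ge0//= mulr_ile1.
  by rewrite sqr_ge0/=; have /andP[] := sq j.
have := sq i; have := sqr_ge0 (sinc (y ord0 i)); move: ih P01.
move: (\prod_(j <- s) _) (sinc _ ^+ 2) => P a ih /andP[P0 P1] a0 /andP[a1 a2].
have := mulr_ge0 (ltW r0) P0; have : 0 <= r * (1 - P) by rewrite mulr_ge0 ?subr_ge0// ltW.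
have : 0 <= (a - (1 - 2 * r)) * P by rewrite mulr_ge0// subr_ge0.
nra.
Qed.

Lemma sinc_kernel_far (e : R) : 0 < e -> exists2 q, 0 <= q < 1 &
  forall y : V, e <= `|y| -> sinc_kernel y <= q.
Proof.
move=> e0; pose r := Num.min 1 e.
have r0 : 0 < r by rewrite lt_min ltr01.
have r1 : r <= 1 by rewrite ge_min lexx.
have [q /andP[q0 q1] hq] := sinc_far r0 r1.
exists (q ^+ 2); first by rewrite exprn_ge0//= expr_lt1.
move=> y ey.
have [i yi] : exists i, `|y| = `|y ord0 i|.
  have : mx_norm y != 0 by apply: lt0r_neq0; exact: lt_le_trans e0 ey.
  by move=> /mx_norm_neq0[[i j] /= E]; exists j; rewrite (ord1 i) in E.
rewrite /sinc_kernel (bigD1 i)//= -[leRHS]mulr1.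
have sq j : 0 <= sinc (y ord0 j) ^+ 2 <= 1.
  by rewrite sqr_ge0 -real_normK ?num_real// expr_le1// sinc_le1.
apply: ler_pM; rewrite ?sqr_ge0//.
- by apply: prodr_ge0 => j _; exact: sqr_ge0.
- rewrite -real_normK ?num_real// lerXn2r ?nnegrE// hq// -yi.
  by apply: le_trans ey; rewrite ge_min lexx orbT.
- by apply: prodr_ile1 => j _; exact: sq.
Qed.

End fourier_uniqueness.

(** * Uniqueness for Fourier integrals *)
Section fourier_vanish.
Variables (R : realType) (n : nat).
Local Notation rc := (real_complex R).
Local Notation Re := complex.Re.
Local Notation Im := complex.Im.
Local Notation V := 'rV[R]_n.
Local Notation leb := (lebesgue_rV R n).

Definition cube_indic (r : R) (y : V) : R :=
  \prod_(i < n) \1_(`[- r, r]%classic : set R) (y ord0 i).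

Lemma cube_indicE (r : R) (y : V) : 0 <= r -> cube_indic r y = (`|y| <= r :> R)%R%:R.
Proof.
move=> r0; have [yr|yr] := leP `|y| r.
  rewrite /cube_indic big1// => i _; rewrite indicE mem_set//= in_itv/= -ler_norml.
  by rewrite (le_trans (rV_coord_le y i)).
have [i yi] : exists i, `|y| = `|y ord0 i|.
  have : mx_norm y != 0 by apply: lt0r_neq0; exact: le_lt_trans r0 yr.
  by move=> /mx_norm_neq0[[i j] /= E]; exists j; rewrite (ord1 i) in E.
rewrite /cube_indic (bigD1 i)//= indicE memNset ?mul0r//=.
by rewrite in_itv/= -ler_norml -yi leNgt yr.
Qed.

Lemma integral_cube_indic (r : R) : 0 < r ->
  (\int[leb]_y (cube_indic r y)%:E = ((2 * r) ^+ n)%:E)%E.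
Proof.
move=> r0.
have E : (\int[@lebesgue_measure R]_t (\1_(`[- r, r]%classic : set R) t)%:E = (2 * r)%:E)%E.
  rewrite integral_indic// setIT -[LHS]/(@lebesgue_measure R `[- r, r]%classic).
  rewrite lebesgue_measure_itv/= lte_fin ifT; last by lra.
  by rewrite -EFinD; congr EFin; lra.
by rewrite (ge0_integral_prod n (u := \1_(`[- r, r]%classic : set R))) ?E ?ltry//.
Qed.

Lemma integrable_cube_indic (r : R) : 0 < r ->
  leb.-integrable setT (fun y => (cube_indic r y)%:E).
Proof.
move=> r0; apply/integrableP; split.
  apply/measurable_EFinP; apply: measurable_prod => i _.
  have mi : measurable_fun setT (\1_(`[- r, r]%classic : set R) : R -> R).
    by apply: measurable_indic; exact: measurable_itv.
  exact: (measurableT_comp mi (measurable_rV_coord i)).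
have c0 y : 0 <= cube_indic r y by rewrite (cube_indicE _ (ltW r0)) ler0n.
under eq_integral do rewrite /= ger0_norm//.
by rewrite integral_cube_indic// ltry.
Qed.

Variables (h : V -> R[i]) (C : R).
Hypothesis hC : dominated C h.
Hypothesis fourier0 :
  forall w, cintegral (fun y => expi (- (2 * pi * dotp y w)) * h y) = 0.

(** Near the origin the real part [r] of the rotated function is bounded below,
    and the [m]-th power of the kernel is at least [rho ^ m]; away from it the
    power is at most [q ^ m] with [q < rho].  As the integral of the product
    vanishes for every [m], letting [m] grow gives a contradiction. *)
Lemma fourier_vanish :
  {for 0, continuous (fun y => Re (h y))} -> {for 0, continuous (fun y => Im (h y))} ->
  h 0 = 0.
Proof.
move=> cr ci; apply: contrapT => h0.
(* rotate [h] so that its value at [0] becomes positive *)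
pose c := conjc (h 0); pose r y := Re (c * h y).
have r0 : 0 < r 0.
  rewrite /r /c; move: h0; case: (h 0) => a b ab; rewrite complexM/=.
  rewrite mulNr opprK -!expr2 lt_def addr_ge0 ?sqr_ge0// andbT.
  apply/negP; rewrite paddr_eq0 ?sqr_ge0// !sqrf_eq0 => /andP[/eqP a0 /eqP b0].
  by apply: ab; rewrite a0 b0.
pose eps := r 0 / 2; have eps0 : 0 < eps by rewrite divr_gt0.
have ch : dominated (cabs c * C) (fun y => c * h y) by exact: dominatedZ.
have [ir _] := dominated_integrable ch.
pose K := @sinc_kernel R n.
have K0 y : 0 <= K y by exact: sinc_kernel_ge0.
have Kr0 m : \int[leb]_y (K y ^+ m * r y) = 0.
  have [mK K1 /(_ 0)] := annihilating_sinc_kernel hC fourier0 m.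
  have dK := dominated_multiplier hC 0 mK K1.
  move=> Km0; have : cintegral (fun y => c *
     (rc (K y ^+ m) * (expi (- (2 * pi * dotp y 0)) * h y))) = 0.
    by rewrite (cintegralZ _ dK) Km0 mulr0.
  move=> [+ _]; move=> <-; apply: eq_Rintegral => y _.
  rewrite (_ : dotp y 0 = 0); last first.
    by rewrite /dotp big1// => i _; rewrite mxE mulr0.
  rewrite mulr0 oppr0 expi0 mul1r mulrCA /r [in RHS]complexM/=.
  by rewrite mul0r subr0.
have c_r : {for 0, continuous r}.
  rewrite (_ : r = (fun y => Re c * Re (h y) - Im c * Im (h y))); last first.
    by apply/funext => y; rewrite /r complexM.
  apply: (@continuousB _ R^o _ (fun y => Re c * Re (h y)) (fun y => Im c * Im (h y))).
    by apply: (@continuousM R _ (fun=> Re c) _ _ _ cr); exact: cst_continuous.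
  by apply: (@continuousM R _ (fun=> Im c) _ _ _ ci); exact: cst_continuous.
have [dl dl0 hdl] : exists2 dl, 0 < dl & forall y, `|y| < dl -> eps <= r y.
  have /(@cvgrPdist_lt R R^o _ (nbhs (0 : V)) (nbhs_filter _))/(_ _ eps0)/nbhs_ballP[e /= e0 he] := c_r.
  exists e => // y ye.
  have : ball (0 : V) e y by rewrite -ball_normE/= sub0r normrN.
  move=> /he /=; rewrite ltr_distl => /andP[_].
  by rewrite [in X in X -> _](splitr (r 0)) -/eps ltrD2r => /ltW.
have [q /andP[q0 q1] hq] := sinc_kernel_far n dl0.
have e0 : 0 < (1 - q) / 2 by rewrite divr_gt0// subr_gt0.
have [s s0 hs] := sinc_kernel_near n e0.
(* [rho], the midpoint of [q] and [1], bounds the kernel from below near [0] *)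
pose rho := 1 - (1 - q) / 2.
have rhoq : q < rho by rewrite /rho; lra.
have rho0 : 0 < rho by apply: le_lt_trans rhoq.
pose s' := Num.min s (dl / 2).
have s'0 : 0 < s' by rewrite lt_min s0 divr_gt0.
have s's : s' <= s by rewrite ge_min lexx.
have s'dl : s' < dl.
  by apply: (@le_lt_trans _ _ (dl / 2)); [rewrite ge_min lexx orbT|lra].
pose M := \int[leb]_y `|r y|.
have ptw m y : rho ^+ m * eps * cube_indic s' y - q ^+ m * `|r y| <= K y ^+ m * r y.
  rewrite (cube_indicE _ (ltW s'0)); have [ys|ys] := leP `|y| s'.
    have ry : eps <= r y by apply: hdl; exact: le_lt_trans ys s'dl.
    apply: (@le_trans _ _ (rho ^+ m * eps)).
      by rewrite mulr1 gerBl mulr_ge0// exprn_ge0.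
    have Ky : rho <= K y by apply: hs; exact: le_trans ys s's.
    rewrite ler_pM ?(ltW eps0) ?exprn_ge0 ?(ltW rho0)//.
    by rewrite lerXn2r ?nnegrE ?(ltW rho0).
  rewrite mulr0 sub0r; have [ydl|ydl] := ltP `|y| dl.
    apply: (@le_trans _ _ 0); first by rewrite oppr_le0 mulr_ge0// exprn_ge0.
    by rewrite mulr_ge0 ?exprn_ge0// (le_trans (ltW eps0))// hdl.
  rewrite lerNl -mulrN; apply: (@le_trans _ _ (K y ^+ m * `|r y|)).
    by rewrite ler_wpM2l ?exprn_ge0// -normrN ler_norm.
  by rewrite ler_wpM2r// lerXn2r ?nnegrE// hq.
have iM : leb.-integrable setT (fun y => `|r y|%:E) by exact: integrable_norm ir.
have iZ (k : R) (u : V -> R) : leb.-integrable setT (fun y => (u y)%:E) ->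
    leb.-integrable setT (EFin \o (fun y => k * u y)).
  move=> iu; rewrite (_ : _ \o _ = (fun y => k%:E * (u y)%:E)%E); last exact/funext.
  exact: integrableZl.
have ineq m : rho ^+ m * eps * (2 * s') ^+ n <= q ^+ m * M.
  rewrite -subr_le0 -(Kr0 m).
  have -> : rho ^+ m * eps * (2 * s') ^+ n - q ^+ m * M =
      \int[leb]_y (rho ^+ m * eps * cube_indic s' y - q ^+ m * `|r y|).
    rewrite RintegralB//; [|exact: iZ (integrable_cube_indic s'0)|exact: iZ].
    rewrite !RintegralZl//; last exact: integrable_cube_indic.
    by rewrite [in RHS]/Rintegral integral_cube_indic.
  apply: le_Rintegral => //.
  - have := integrableB measurableT (iZ (rho ^+ m * eps) _ (integrable_cube_indic s'0))
      (iZ (q ^+ m) _ iM).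
    by apply: eq_integrable => // y _ /=; rewrite EFinB.
  - apply: le_integrable (integrableZl _ 1 ir) => //.
      apply/measurable_EFinP; apply: measurable_funM; last first.
        by have /integrableP[/measurable_EFinP] := ir.
      by have [+ _ _] := annihilating_sinc_kernel hC fourier0 m.
    move=> y _; rewrite mul1e lee_fin normrM ler_piMl//.
    by have [_ + _] := annihilating_sinc_kernel hC fourier0 m; exact.
pose t := q / rho.
have t1 : `|t| < 1.
  by rewrite ger0_norm ?divr_ge0// ?(ltW rho0)// ltr_pdivrMr// mul1r.
have ineq' m : eps * (2 * s') ^+ n <= M * t ^+ m.
  rewrite /t expr_div_n mulrA ler_pdivlMr ?exprn_gt0// (mulrC M).
  by apply: le_trans (ineq m); rewrite mulrC mulrA.
have : eps * (2 * s') ^+ n <= 0.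
  have /cvg_lim <- // := @cvg_geometric R M t t1.
  apply: limr_ge; first by apply/cvg_ex; exists 0; exact: cvg_geometric.
  by apply: nearW => m; exact: ineq'.
by rewrite leNgt mulr_gt0// exprn_gt0// mulr_gt0.
Qed.

End fourier_vanish.

(** * The [tau]-Wigner distribution of a nonzero function is nonzero *)
Section wigner_neq0.
Variables (R : realType) (d : nat) (tau : R).
Local Notation rc := (real_complex R).
Local Notation Re := complex.Re.
Local Notation Im := complex.Im.
Local Notation V := 'rV[R]_d.

(** For fixed [a], [w |-> W_tau(phi, phi)(a, w)] consists of the Fourier integrals
    of a function [h] of [y] with [h 0 = |phi a| ^ 2]. *)
Lemma wigner_neq0 (phi : V -> R[i]) : schwartz phi -> phi <> (fun=> 0) ->
  tau_wigner tau phi phi <> (fun=> 0).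
Proof.
move=> sphi phi0 W0; apply: phi0; apply/funext => a.
pose h (y : V) := phi (a + tau *: y) * conjc (phi (a - (1 - tau) *: y)).
suff : h 0 = 0.
  rewrite /h !scaler0 addr0 subr0 => /(congr1 (@cabs R)).
  rewrite cabsM cabsJ cabs0 => /eqP; rewrite mulf_eq0 orbb => /eqP.
  exact: cabs_eq0.
have [C [C0 hC]] := wigner_integrand_dominated tau sphi sphi.
have hE w y : wigner_integrand tau phi phi a w y = expi (- (2 * pi * dotp y w)) * h y.
  by rewrite /wigner_integrand /h mulrA.
have dh : dominated C h.
  have := hC a 0; congr dominated; apply/funext => y; rewrite hE.
  rewrite (_ : dotp y 0 = 0); last by rewrite /dotp big1// => i _; rewrite mxE mulr0.
  by rewrite mulr0 oppr0 expi0 mul1r.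
have [cr ci] : continuous (fun x => Re (phi x)) /\ continuous (fun x => Im (phi x)).
  by have [/(_ [::])[]] := sphi.
have aff (c : R) : continuous (fun y : V => a + c *: y).
  move=> y; apply: (@continuousD R V V (fun=> a) (fun y => c *: y)).
    exact: cst_continuous.
  exact: scaler_continuous.
have comp (g : V -> R) (c : R) : continuous g -> continuous (fun y : V => g (a + c *: y)).
  by move=> cg y; apply: (@continuous_comp _ _ _ (fun y : V => a + c *: y) g);
    [exact: aff|exact: cg].
apply: (fourier_vanish dh).
- move=> w; have := congr1 (fun F => F (row_mx a w)) W0.
  rewrite wignerE row_mxKl row_mxKr => <-; congr cintegral; apply/funext => y.
  by rewrite hE.
- rewrite (_ : (fun y => Re (h y)) = (fun y => Re (phi (a + tau *: y)) * Re (phi (a + - (1 - tau) *: y)) +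
    Im (phi (a + tau *: y)) * Im (phi (a + - (1 - tau) *: y)))); last first.
    by apply/funext => y; rewrite /h !complexE/= scaleNr; ring.
  apply: (@continuousD R R^o V); apply: (@continuousM R V); 
    first [exact: (comp (fun x => Re (phi x)) _ cr)|exact: (comp (fun x => Im (phi x)) _ ci)].
- rewrite (_ : (fun y => Im (h y)) = (fun y => Im (phi (a + tau *: y)) * Re (phi (a + - (1 - tau) *: y)) -
    Re (phi (a + tau *: y)) * Im (phi (a + - (1 - tau) *: y)))); last first.
    by apply/funext => y; rewrite /h !complexE/= scaleNr; ring.
  apply: (@continuousB R R^o V); apply: (@continuousM R V); 
    first [exact: (comp (fun x => Re (phi x)) _ cr)|exact: (comp (fun x => Im (phi x)) _ ci)].
Qed.

End wigner_neq0.

(** * Tempered distributions on bounded families *)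
Section tempered_distributions.
Variables (R : realType) (n : nat).
Local Notation rc := (real_complex R).
Local Notation Re := complex.Re.
Local Notation Im := complex.Im.
Local Notation V := 'rV[R]_n.
Local Notation e := (basis_vec R).
Implicit Types (f g : V -> R[i]) (x y z w : V) (sigma : functional R n).

Lemma schwartz0 : schwartz (fun _ : V => 0 : R[i]).
Proof.
apply: (@schwartz_boundedP R n unit (fun _ _ => 0) tt).
apply: (@schwartz_bounded_coind R n unit (fun F => F = fun _ _ => 0)) => //.
- move=> F -> i; exists (fun _ _ => 0) => // _ x; exact: is_cderive_cst.
- by move=> F -> N; exists 0 => _ x; rewrite cabs0 mulr0.
Qed.

Lemma tempered0 sigma : tempered sigma -> sigma (fun=> 0) = 0.
Proof.
move=> [sl _]; have := sl 1 _ _ schwartz0 schwartz0.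
under [X in sigma X]funext do rewrite mulr0 addr0.
by rewrite conjc1 mul1r => /eqP; rewrite -subr_eq0 opprD addrA subrr sub0r oppr_eq0 => /eqP.
Qed.

Lemma temperedZ sigma c f : tempered sigma -> schwartz f ->
  sigma (fun x => c * f x) = conjc c * sigma f.
Proof.
move=> st sf; have := st.1 c f _ sf schwartz0.
by under [X in sigma X]funext do rewrite addr0; rewrite tempered0// addr0.
Qed.

Lemma pderivsZ s c f : schwartz f ->
  pderivs s (fun x => c * f x) = (fun x => c * pderivs s f x).
Proof.
move=> [sf _]; elim: s => [//|i s ih]; apply/funext => x.
rewrite [LHS]/(pderiv i (pderivs s (fun x => c * f x)) x) ih.
apply: is_cderive_pderiv; apply: is_cderiveZ; apply: pderivable_is_cderive.
by have [_ _] := sf s; exact.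
Qed.

(** There are finitely many sequences of directions of length at most [N]. *)
Lemma seq_bounded (C : seq 'I_n -> R) N :
  exists B, forall s, (size s <= N)%N -> C s <= B.
Proof.
elim: N C => [|N ih] C.
  by exists (C [::]) => -[|//].
have /choice[B hB] i := ih (fun s => C (i :: s)).
exists (`|C [::]| + \sum_i `|B i|) => -[_|i s /= sN].
  by rewrite ler_wpDr ?sumr_ge0 ?ler_norm.
apply: (le_trans (hB i s sN)); rewrite ler_wpDl// (bigD1 i)//= ler_wpDr ?sumr_ge0//.
exact: ler_norm.
Qed.

Lemma tempered_bounded (T : Type) (F : T -> V -> R[i]) sigma :
  tempered sigma -> schwartz_bounded F -> exists K, forall t, cabs (sigma (F t)) <= K.
Proof.
move=> st bF; have sF t : schwartz (F t) by exact: schwartz_boundedP.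
have [N [dl [dl0 hN]]] := st.2 _ schwartz0 1 ltr01.
have /choice[C hC] s := bF.2 N s.
have [B hB] := seq_bounded C N.
have B1 : 0 < 2 * (`|B| + 1) by rewrite mulr_gt0// ltr_wpDl.
(* scaling by [c] brings every [F t] into the neighbourhood given by continuity *)
pose c := dl / (2 * (`|B| + 1)).
have c0 : 0 < c by rewrite divr_gt0.
exists c^-1 => t; rewrite -[leRHS]mul1r ler_pdivlMr//.
have := hN (fun x => rc c * F t x) (schwartzZ _ (sF t)).
rewrite tempered0// subr0 temperedZ// cabsM conjc_real cabs_real ger0_norm ?(ltW c0)//.
rewrite mulrC => h; apply: ltW; apply: h => a s aN sN.
under [X in schwartz_seminorm _ _ X]funext do rewrite subr0.
apply: (@le_lt_trans _ _ (dl / 2)%:E); last by rewrite lte_fin; lra.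
apply: ge_ereal_sup => _ [x _ <-]; rewrite lee_fin pderivsZ// cabsM cabs_real.
rewrite (ger0_norm (ltW c0)) mulrCA.
have wtN : `|monomial a x| <= poly_weight N x.
  by apply: le_trans (monomial_le_poly_weight a x) _; rewrite /poly_weight ler_weXn2l// lerDl.
have h1 : `|monomial a x| * cabs (pderivs s (F t) x) <= `|B|.
  apply: le_trans (ler_norm _); apply: le_trans (hB s sN); apply: le_trans (hC s t x).
  by rewrite ler_wpM2r ?cabs_ge0.
apply: (le_trans (ler_wpM2l (ltW c0) h1)).
rewrite /c mulrAC ler_pdivrMr// -mulrA ler_wpM2l ?(ltW dl0)//.
by have := normr_ge0 B; lra.
Qed.

Lemma schwartz_pderivC i j g : schwartz g ->
  pderiv i (pderiv j g) = pderiv j (pderiv i g).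
Proof.
move=> sg; apply/funext => x.
have hd k y : is_cderive y (e k) g (pderiv k g y) by exact: schwartz_is_cderive.
have hdd k l y : is_cderive y (e l) (pderiv k g) (pderiv l (pderiv k g) y).
  by apply: schwartz_is_cderive; exact: schwartz_pderiv.
have cont k l : continuous (fun y => Re (pderiv k (pderiv l g) y)) /\
    continuous (fun y => Im (pderiv k (pderiv l g) y)).
  have [sm _] := sg; have [h1 h2 _] := sm [:: k; l]; split; [exact h1|exact h2].
apply: complex_ext.
  apply: (mixed_derivatives (u := fun y => Re (g y)) (a := fun y => Re (pderiv j g y))
    (b := fun y => Re (pderiv i g y)) (v := e j) (w := e i)
    (a' := fun y => Re (pderiv i (pderiv j g) y)) (b' := fun y => Re (pderiv j (pderiv i g) y))).
  - by move=> y; case: (hd j y).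
  - by move=> y; case: (hd i y).
  - by move=> y; case: (hdd j i y).
  - by move=> y; case: (hdd i j y).
  - exact: (cont i j).1.
  - exact: (cont j i).1.
apply: (mixed_derivatives (u := fun y => Im (g y)) (a := fun y => Im (pderiv j g y))
  (b := fun y => Im (pderiv i g y)) (v := e j) (w := e i)
  (a' := fun y => Im (pderiv i (pderiv j g) y)) (b' := fun y => Im (pderiv j (pderiv i g) y))).
- by move=> y; case: (hd j y).
- by move=> y; case: (hd i y).
- by move=> y; case: (hdd j i y).
- by move=> y; case: (hdd i j y).
- exact: (cont i j).2.
- exact: (cont j i).2.
Qed.

Lemma norm_basis_vec_le (i : 'I_n) : `|e i| <= 1.
Proof.
apply: rV_norm_le => // j; rewrite mxE eqxx/=.
by case: (j == i); rewrite ?normr1 ?normr0.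
Qed.

(** The second order Taylor remainder of the translation [g (x - t e_i)],
    divided by [t ^ 2]: its boundedness in the Schwartz topology is what makes
    [t |-> g (x - t e_i)] differentiable when tested against a distribution. *)
Definition translation_remainder (i : 'I_n) g (t : R) x : R[i] :=
  rc (t ^- 2) * (g (x - t *: e i) - g x + rc t * pderiv i g x).

Local Notation T01 := {t : R | `|t| <= 1 /\ t != 0}.

(** The class of these remainders is stable under derivatives, because partial
    derivatives commute; the mean value theorem bounds each of them by a second
    derivative of [g] at a point at distance at most [1]. *)
Lemma translation_remainder_bounded i g : schwartz g ->
  schwartz_bounded (fun t : T01 => translation_remainder i g (projT1 t)).
Proof.
move=> sg.
apply: (@schwartz_bounded_coind R n T01 (fun F => exists2 g, schwartz g &
  F = fun t => translation_remainder i g (projT1 t))); last by exists g.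
- move=> _ [{sg}g sg ->] j.
  exists (fun t => translation_remainder i (pderiv j g) (projT1 t)).
    by exists (pderiv j g) => //; exact: schwartz_pderiv.
  move=> [t tP] x; rewrite /translation_remainder/=; apply: is_cderiveZ.
  rewrite schwartz_pderivC//; apply: is_cderiveD; first apply: is_cderiveD.
  + rewrite -[pderiv j g (_ - _)]mul1r.
    apply: (@is_cderive_line R _ _ g (fun x => x - t *: e i)).
      by move=> s; rewrite mulr1 addrAC.
    exact: schwartz_is_cderive.
  + rewrite -mulN1r (_ : (fun y => - g y) = (fun y => -1 * g y)); last first.
      by apply/funext => y; rewrite mulN1r.
    by apply: is_cderiveZ; exact: schwartz_is_cderive.
  + by apply: is_cderiveZ; apply: schwartz_is_cderive; exact: schwartz_pderiv.
- move=> _ [{sg}g sg ->] N.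
  have sg2 := schwartz_pderiv i (schwartz_pderiv i sg).
  have [C hC] := schwartz_decay N sg2.
  exists (2 * (2 ^+ N * C)) => -[t [t1 t0]] x /=.
  have key (p : R[i] -> R) : (forall c, `|p c| <= cabs c) ->
      (forall y, is_derive y (e i) (fun y => p (g y)) (p (pderiv i g y))) ->
      (forall y, is_derive y (e i) (fun y => p (pderiv i g y)) (p (pderiv i (pderiv i g) y))) ->
      poly_weight N x * `|t ^- 2 * (p (g (x - t *: e i)) - p (g x) + t * p (pderiv i g x))| <= 2 ^+ N * C.
    move=> pc h1 h2.
    have [s st E1] := MVT_line_norm h1 x (- t).
    have [s' ss' E2] := MVT_line_norm h2 x s.
    rewrite normrN in st.
    have -> : p (g (x - t *: e i)) - p (g x) + t * p (pderiv i g x) =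
        - t * (s * p (pderiv i (pderiv i g) (x + s' *: e i))).
      by rewrite -E2 mulrBr -E1 scaleNr; ring.
    rewrite !normrM normrN normfV normrX.
    set D := p _.
    have t20 : 0 < `|t| by rewrite normr_gt0.
    apply: (@le_trans _ _ (poly_weight N x * `|D|)).
      rewrite ler_wpM2l ?poly_weight_ge0//.
      rewrite (_ : _ * (_ * _) = `|t| ^- 2 * (`|t| * `|s|) * `|D|); last by rewrite !mulrA.
      rewrite ler_piMl// ler_pdivrMl ?exprn_gt0// mulr1 expr2.
      by rewrite ler_wpM2l.
    apply: (@le_trans _ _ (poly_weight N (x + s' *: e i) * poly_weight N (- s' *: e i) * `|D|)).
      rewrite ler_wpM2r//; rewrite -{1}(addrK (s' *: e i) x) -scaleNr; exact: poly_weightD.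
    rewrite mulrAC mulrC ler_pM ?mulr_ge0 ?poly_weight_ge0//.
      rewrite /poly_weight lerXn2r ?nnegrE ?addr_ge0//.
      rewrite (_ : 2 = 1 + 1)// lerD2l normrZ normrN mulr_ile1 ?norm_basis_vec_le//.
      exact: le_trans ss' (le_trans st t1).
    apply: le_trans (hC (x + s' *: e i)); rewrite ler_wpM2l ?poly_weight_ge0//; exact: pc.
  rewrite /translation_remainder; set u := g _ - _ + _.
  apply: le_trans (ler_wpM2l (poly_weight_ge0 _ _) (cabs_le _)) _.
  rewrite mulrDr mulr_natl mulr2n lerD//.
    have -> : Re (rc (t ^- 2) * u) =
        t ^- 2 * (Re (g (x - t *: e i)) - Re (g x) + t * Re (pderiv i g x)).
      by rewrite /u !complexE/=; ring.
    apply: key; first exact: Re_le_cabs.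
      by move=> y; case: (schwartz_is_cderive i y sg).
    by move=> y; case: (schwartz_is_cderive i y (schwartz_pderiv i sg)).
  have -> : Im (rc (t ^- 2) * u) =
      t ^- 2 * (Im (g (x - t *: e i)) - Im (g x) + t * Im (pderiv i g x)).
    by rewrite /u !complexE/=; ring.
  apply: key; first exact: Im_le_cabs.
    by move=> y; case: (schwartz_is_cderive i y sg).
  by move=> y; case: (schwartz_is_cderive i y (schwartz_pderiv i sg)).
Qed.

End tempered_distributions.

(** * Regularity of the short-time Fourier transform in the position *)
Section stft_regularity.
Variables (R : realType) (n : nat).
Local Notation rc := (real_complex R).
Local Notation Re := complex.Re.
Local Notation Im := complex.Im.
Local Notation V := 'rV[R]_n.
Local Notation e := (basis_vec R).
Implicit Types (f g : V -> R[i]) (x y z w : V) (sigma : functional R n).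

Lemma is_derive_quadratic (W : normedModType R) (u : W -> R) (x v : W) (l K : R) :
  (forall t : R, `|t| <= 1 -> t != 0 -> `|u (x + t *: v) - u x - t * l| <= K * t ^+ 2) ->
  is_derive x v u l.
Proof.
move=> hu.
have cv : (fun h : R => h^-1 *: ((u \o shift x) (h *: v) - u x)) @ 0^' --> l.
  apply/cvgrPdist_le => eps eps0.
  pose dl := Num.min 1 (eps / (`|K| + 1)).
  have dl0 : 0 < dl by rewrite lt_min ltr01 divr_gt0// ltr_wpDl.
  rewrite /dnbhs/= /within/=; apply/nbhs_ballP; exists dl => //= t.
  rewrite -ball_normE/= sub0r normrN lt_min => /andP[/ltW t1 tK] t0.
  have tn : 0 < `|t| by rewrite normr_gt0.
  rewrite distrC /shift/= (addrC _ x) -[_ *: _]/(_ * _).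
  have -> : t^-1 * (u (x + t *: v) - u x) - l = t^-1 * (u (x + t *: v) - u x - t * l).
    by rewrite !mulrBr mulKf.
  rewrite normrM normfV ler_pdivrMl//; apply: (le_trans (hu t t1 t0)).
  rewrite -real_normK ?num_real// expr2 mulrCA ler_wpM2l//.
  move: tK; rewrite ltr_pdivlMr ?ltr_wpDl// => /ltW; apply: le_trans.
  by rewrite mulrC ler_wpM2l// ler_wpDr// ler_norm.
split; first by apply/cvg_ex; exists l.
exact/cvg_lim.
Qed.

Lemma schwartz_bounded_tf_shift (T : Type) (F : T -> V -> R[i]) (z : T -> V) (K : R) w :
  schwartz_bounded F -> (forall t, `|z t| <= K) ->
  schwartz_bounded (fun t => tf_shift (z t) w (F t)).
Proof.
move=> bF zK; apply: schwartz_spanP.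
apply: (@span_modulation R n T w (fun t x => F t (x - z t))).
by apply: (span_translation zK); exact: span_base.
Qed.

(** The error in the first order expansion at [z] is [t ^ 2] times the value of
    [sigma] on a bounded family. *)
Lemma stft_is_cderive sigma i g z w : tempered sigma -> schwartz g ->
  is_cderive z (e i) (fun z => stft g sigma z w) (- stft (pderiv i g) sigma z w).
Proof.
move=> st sg.
have bS := schwartz_bounded_tf_shift w (z := fun=> z) (translation_remainder_bounded i sg)
  (fun=> lexx `|z|).
have [K hK] := tempered_bounded st bS.
have E t : t != 0 -> `|t| <= 1 ->
    stft g sigma (z + t *: e i) w - stft g sigma z w + rc t * stft (pderiv i g) sigma z w =
    rc (t ^+ 2) * sigma (tf_shift z w (translation_remainder i g t)).
  have rcN : rc (- t) = - rc t by exact: rmorphN.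
  move=> t0 t1; have sg' := schwartz_pderiv i sg.
  have sr : schwartz (tf_shift z w (translation_remainder i g t)).
    exact: (schwartz_boundedP (exist _ t (conj t1 t0)) bS).
  have -> : stft g sigma (z + t *: e i) w = sigma (fun x => rc (t ^+ 2) *
      tf_shift z w (translation_remainder i g t) x +
      (rc (- t) * tf_shift z w (pderiv i g) x + tf_shift z w g x)).
    congr sigma; apply/funext => x; rewrite /tf_shift /translation_remainder opprD addrA.
    have -> : rc (t ^- 2) = (rc (t ^+ 2))^-1 by rewrite fmorphV.
    have t2 : rc (t ^+ 2) != 0 by rewrite fmorph_eq0 expf_neq0.
    rewrite rcN; move: (expi _) (g _) (g _) (pderiv _ _ _) (rc (t ^+ 2)) t2 (rc t).
    by move=> a b c d0 q q0 s; field.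
  rewrite st.1//; last by apply: schwartzD; [apply: schwartzZ|]; exact: schwartz_tf_shift.
  rewrite st.1//; try exact: schwartz_tf_shift.
  by rewrite !conjc_real rcN /stft; ring.
have bound (p : R[i] -> R) : (forall c, `|p c| <= cabs c) ->
    (forall a b c (s : R), p (a - b + rc s * c) = p a - p b + s * p c) ->
    forall t : R, `|t| <= 1 -> t != 0 ->
    `|p (stft g sigma (z + t *: e i) w) - p (stft g sigma z w) -
      t * - p (stft (pderiv i g) sigma z w)| <= K * t ^+ 2.
  move=> pc pl t t1 t0; rewrite mulrN opprK -pl E//.
  apply: le_trans (pc _) _; rewrite cabsM cabs_real ger0_norm ?sqr_ge0// mulrC.
  by rewrite ler_wpM2r ?sqr_ge0//; exact: (hK (exist _ t (conj t1 t0))).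
split; rewrite complexN/=.
  apply: (is_derive_quadratic (K := K)); apply: bound; first exact: Re_le_cabs.
  by move=> a b c s; rewrite !complexE/=; ring.
apply: (is_derive_quadratic (K := K)); apply: bound; first exact: Im_le_cabs.
by move=> a b c s; rewrite !complexE/=; ring.
Qed.

Lemma stft_continuous sigma g w : tempered sigma -> schwartz g ->
  continuous (fun z => Re (stft g sigma z w)) /\
  continuous (fun z => Im (stft g sigma z w)).
Proof.
move=> st sg.
have bd (z : V) : exists C, forall i y, `|y - z| <= 1 -> cabs (- stft (pderiv i g) sigma y w) <= C.
  have /choice[C hC] i : exists C, forall y, `|y - z| <= 1 -> cabs (- stft (pderiv i g) sigma y w) <= C.
    have zy (t : {y : V | `|y - z| <= 1}) : `|projT1 t| <= `|z| + 1.
      case: t => y yz /=; rewrite -(subrK z y) addrC.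
      by rewrite (le_trans (ler_normD _ _))// lerD.
    have [C hC] := tempered_bounded st (schwartz_bounded_tf_shift w
      (schwartz_bounded_cst {y : V | `|y - z| <= 1} (schwartz_pderiv i sg)) zy).
    by exists C => y yz; rewrite cabsN; exact: (hC (exist _ y yz)).
  exists (\sum_i `|C i|) => i y yz; apply: (le_trans (hC i y yz)).
  by rewrite (bigD1 i)//= ler_wpDr ?sumr_ge0// ler_norm.
split=> z; have [C hC] := bd z.
  apply: (bounded_partials_continuous (D := fun i z => Re (- stft (pderiv i g) sigma z w))
    (C := C)) => i y.
    by have [] := stft_is_cderive i y w st sg.
  by move=> yz; apply: le_trans (Re_le_cabs _) (hC i y yz).
apply: (bounded_partials_continuous (D := fun i z => Im (- stft (pderiv i g) sigma z w))
  (C := C)) => i y.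
  by have [] := stft_is_cderive i y w st sg.
by move=> yz; apply: le_trans (Im_le_cabs _) (hC i y yz).
Qed.

End stft_regularity.

(** * A pointwise bound by integrals of derivatives over a cube *)
Section sobolev.
Variable R : realType.
Local Notation mu := (@lebesgue_measure R).
Local Notation leb := (lebesgue_rV R).

Lemma is_derive_continuous (a a' : R -> R) :
  (forall t : R, is_derive t 1 a (a' t)) -> continuous a.
Proof.
move=> ha t; apply: differentiable_continuous; apply/derivable1_diffP.
by case: (ha t).
Qed.

Lemma increment_le_integral (a a' : R -> R) (dl t : R) :
  (forall t : R, is_derive t 1 a (a' t)) -> continuous a' -> 0 <= t <= dl ->
  (`|a 0|%:E <= `|a t|%:E + \int[mu]_(s in `[0%R, dl]) `|a' s|%:E)%E.
Proof.
move=> ha ca' /andP[]; rewrite le_eqVlt => /predU1P[<-|t0] tdl.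
  by apply: leeDl; apply: integral_ge0 => s _; rewrite lee_fin.
have ma' (D : set R) : measurable D -> measurable_fun D (fun s => (a' s)%:E).
  by move=> mD; apply/measurable_EFinP; apply: measurable_funTS; exact: continuous_measurable_fun.
have ftc : (\int[mu]_(s in `[0%R, t]) (a' s)%:E = (a t)%:E - (a 0)%:E)%E.
  apply: (continuous_FTC2 t0).
  - exact: continuous_subspaceT.
  - split.
    + by move=> s _; case: (ha s).
    + by apply: cvg_at_right_filter; exact: (is_derive_continuous ha).
    + by apply: cvg_at_left_filter; exact: (is_derive_continuous ha).
  - by move=> s _; rewrite derive1E; case: (ha s).
apply: (@le_trans _ _ (`|a t|%:E + \int[mu]_(s in `[0%R, t]) `|a' s|%:E)%E); last first.
  apply: leeD2l; apply: ge0_subset_integral => //.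
  - apply/measurable_EFinP; apply: measurable_funTS; apply: measurableT_comp => //.
    exact: continuous_measurable_fun.
  - by apply: subset_itvl; rewrite bnd_simp.
have : (`|\int[mu]_(s in `[0%R, t]) (a' s)%:E| <= \int[mu]_(s in `[0%R, t]) `|a' s|%:E)%E.
  by apply: le_abse_integral => //; exact: ma'.
rewrite ftc -EFinB /= => h.
apply: (@le_trans _ _ (`|a t|%:E + `|a t - a 0|%:E)%E); last exact: leeD2l.
rewrite -EFinD lee_fin -{1}[a 0](subKr (a t)).
exact: ler_normB.
Qed.

Local Notation ind dl := (\1_(`[0%R, dl]%classic : set R) : R -> R).

Lemma integral_indic_weight (u : R -> R) (dl : R) :
  (\int[mu]_(s in `[0%R, dl]) `|u s|%:E = \int[mu]_s (`|u s| * ind dl s)%:E)%E.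
Proof.
rewrite integral_mkcond; apply: eq_integral => s _.
rewrite patchE indicE; case: ifPn => _; by rewrite ?mulr1 ?mulr0.
Qed.

Lemma point_le_integral (a a' : R -> R) (dl : R) : 0 < dl ->
  (forall t : R, is_derive t 1 a (a' t)) -> continuous a' ->
  ((dl * `|a 0|)%:E <= \int[mu]_s (`|a s| * ind dl s)%:E
     + dl%:E * \int[mu]_s (`|a' s| * ind dl s)%:E)%E.
Proof.
move=> dl0 ha ca'; rewrite -!integral_indic_weight.
set B := (\int[mu]_(s in _) `|a' s|%:E)%E.
have mD : measurable (`[0%R, dl]%classic : set (measurableTypeR R)) by exact: measurable_itv.
have lD : mu `[0%R, dl]%classic = dl%:E.
  by rewrite lebesgue_measure_itv/= lte_fin dl0 -EFinD subr0.
have cstI (r : \bar R) : (\int[mu]_(s in `[0%R, dl]) r = r * dl%:E)%E.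
  by rewrite -lD -integral_cst.
have ma (u : R -> R) : continuous u -> measurable_fun (`[0%R, dl]%classic : set (measurableTypeR R)) (fun s => `|u s|%:E).
  move=> cu; apply/measurable_EFinP; apply: measurable_funTS.
  by apply: measurableT_comp => //; exact: continuous_measurable_fun.
have B0 : (0 <= B)%E by apply: integral_ge0 => s _; rewrite lee_fin.
have [Boo|/negPf Bfin] := eqVneq B +oo%E.
  have I0 : (0 <= \int[mu]_(s in `[0%R, dl]) `|a s|%:E)%E.
    by apply: integral_ge0 => s _; rewrite lee_fin.
  rewrite Boo gt0_muley ?lte_fin// addey ?leey// -ltNye.
  exact: lt_le_trans I0.
have fB : B \is a fin_num by rewrite ge0_fin_numE// ltey Bfin.
apply: (@le_trans _ _ (\int[mu]_(s in `[0%R, dl]) (`|a s|%:E + B))%E).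
  have -> : (dl * `|a 0|)%:E = (\int[mu]_(s in `[0%R, dl]) `|a 0|%:E)%E.
    by rewrite cstI EFinM muleC.
  apply: ge0_le_integral => //.
  - by apply: emeasurable_funD; [apply: ma; exact: is_derive_continuous ha|exact: measurable_cst].
  - move=> s /=; rewrite in_itv/= => s01.
    exact: (increment_le_integral ha ca').
rewrite ge0_integralD//; last by apply: ma; exact: is_derive_continuous ha.
by rewrite cstI muleC.
Qed.

Definition box (dl : R) n (x : 'rV[R]_n) : R := \prod_(i < n) ind dl (x ord0 i).

Lemma box_ge0 dl n (x : 'rV[R]_n) : 0 <= box dl x.
Proof. by apply: prodr_ge0 => i _; rewrite indicE. Qed.

Lemma measurable_box dl n : measurable_fun setT (@box dl n).
Proof.
apply: measurable_prod => i _.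
have mi : measurable_fun setT (ind dl) by apply: measurable_indic; exact: measurable_itv.
exact: (measurableT_comp mi (measurable_rV_coord i)).
Qed.

Lemma box_cons dl n t (y : 'rV[R]_n) : box dl (rV_cons (t, y)) = ind dl t * box dl y.
Proof.
rewrite /box big_ord_recl !mxE unlift_none; congr (_ * _).
by apply: eq_bigr => i _; rewrite !mxE liftK.
Qed.

Lemma rV_cons_line0 n (t s : R) (y : 'rV[R]_n) :
  rV_cons (t + s, y) = rV_cons (t, y) + s *: basis_vec R ord0.
Proof.
apply/rowP => i; rewrite !mxE eqxx/=; case: unliftP => [j ->|->] /=.
  by rewrite mulr0 addr0.
by rewrite mulr1.
Qed.

Lemma rV_cons_line n (t s : R) (y : 'rV[R]_n) (j : 'I_n) :
  rV_cons (t, y + s *: basis_vec R j) = rV_cons (t, y) + s *: basis_vec R (lift ord0 j).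
Proof.
apply/rowP => i; rewrite !mxE eqxx/=; case: unliftP => [k ->|->] /=.
  by rewrite !mxE eqxx/= (inj_eq lift_inj).
by rewrite mulr0 addr0.
Qed.

(** The functions [F s] are, up to sign, the iterated partial derivatives of
    [F [::]]; the sign is the one of the derivatives of short-time Fourier
    transforms. *)
Definition derivative_family n (F : seq 'I_n -> 'rV[R]_n -> R) : Prop :=
  (forall s, measurable_fun setT (F s)) /\
  (forall s i x, is_derive x (basis_vec R i) (F s) (- F (i :: s) x)).

(** In one variable [|a 0|] is at most the mean of [|a|] over an interval plus the
    integral of [|a'|]; this is applied to the first coordinate, with the others
    fixed, and the induction hypothesis to the others.  The constant depends on
    [dl] and the bounds [K] of the integrals only, which is what allows uniformity
    over a set of functions [F]. *)
Lemma sobolev_point_bound n (dl : R) (K : seq 'I_n -> R) : 0 < dl ->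
  exists C, forall F, derivative_family F ->
   (forall s, (\int[leb n]_x (`|F s x| * box dl x)%:E <= (K s)%:E)%E) ->
   `|F [::] 0| <= C.
Proof.
move=> dl0; elim: n K => [|n ih] K.
  exists (K [::]) => F [mF _] /(_ [::]).
  rewrite ge0_integral_rV0; last by move=> x; rewrite lee_fin mulr_ge0// box_ge0.
  by rewrite /box big_ord0 mulr1 lee_fin.
pose ls (s : seq 'I_n) := map (lift ord0) s : seq 'I_n.+1.
have [C hC] := ih (fun s => dl^-1 * (K (ls s) + dl * K (ord0 :: ls s))).
exists C => F [mF dF] hK.
pose G s y := F (ls s) (rV_cons (0, y)).
have -> : F [::] 0 = G [::] 0.
  rewrite /G; congr F; apply/rowP => i; rewrite !mxE.
  by case: unliftP => [j _|_]; rewrite ?mxE.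
apply: hC.
  split=> [s|s i x].
    apply: (measurableT_comp (mF (ls s))).
    apply: (measurableT_comp (@measurable_rV_cons R n)).
    exact: measurable_fun_pair.
  apply: line_is_derive; rewrite /G.
  under eq_fun do rewrite rV_cons_line.
  exact: is_derive_line0 (dF _ _ _).
move=> s.
pose A s' y := (\int[mu]_t (`|F s' (rV_cons (t, y))| * box dl (rV_cons (t, y)))%:E)%E.
have A0 s' y : (0 <= A s' y)%E.
  by apply: integral_ge0 => t _; rewrite lee_fin mulr_ge0// box_ge0.
have mFb s' : measurable_fun setT (fun x => (`|F s' x| * box dl x)%:E).
  apply/measurable_EFinP; apply: measurable_funM; last exact: measurable_box.
  exact: measurableT_comp.
have mA s' : measurable_fun setT (A s').
  apply: (@measurable_fun_fubini_tonelli_G _ _ _ _ _ mu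
    ((fun x => (`|F s' x| * box dl x)%:E) \o @rV_cons R n)) => [|x].
    by apply: measurableT_comp => //; exact: measurable_rV_cons.
  by rewrite lee_fin mulr_ge0// box_ge0.
have IA s' : (\int[leb n]_y A s' y <= (K s')%:E)%E.
  have := hK s'; rewrite ge0_integral_rVS//.
  by move=> x; rewrite lee_fin mulr_ge0// box_ge0.
have ptw y : ((`|G s y| * box dl y)%:E <=
    (dl^-1)%:E * (A (ls s) y + dl%:E * A (ord0 :: ls s) y))%E.
  have AE s' : A s' y = ((box dl y)%:E *
      \int[mu]_t (`|F s' (rV_cons (t, y))| * ind dl t)%:E)%E.
    rewrite -ge0_integralZl_EFin; last 4 first.
    - exact: measurableT.
    - by move=> t _; rewrite lee_fin mulr_ge0// indicE.
    - apply/measurable_EFinP; apply: measurable_funM.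
        apply: measurableT_comp => //; apply: (measurableT_comp (mF s')).
        apply: (measurableT_comp (@measurable_rV_cons R n)).
        exact: measurable_fun_pair.
      by apply: measurable_indic; exact: measurable_itv.
    - exact: box_ge0.
    by apply: eq_integral => t _; rewrite box_cons -EFinM; congr EFin; ring.
  rewrite !AE muleCA -ge0_muleDr; last 2 first.
  - by apply: integral_ge0 => t _; rewrite lee_fin mulr_ge0// indicE.
  - apply: mule_ge0; first by rewrite lee_fin ltW.
    by apply: integral_ge0 => t _; rewrite lee_fin mulr_ge0// indicE.
  rewrite muleCA mulrC EFinM lee_wpmul2l ?lee_fin ?box_ge0//.
  rewrite lee_pdivlMl// -EFinM.
  have dline (s' : seq 'I_n.+1) (t : R) : is_derive t 1 (fun t => F s' (rV_cons (t, y)))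
      (- F (ord0 :: s') (rV_cons (t, y))).
    apply: line_is_derive.
    under eq_fun do rewrite -[_ *: _]/(_ * _) mulr1 rV_cons_line0.
    exact: is_derive_line0 (dF _ _ _).
  have cF : continuous (fun t => - F (ord0 :: ls s) (rV_cons (t, y))).
    by move=> t; apply: continuousN; exact: (is_derive_continuous (dline (ord0 :: ls s))).
  have := point_le_integral dl0 (dline (ls s)) cF.
  have -> : (\int[mu]_t (`|- F (ord0 :: ls s) (rV_cons (t, y))| * ind dl t)%:E =
      \int[mu]_t (`|F (ord0 :: ls s) (rV_cons (t, y))| * ind dl t)%:E)%E.
    by apply: eq_integral => t _; rewrite normrN.
  by [].
apply: (@le_trans _ _ (\int[leb n]_y ((dl^-1)%:E * (A (ls s) y + dl%:E * A (ord0 :: ls s) y)))%E).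
  apply: le_nnintegral => // y.
  by rewrite lee_fin mulr_ge0// box_ge0.
have dA0 y : (0 <= dl%:E * A (ord0 :: ls s) y)%E by rewrite mule_ge0// lee_fin ltW.
have mdA : measurable_fun setT (fun y => dl%:E * A (ord0 :: ls s) y)%E by exact: measurable_funeM.
rewrite ge0_integralZl_EFin//; last 3 first.
- by move=> y _; exact: adde_ge0.
- exact: emeasurable_funD.
- by rewrite invr_ge0 ltW.
rewrite EFinM lee_wpmul2l ?lee_fin ?invr_ge0 ?(ltW dl0)//.
rewrite ge0_integralD//= EFinD; apply: leeD; first exact: IA.
rewrite ge0_integralZl_EFin//; last exact: ltW.
by rewrite EFinM lee_wpmul2l ?lee_fin ?(ltW dl0).
Qed.

End sobolev.

(** * The supremum of the transform over the modulations *)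
Section stft_sup.
Variables (R : realType) (n : nat) (sigma : functional R n).
Hypothesis st : tempered sigma.
Local Notation rc := (real_complex R).
Local Notation Re := complex.Re.
Local Notation Im := complex.Im.
Local Notation V := 'rV[R]_n.
Local Notation leb := (lebesgue_rV R n).
Local Notation e := (basis_vec R).
Implicit Types (g : V -> R[i]) (x y z w : V).

Definition stft_sup g z : \bar R :=
  ereal_sup (range (fun w => (cabs (stft g sigma z w))%:E)).

Lemma stft_le_sup g z w : ((cabs (stft g sigma z w))%:E <= stft_sup g z)%E.
Proof. by apply: ereal_sup_ubound; exists w. Qed.

Lemma stft_sup_ge0 g z : (0 <= stft_sup g z)%E.
Proof. by apply: le_trans (stft_le_sup g z 0); rewrite lee_fin cabs_ge0. Qed.

Lemma cabs_sqrt (c : R[i]) : cabs c = Num.sqrt (Re c ^+ 2 + Im c ^+ 2).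
Proof. by case: c. Qed.

Lemma cabs_stft_continuous g w : schwartz g -> continuous (fun z => cabs (stft g sigma z w)).
Proof.
move=> sg; have [cr ci] := stft_continuous w st sg => z.
rewrite (_ : (fun z => _) = (fun z => Num.sqrt (Re (stft g sigma z w) ^+ 2 +
  Im (stft g sigma z w) ^+ 2))); last by apply/funext => y; rewrite cabs_sqrt.
apply: (@continuous_comp _ _ _ (fun z => Re (stft g sigma z w) ^+ 2 +
  Im (stft g sigma z w) ^+ 2) Num.sqrt); last exact: sqrt_continuous.
rewrite (_ : (fun z => _) = (fun z => Re (stft g sigma z w) * Re (stft g sigma z w) +
  Im (stft g sigma z w) * Im (stft g sigma z w)))//.
by apply: (@continuousD R R^o V); apply: (@continuousM R V);
  first [exact: cr|exact: ci].
Qed.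

Lemma measurable_stft_sup g : schwartz g -> measurable_fun setT (stft_sup g).
Proof.
move=> sg; apply: lsc_measurable_rV => a.
rewrite (_ : [set x | _] = \bigcup_w [set z | a < cabs (stft g sigma z w)]); last first.
  apply/seteqP; split => [z /= /ereal_sup_gt[_ [w _ <-]]|z [w _ /=] aw].
    by rewrite lte_fin => aw; exists w.
  by apply: lt_le_trans (stft_le_sup g z w); rewrite lte_fin.
apply: bigcup_open => w _.
rewrite (_ : [set z | _] = (fun z => cabs (stft g sigma z w)) @^-1` [set y | a < y])//.
by apply: open_comp; [move=> z _; exact: cabs_stft_continuous|exact: open_gt].
Qed.

Variable u : V -> R.
Hypotheses (cu : continuous u) (u0 : forall z, 0 < u z).

Lemma stft_window0 z w : stft (fun=> 0) sigma z w = 0.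
Proof.
rewrite /stft (_ : tf_shift _ _ _ = (fun=> 0)) ?tempered0//.
by apply/funext => t; rewrite /tf_shift mulr0.
Qed.

(** The integrals attached to the derivatives of the window control a Sobolev
    norm of [z |-> stft g sigma z w] near [z0], uniformly in [w]. *)
Lemma stft_sup_finite g z0 :
  (forall g, schwartz g -> g <> (fun=> 0) -> amalgam g u sigma) ->
  schwartz g -> exists C, forall w, cabs (stft g sigma z0 w) <= C.
Proof.
move=> amal sg.
have sgs s : schwartz (pderivs s g).
  by elim: s => [//|i s ih]; exact: (schwartz_pderiv i ih).
pose M s := (\int[leb]_z (stft_sup (pderivs s g) z * (u z)%:E))%E.
have M0 s : (0 <= M s)%E.
  by apply: integral_ge0 => z _; rewrite mule_ge0 ?stft_sup_ge0// lee_fin ltW.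
have Moo s : (M s < +oo)%E.
  have [g0|g0] := pselect (pderivs s g = (fun=> 0)); last by have [] := amal _ (sgs s) g0.
  rewrite /M integral0_eq ?ltry// => z _.
  rewrite (_ : stft_sup _ _ = 0%E) ?mul0e//; apply/eqP.
  rewrite eq_le stft_sup_ge0 andbT; apply: ge_ereal_sup => _ [w _ <-].
  by rewrite g0 stft_window0 cabs0.
have u20 : 0 < u z0 / 2 by rewrite divr_gt0.
have cuz : {for z0, continuous u} by exact: cu.
have /(@cvgrPdist_lt R R^o _ (nbhs z0) (nbhs_filter _))/(_ _ u20)/nbhs_ballP[dl0 /= dl00 hdl] := cuz.
pose dl := dl0 / 2; have dl_gt0 : 0 < dl by rewrite divr_gt0.
(* [u >= u z0 / 2] on the cube, hence its indicator is at most [2 u / u z0] *)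
have ubox x : box dl x <= (2 / u z0) * u (x + z0).
  have [x1|[i xi]] : (forall i, 0 <= x ord0 i <= dl) \/ exists i, ~~ (0 <= x ord0 i <= dl).
    by have [?|/existsNP[i /negP]] := pselect (forall i, 0 <= x ord0 i <= dl);
      [left|right; exists i].
    have xdl : `|x| <= dl.
      by apply: rV_norm_le => [|i]; [exact: ltW|have /andP[xi0 xi1] := x1 i; rewrite ger0_norm].
    apply: (@le_trans _ _ 1).
      by apply: prodr_ile1 => i _; rewrite indicE; case: (_ \in _); rewrite ler01 lexx.
    have : ball z0 dl0 (x + z0).
      rewrite -ball_normE/= opprD addrCA subrr addr0 normrN.
      by apply: le_lt_trans xdl _; rewrite /dl; lra.
    move=> /hdl/=; rewrite ltr_distl => /andP[_ h].
    rewrite mulrAC ler_pdivlMr// mul1r.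
    by move: h; rewrite -ltrBlDr; lra.
  rewrite /box (bigD1 i)//= indicE memNset ?mul0r.
    by rewrite mulr_ge0 ?divr_ge0// ltW.
  by rewrite /= in_itv/=; exact/negP.
pose K s := 2 / u z0 * fine (M s).
have bound (p : R[i] -> R) : (forall c, `|p c| <= cabs c) ->
    (forall g w, schwartz g -> continuous (fun z => p (stft g sigma z w))) ->
    (forall g i z w, schwartz g -> is_derive z (e i) (fun z => p (stft g sigma z w))
       (- p (stft (pderiv i g) sigma z w))) ->
    exists C, forall w, `|p (stft g sigma z0 w)| <= C.
  move=> pc pcont pder; have [C hC] := sobolev_point_bound K dl_gt0.
  exists C => w; pose F s x := p (stft (pderivs s g) sigma (x + z0) w).
  have -> : p (stft g sigma z0 w) = F [::] 0 by rewrite /F add0r.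
  apply: (hC F).
    split=> [s|s i x].
      rewrite (_ : F s = (fun z => p (stft (pderivs s g) sigma z w)) \o
        (rV_aff (fun=> 1) (fun i => z0 ord0 i))); last first.
        apply/funext => x; rewrite /F/=; congr (p (stft _ _ _ _)).
        by apply/rowP => i; rewrite !mxE mul1r.
      apply: (measurableT_comp (continuous_measurable_rV (pcont _ w (sgs s)))).
      exact: measurable_rV_aff.
    apply: line_is_derive; rewrite /F; under eq_fun do rewrite addrAC.
    exact: (is_derive_line0 (pder _ i (x + z0) w (sgs s))).
  move=> s; rewrite /K EFinM fineK; last by rewrite ge0_fin_numE.
  have mM : measurable_fun setT (fun z => stft_sup (pderivs s g) z * (u z)%:E)%E.
    apply: emeasurable_funM; first exact: measurable_stft_sup.
    by apply/measurable_EFinP; exact: continuous_measurable_rV.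
  rewrite -ge0_integralZl_EFin//; last 2 first.
  - by move=> z _; rewrite mule_ge0 ?stft_sup_ge0// lee_fin ltW.
  - by rewrite divr_ge0// ltW.
  rewrite -(integral_translation z0
    (f := fun z => (2 / u z0)%:E * (stft_sup (pderivs s g) z * (u z)%:E))%E); last first.
    exact: measurable_funeM.
  apply: le_nnintegral => x; first by rewrite lee_fin mulr_ge0// box_ge0.
  rewrite muleCA -EFinM [X in (X <= _)%E]EFinM; apply: lee_pmul; rewrite ?lee_fin ?box_ge0//.
  by apply: le_trans (stft_le_sup _ _ w); rewrite lee_fin; exact: pc.
have [A hA] : exists C, forall w, `|Re (stft g sigma z0 w)| <= C.
  apply: (bound (fun c => Re c)) => [c|h w sh|h i z w sh].
  - exact: Re_le_cabs.
  - exact: (stft_continuous w st sh).1.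
  - by have [+ _] := stft_is_cderive i z w st sh; rewrite complexN.
have [B hB] : exists C, forall w, `|Im (stft g sigma z0 w)| <= C.
  apply: (bound (fun c => Im c)) => [c|h w sh|h i z w sh].
  - exact: Im_le_cabs.
  - exact: (stft_continuous w st sh).2.
  - by have [_ +] := stft_is_cderive i z w st sh; rewrite complexN.
by exists (A + B) => w; apply: le_trans (cabs_le _) _; exact: lerD.
Qed.

End stft_sup.

(** * Covariance of the [tau]-Wigner distribution *)
Section covariance.
Variables (R : realType) (d : nat) (tau : R).
Local Notation rc := (real_complex R).
Local Notation V := 'rV[R]_d.
Implicit Types (f g : V -> R[i]) (z w : 'rV[R]_(d + d)).

Lemma dotpDl n (x y w : 'rV[R]_n) : dotp (x + y) w = dotp x w + dotp y w.
Proof. by rewrite /dotp -big_split/=; apply: eq_bigr => i _; rewrite mxE mulrDl. Qed.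

Lemma dotpZl n (c : R) (x w : 'rV[R]_n) : dotp (c *: x) w = c * dotp x w.
Proof. by rewrite /dotp mulr_sumr; apply: eq_bigr => i _; rewrite mxE mulrA. Qed.

Lemma dotpNl n (x w : 'rV[R]_n) : dotp (- x) w = - dotp x w.
Proof. by rewrite -scaleN1r dotpZl mulN1r. Qed.

Lemma dotpDr n (x y w : 'rV[R]_n) : dotp w (x + y) = dotp w x + dotp w y.
Proof. by rewrite !(dotpC w) dotpDl. Qed.

Lemma dotpZr n (c : R) (x w : 'rV[R]_n) : dotp w (c *: x) = c * dotp w x.
Proof. by rewrite !(dotpC w) dotpZl. Qed.

Lemma dotpNr n (x w : 'rV[R]_n) : dotp w (- x) = - dotp w x.
Proof. by rewrite !(dotpC w) dotpNl. Qed.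

Lemma dotp_row_mx (x w : V) z :
  dotp (row_mx x w) z = dotp x (lsubmx z) + dotp w (rsubmx z).
Proof.
rewrite /dotp big_split_ord/=; congr (_ + _); apply: eq_bigr => i _.
  by rewrite row_mxEl mxE.
by rewrite row_mxEr mxE.
Qed.

Definition wigner_center w z : 'rV[R]_(d + d) :=
  row_mx ((1 - tau) *: lsubmx w + tau *: lsubmx z) (tau *: rsubmx w + (1 - tau) *: rsubmx z).

Definition wigner_modulation w z : 'rV[R]_(d + d) :=
  row_mx (rsubmx w - rsubmx z) (lsubmx z - lsubmx w).

(** The substitution [y |-> y + b], with [b] the difference of the positions of
    [w] and [z], moves both shifts of the arguments into the one centre
    [wigner_center w z]. *)
Lemma wigner_covariance f g w z : schwartz f -> schwartz g ->
  tau_wigner tau (phase_shift w f) (phase_shift z g) =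
  (fun p => expi (2 * pi * dotp (lsubmx w - lsubmx z) (rsubmx (wigner_center w z))) *
     tf_shift (wigner_center w z) (wigner_modulation w z) (tau_wigner tau f g) p).
Proof.
move=> sf sg; apply/funext => p; rewrite /tf_shift !wignerE.
set T := wigner_center w z; set J := wigner_modulation w z.
set b := lsubmx w - lsubmx z.
have [C [C0 hC]] := wigner_integrand_dominated tau sf sg.
have dK := hC (lsubmx (p - T)) (rsubmx (p - T)).
rewrite mulrA -expiD.
set th := 2 * pi * _ + _.
rewrite -(cintegralZ _ dK) -(cintegral_translation (- b) (dominatedZ (expi th) dK).1).
congr cintegral; apply/funext => y.
rewrite /wigner_integrand /phase_shift /tf_shift conjcM conjc_expi.
have E1 : lsubmx (p - T) + tau *: (y - b) = lsubmx p + tau *: y - lsubmx w.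
  by rewrite linearB /= row_mxKl; apply/rowP => i; rewrite !mxE; ring.
have E2 : lsubmx (p - T) - (1 - tau) *: (y - b) = lsubmx p - (1 - tau) *: y - lsubmx z.
  by rewrite linearB /= row_mxKl; apply/rowP => i; rewrite !mxE; ring.
rewrite E1 E2.
set A := f _; set B := conjc (g _).
have -> : expi th * (expi (- (2 * pi * dotp (y - b) (rsubmx (p - T)))) * A * B) =
    expi (th - 2 * pi * dotp (y - b) (rsubmx (p - T))) * A * B.
  by rewrite (expiD th) !mulrA.
have -> : expi (- (2 * pi * dotp y (rsubmx p))) *
    (expi (2 * pi * dotp (rsubmx w) (lsubmx p + tau *: y)) * A) *
    (expi (- (2 * pi * dotp (rsubmx z) (lsubmx p - (1 - tau) *: y))) * B) =
   expi (- (2 * pi * dotp y (rsubmx p)) + 2 * pi * dotp (rsubmx w) (lsubmx p + tau *: y) -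
     2 * pi * dotp (rsubmx z) (lsubmx p - (1 - tau) *: y)) * A * B.
  by rewrite !expiD; ring.
congr (expi _ * _ * _).
have E3 : rsubmx (p - T) = rsubmx p - rsubmx T by rewrite linearB.
rewrite /th /b /J dotp_row_mx E3 /T /wigner_center row_mxKr.
move: (lsubmx w) (rsubmx w) (lsubmx z) (rsubmx z) (lsubmx p) (rsubmx p) => w1 w2 z1 z2 x om.
rewrite !(dotpDl, dotpNl, dotpZl, dotpDr, dotpNr, dotpZr).
rewrite (dotpC w2 y) (dotpC z2 y); ring.
Qed.

End covariance.

(** * The two conditions in terms of the window [Phi] *)
Section main.
Variables (R : realType) (d : nat) (tau : R).
Hypothesis tau01 : 0 < tau < 1.
Local Notation rc := (real_complex R).
Local Notation P := 'rV[R]_(d + d).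
Local Notation leb := (lebesgue_rV R (d + d)).
Implicit Types (z w : P).

Let tau0 : 0 < tau. Proof. by have /andP[] := tau01. Qed.
Let tau1 : 0 < 1 - tau. Proof. by have /andP[_ ?] := tau01; rewrite subr_gt0. Qed.

Definition block_scale (a b : R) z : P := row_mx (a *: lsubmx z) (b *: rsubmx z).

Lemma mxapp_block (a b : R) z :
  mxapp (block_mx a%:M 0 0 b%:M) z = block_scale a b z.
Proof.
rewrite /mxapp trmx_mul trmxK tr_block_mx !tr_scalar_mx !trmx0.
rewrite -{1}(hsubmxK z) mul_row_block !mulmx0 addr0 add0r.
by rewrite !mul_mx_scalar.
Qed.

Lemma block_scaleE (a b : R) : block_scale a b =
  rV_aff (fun i : 'I_(d + d) => if fintype.split i is inl _ then a else b) (fun=> 0).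
Proof.
apply/funext => z; apply/rowP => i; rewrite !mxE addr0.
by case: splitP => j ij; rewrite !mxE; congr (_ * z _ _); exact: val_inj.
Qed.

Lemma block_scaleK (a b : R) : a != 0 -> b != 0 ->
  cancel (block_scale a b) (block_scale a^-1 b^-1).
Proof.
move=> a0 b0 z; rewrite /block_scale row_mxKl row_mxKr !scalerA !mulVf// !scale1r.
exact: hsubmxK.
Qed.

Lemma block_scale_continuous (a b : R) : continuous (block_scale a b).
Proof.
move=> z.
(* the final [1] keeps [M] positive when [a = b = 0] *)
pose M := `|a| + `|b| + 1.
have M0 : 0 < M by rewrite ltr_wpDl// addr_ge0.
have aM : `|a| <= M by rewrite /M; have := normr_ge0 b; lra.
have bM : `|b| <= M by rewrite /M; have := normr_ge0 a; lra.
apply/(@cvgrPdist_lt R P _ (nbhs z) (nbhs_filter z)) => e e0.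
apply/nbhs_ballP; exists (e / M) => /=; first by rewrite divr_gt0.
move=> y; rewrite -ball_normE/= ltr_pdivlMr// mulrC => h; apply: le_lt_trans h.
apply: rV_norm_le => [|i]; first by rewrite mulr_ge0// ltW.
have zy k : `|z ord0 k - y ord0 k| <= `|z - y|.
  by have := rV_coord_le (z - y) k; rewrite !mxE.
rewrite !mxE; case: splitP => j ij; rewrite !mxE -mulrBr normrM ler_pM//.
Qed.

Lemma block_scale_integral (a b : R) : 0 < a -> 0 < b ->
  exists2 k : R, 0 < k & forall F : P -> \bar R, measurable_fun setT F ->
    (forall x, 0 <= F x)%E ->
    (\int[leb]_x F (block_scale a b x) = k%:E * \int[leb]_x F x)%E.
Proof.
move=> a0 b0; pose c (i : 'I_(d + d)) := if fintype.split i is inl _ then a else b.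
have c0 i : 0 < c i by rewrite /c; case: (fintype.split i).
exists (\prod_i (c i)^-1); first by apply: prodr_gt0 => i _; rewrite invr_gt0.
move=> F mF F0; rewrite block_scaleE.
exact: ge0_integral_affine.
Qed.

Lemma B_tauE z : mxapp (B_tau d tau) z = block_scale (1 - tau)^-1 tau^-1 z.
Proof. by rewrite /B_tau mxapp_block !div1r. Qed.

Lemma U_tauE z : mxapp (U_tau d tau) z = - block_scale (tau / (1 - tau)) ((1 - tau) / tau) z.
Proof. by rewrite -mxapp_block /U_tau /mxapp mulNmx linearN. Qed.

Lemma B_tau_center w z :
  w - mxapp (U_tau d tau) z = mxapp (B_tau d tau) (wigner_center tau w z).
Proof.
rewrite B_tauE U_tauE opprK -{1}(hsubmxK w) /block_scale /wigner_center.
rewrite row_mxKl row_mxKr add_row_mx; have := lt0r_neq0 tau0; have := lt0r_neq0 tau1.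
move=> t1 t0; congr row_mx; apply/rowP => i; rewrite !mxE; field; by rewrite ?t0 ?t1.
Qed.

Lemma wigner_parameters_surj (p q : P) : exists w z,
  wigner_center tau w z = p /\ wigner_modulation w z = q.
Proof.
exists (row_mx (lsubmx p - tau *: rsubmx q) (rsubmx p + (1 - tau) *: lsubmx q)).
exists (row_mx (lsubmx p + (1 - tau) *: rsubmx q) (rsubmx p - tau *: lsubmx q)).
rewrite /wigner_center /wigner_modulation !row_mxKl !row_mxKr.
split; [rewrite -[RHS](hsubmxK p)|rewrite -[RHS](hsubmxK q)];
  congr row_mx; apply/rowP => i; rewrite !mxE; ring.
Qed.

Lemma Op_tau_stft (phi : 'rV[R]_d -> R[i]) (sigma : functional R (d + d)) w z :
  tempered sigma -> schwartz phi ->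
  cabs (Op_tau tau sigma (phase_shift z phi) (phase_shift w phi)) =
  cabs (stft (tau_wigner tau phi phi) sigma (wigner_center tau w z) (wigner_modulation w z)).
Proof.
move=> st sphi; rewrite /Op_tau wigner_covariance// temperedZ//.
  by rewrite cabsM cabsJ cabs_expi mul1r.
by apply: schwartz_tf_shift; exact: wigner_schwartz.
Qed.

Section weight.
Variable v : P -> R.
Hypothesis v_adm : admissible v.

(** [1 = v (z - z) <= v z * v (- z)]. *)
Lemma admissible_gt0 z : 0 < v z.
Proof.
rewrite lt_def (admissible_ge0 v_adm) andbT; apply/eqP => vz.
have := admissible_submultiplicative v_adm z (- z).
by rewrite subrr (admissible0 v_adm) vz mul0r ler10.
Qed.

Lemma weight_continuous : continuous (v \o mxapp (B_tau d tau)).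
Proof.
rewrite (_ : v \o _ = v \o block_scale (1 - tau)^-1 tau^-1); last first.
  by apply/funext => z /=; rewrite B_tauE.
move=> z; apply: continuous_comp; first exact: block_scale_continuous.
exact: (admissible_continuous v_adm).
Qed.

Variables (Phi : P -> R[i]) (sigma : functional R (d + d)).
Hypotheses (st : tempered sigma) (sPhi : schwartz Phi).
Local Notation u := (v \o mxapp (B_tau d tau)).

(** [H] is the supremum over the modulations, transported by [B_tau]. *)
Lemma amalgam_control :
  (forall g, schwartz g -> g <> (fun=> 0) -> amalgam g u sigma) -> Phi <> (fun=> 0) ->
  exists H, weighted_L1 v H /\
    forall p q, cabs (stft Phi sigma p q) <= H (mxapp (B_tau d tau) p).
Proof.
move=> amal Phi0.
have u0 z : 0 < u z by exact: admissible_gt0.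
have fin z : stft_sup sigma Phi z \is a fin_num.
  have [C hC] := stft_sup_finite st weight_continuous u0 z amal sPhi.
  rewrite ge0_fin_numE ?stft_sup_ge0//; apply: le_lt_trans (ltry C).
  by apply: ge_ereal_sup => _ [w _ <-]; rewrite lee_fin.
pose H z := fine (stft_sup sigma Phi (block_scale (1 - tau) tau z)).
have HB z : H (mxapp (B_tau d tau) z) = fine (stft_sup sigma Phi z).
  have := block_scaleK (invr_neq0 (lt0r_neq0 tau1)) (invr_neq0 (lt0r_neq0 tau0)) z.
  by rewrite !invrK /H B_tauE => ->.
have mH : measurable_fun setT H.
  apply: (measurableT_comp (fine_measurable measurableT)).
  apply: measurableT_comp; first exact: measurable_stft_sup.
  by rewrite block_scaleE; exact: measurable_rV_aff.
have H0 z : 0 <= H z by rewrite fine_ge0// stft_sup_ge0.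
exists H; split; last first.
  by move=> p q; rewrite HB -lee_fin fineK//; exact: stft_le_sup.
split=> //.
have i0 : 0 < (1 - tau)^-1 by rewrite invr_gt0.
have j0 : 0 < tau^-1 by rewrite invr_gt0.
have [k k0 hk] := block_scale_integral i0 j0.
pose F z := (`|H z| * v z)%:E.
have F0 z : (0 <= F z)%E by rewrite lee_fin mulr_ge0// ltW// admissible_gt0.
have mF : measurable_fun setT F.
  apply/measurable_EFinP; apply: measurable_funM; first exact: measurableT_comp.
  by apply: continuous_measurable_rV; exact: (admissible_continuous v_adm).
have [_] := amal _ sPhi Phi0.
rewrite [X in (X < _)%E -> _](_ : _ = \int[leb]_z F (block_scale (1 - tau)^-1 tau^-1 z))%E; last first.
  apply: eq_integral => z _; rewrite /F -B_tauE HB ger0_norm ?fine_ge0 ?stft_sup_ge0//.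
  by rewrite EFinM fineK.
rewrite hk//; apply: contraLR; rewrite -!leNgt !leye_eq => /eqP ->.
by rewrite gt0_muley ?lte_fin.
Qed.

Lemma control_amalgam H : weighted_L1 v H ->
  (forall p q, cabs (stft Phi sigma p q) <= H (mxapp (B_tau d tau) p)) ->
  amalgam Phi u sigma.
Proof.
move=> [mH Hoo] hH; split=> //.
have i0 : 0 < (1 - tau)^-1 by rewrite invr_gt0.
have j0 : 0 < tau^-1 by rewrite invr_gt0.
have [k k0 hk] := block_scale_integral i0 j0.
pose F z := (`|H z| * v z)%:E.
have F0 z : (0 <= F z)%E by rewrite lee_fin mulr_ge0// (admissible_ge0 v_adm).
have mF : measurable_fun setT F.
  apply/measurable_EFinP; apply: measurable_funM; first exact: measurableT_comp.
  by apply: continuous_measurable_rV; exact: (admissible_continuous v_adm).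
apply: (@le_lt_trans _ _ (\int[leb]_z F (block_scale (1 - tau)^-1 tau^-1 z))%E).
  apply: le_nnintegral => z.
    by rewrite mule_ge0 ?lee_fin ?(admissible_ge0 v_adm)//; exact: stft_sup_ge0.
  rewrite /F -B_tauE EFinM; apply: lee_wpmul2r.
    by rewrite lee_fin (admissible_ge0 v_adm).
  apply: ge_ereal_sup => _ [w _ <-]; rewrite lee_fin.
  exact: le_trans (hH z w) (ler_norm _).
rewrite hk// lte_mul_pinfty ?lee_fin ?(ltW k0)//.
Qed.

End weight.
End main.

Theorem theorem4p3 (R : realType) (d : nat) (v : 'rV[R]_(d + d) -> R)
    (phi : 'rV[R]_d -> R[i]) (tau : R) (G : 'rV[R]_(d + d) -> R[i])
    (v_adm : admissible v)
    (phi_S : schwartz phi) (phi_neq0 : phi <> (fun=> 0))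
    (tau01 : 0 < tau < 1)
    (G_S : schwartz G) (G_neq0 : G <> (fun=> 0))
    (G_indep : window_independent (v \o mxapp (B_tau d tau)))
    (sigma : functional R (d + d)) :
  amalgam G (v \o mxapp (B_tau d tau)) sigma <->
  (tempered sigma /\
   exists H : 'rV[R]_(d + d) -> R,
     weighted_L1 v H /\
     forall w z : 'rV[R]_(d + d),
       cabs (Op_tau tau sigma (phase_shift z phi) (phase_shift w phi))
         <= H (w - mxapp (U_tau d tau) z)).
Proof.
pose Phi := tau_wigner tau phi phi.
have sPhi : schwartz Phi by exact: wigner_schwartz.
have Phi0 : Phi <> (fun=> 0) by exact: wigner_neq0.
split=> [GA|[st [H [HL hH]]]].
  have st : tempered sigma by case: GA.
  split=> //.
  have amal g : schwartz g -> g <> (fun=> 0) -> amalgam g (v \o mxapp (B_tau d tau)) sigma.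
    by move=> sg g0; exact: (G_indep G g).
  have [H [HL hH]] := amalgam_control tau01 v_adm st sPhi amal Phi0.
  exists H; split=> // w z.
  by rewrite Op_tau_stft// (B_tau_center tau01).
apply: (G_indep Phi G) => //; apply: (control_amalgam tau01 v_adm st HL) => p q.
have [w [z [<- <-]]] := wigner_parameters_surj tau p q.
by rewrite -Op_tau_stft// -(B_tau_center tau01).
Qed.
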